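(* Let $G$ be a quasi-transitive nonamenable graph and let $p\in[0,1]$. Then almost surely every infinite cluster of Bernoulli$(p)$ percolation on $G$ is transient for simple random walk.
   Context: All graphs are connected, locally finite and infinite; multiple edges and loops are allowed. $G$ is quasi-transitive if $\mathrm{Aut}(G)$ has finitely many orbits on the vertex set. Under Bernoulli$(p)$ (bond) percolation each edge is open independently with probability $p$; clusters are the connected components of the open subgraph. *)

(* Defs.v *)
From HB Require Import structures.
From Stdlib Require Import Relation_Operators.
From mathcomp Require Import all_boot all_order all_algebra finmap.
From mathcomp Require Import all_classical all_reals all_analysis.

Set Implicit Arguments.
Unset Strict Implicit.
Unset Printing Implicit Defensive.

Import Order.TTheory GRing.Theory Num.Theory.

Local Open Scope classical_set_scope.
Local Open Scope ring_scope.

(* Undirected multigraph, loops and parallel edges allowed. The order of the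
   two endpoints of an edge is an arbitrary choice: every notion below is
   insensitive to it. *)
Record multigraph := Multigraph {
  vertex : choiceType;
  edge : choiceType;
  ends : edge -> vertex * vertex }.

Section Graph.
Variable G : multigraph.
Local Notation V := (vertex G).
Local Notation E := (edge G).

(* The two orientations of e are (e, false) and (e, true); a loop has two
   orientations as well, hence counts twice in the degree. *)
Definition dart : choiceType := (E * bool)%type.
Definition dart_tail (a : dart) : V := if a.2 then (ends a.1).2 else (ends a.1).1.
Definition dart_head (a : dart) : V := if a.2 then (ends a.1).1 else (ends a.1).2.

(* A set w of edges stands for the spanning subgraph (V, w). *)
Definition darts_from (w : set E) (x : V) : set dart :=
  [set a | w a.1 /\ dart_tail a = x].
Definition darts_between (w : set E) (x y : V) : set dart :=
  [set a | [/\ w a.1, dart_tail a = x & dart_head a = y]].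

Definition degree (w : set E) (x : V) : nat := #|` fset_set (darts_from w x)|.

Definition adjacent (w : set E) (x y : V) : Prop := darts_between w x y !=set0.

Definition cluster_of (w : set E) (x : V) : set V :=
  [set y | clos_refl_trans V (adjacent w) x y].
Definition is_cluster (w : set E) (C : set V) : Prop :=
  exists x, C = cluster_of w x.

Definition connected_graph : Prop := forall x y, cluster_of setT x y.
Definition locally_finite_graph : Prop :=
  forall x, finite_set (darts_from setT x).
Definition infinite_graph : Prop := infinite_set [set: V].

Definition is_automorphism (fV : V -> V) (fE : E -> E) : Prop :=
  [/\ bijective fV, bijective fE &
    forall e, ends (fE e) = (fV (ends e).1, fV (ends e).2) \/
              ends (fE e) = (fV (ends e).2, fV (ends e).1)].

Definition aut_orbit (x : V) : set V :=
  [set y | exists fV fE, is_automorphism fV fE /\ y = fV x].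
Definition quasi_transitive : Prop := finite_set (range aut_orbit).

Definition edge_boundary (K : {fset V}) : set E :=
  [set e | ((ends e).1 \in K) != ((ends e).2 \in K)].

Section Real.
Variable R : realType.

(* Infimum over nonempty finite K of |edge boundary of K| / (sum of degrees in K). *)
Definition cheeger_constant : R :=
  inf [set (#|` fset_set (edge_boundary K)|)%:R
             / (\sum_(v <- K) degree setT v)%N%:R
      | K in [set K : {fset V} | K != fset0]].
Definition nonamenable : Prop := 0 < cheeger_constant.

Definition bernoulli_percolation (p : R) d (T : measurableType d)
    (P : probability T R) (omega : T -> set E) : Prop :=
  let is_open e := [set t | omega t e] in
  [/\ forall e, measurable (is_open e),
      forall e, P (is_open e) = p%:E &
      forall F : {fset E}, P (\bigcap_(e in [set` F]) is_open e) =
                           (\prod_(e <- F) P (is_open e))%E].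

(* All values are 0 when x has degree 0 in w: simple random walk is only
   meaningful on clusters that contain an edge, e.g. the infinite ones. *)
Definition srw_step (w : set E) (x y : V) : R :=
  (#|` fset_set (darts_between w x y)|)%:R / (degree w x)%:R.

(* Finite-dimensional laws of simple random walk on (V, w) started from x; the
   walk stays in the w-cluster of x. *)
Definition is_srw (w : set E) (x : V) d (T : measurableType d)
    (Q : probability T R) (X : nat -> T -> V) : Prop :=
  (forall n y, measurable (X n @^-1` [set y])) /\
  (forall n (z : nat -> V),
     Q [set t | forall i, (i <= n)%N -> X i t = z i] =
     ((z 0%N == x)%:R * \prod_(i < n) srw_step w (z i) (z i.+1))%:E).

(* The walk returns to its starting point with probability < 1. This probability
   depends only on w and x, since is_srw determines the law of X. *)
Definition transient_cluster (w : set E) (C : set V) : Prop :=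
  forall x, C x ->
  forall d (T : measurableType d) (Q : probability T R) (X : nat -> T -> V),
    is_srw w x Q X ->
    (Q [set t | exists2 n, (0 < n)%N & X n t = x] < 1)%E.

End Real.
End Graph.

Arguments nonamenable G R : clear implicits.

(* Main.v *)
(** For a finite vertex set [U] and a vertex [o] of [U], let [capO] be the supremum
of [2 * mass - energy] over measures on finite open routes from [o] to the
complement of [U]. It is at most the Dirichlet energy of every function that is
supported in [U] and equals [1] at [o], hence it tends to [0] as [U] grows when
the cluster of [o] is recurrent. So it suffices to bound, uniformly in large [U],
the probability that [o] is connected to the complement of [U] while
[capO < 1 / (16 r)].

Let [capA] be the similar quantity for routes that leave a set [A] through a
contact edge, which need not be open and costs [r] times its squared flow. If
[capA] has expectation at least [|A| / (K r)] for all [A] in [U], take for [A] the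
ball of radius [r] around [o] in the cluster of [o]. With high probability [A] has
at least [M r] points, because small spheres could be closed at bounded cost, and
[capA] is concentrated by the Efron-Stein inequality, because it is independent of
the edges touching [A]. If moreover [capO < 1 / (16 r)], then opening any one out
of a positive proportion of the contact edges increases [capO] by order [1 / r],
whereas every configuration has only [O(r)] open edges with such an influence; by
insertion tolerance this event has probability [O(1 / M)].

The bound on the expectation of [capA] has two cases. If the connection
probabilities are bounded below, then nonamenability and the marriage theorem
provide injective random words spreading from [A], and connecting their
successive points gives routes with a bounded second moment by the Harris
inequality. Otherwise some three points of every large ball have a positive
probability to reach the complement of [U] in distinct clusters. The Burton-Keane
argument turns the resulting trifurcations into as many disjoint branches, whose
capacities are bounded below by a bootstrap that applies the previous paragraph
with decreasing [r]. *)

Require Import Defs.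
From HB Require Import structures.
From mathcomp Require Import all_boot all_order all_algebra finmap.
From mathcomp Require Import all_classical all_reals all_analysis.
From Stdlib Require Import Relation_Operators Operators_Properties.
From mathcomp Require Import ring lra zify.

Set Implicit Arguments.
Unset Strict Implicit.
Unset Printing Implicit Defensive.

Import Order.TTheory GRing.Theory Num.Theory.

Local Open Scope classical_set_scope.
Local Open Scope ring_scope.

(** * Product Bernoulli measure on finitely many edges *)

Section Indicator.
Variable R : realType.

(** Deleting an edge lowers a capacity by at most twice the load that a near-optimal measure puts on
    it, up to a small error, and the squared loads add up to at most the capacity. This one estimate
    gives both the variance bound behind the concentration and the count of edges with a large
    influence. The cost [r] of a contact edge stands for the path inside the ball that joins the
    contact to [o], of at most [r] edges. It also forces a measure of large mass to spread over a
    number of contacts of order [|A|]; against [O(r)] influential edges, [|A| >= M r] gives the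
    factor [1 / M]. Losses do not accumulate in the bootstrap: at each [r] the probability of
    splitting is recovered from the same lower bound for three ends. A third case completes the two
    of the overview: if the probability of leaving [U] is not bounded below uniformly in the
    starting point, it tends to 0 for every starting point as [U] grows, and weak escapes are rare
    because all escapes are. The values [p = 0] and [p = 1], where edges cannot be both opened and
    closed at bounded cost, are treated apart. *)

Definition ind (P : Prop) : R := (`[< P >])%:R.

Lemma ind_ge0 P : 0 <= ind P. Proof. by rewrite /ind ler0n. Qed.
Lemma ind_le1 P : ind P <= 1. Proof. by rewrite /ind; case: asbool. Qed.
Lemma indT (P : Prop) : P -> ind P = 1.
Proof. by move=> h; rewrite /ind asboolT. Qed.
Lemma indF (P : Prop) : ~ P -> ind P = 0.
Proof. by move=> h; rewrite /ind asboolF. Qed.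
Lemma ind_le (P Q : Prop) : (P -> Q) -> ind P <= ind Q.
Proof.
move=> h; have [p|p] := pselect P; first by rewrite (indT p) (indT (h p)).
by rewrite (indF p) ind_ge0.
Qed.
Lemma ind_eq (P Q : Prop) : (P <-> Q) -> ind P = ind Q.
Proof. by move=> h; rewrite (propext h). Qed.
Lemma ind_and (P Q : Prop) : ind (P /\ Q) = ind P * ind Q.
Proof.
have [p|p] := pselect P; last by rewrite (indF p) mul0r indF // => -[].
by rewrite (indT p) mul1r; apply: ind_eq; split=> [[]|].
Qed.
Lemma ind_not (P : Prop) : ind (~ P) = 1 - ind P.
Proof.
have [p|p] := pselect P; first by rewrite (indT p) subrr indF.
by rewrite (indF p) subr0 indT.
Qed.
Lemma ind_or_le (P Q : Prop) : ind (P \/ Q) <= ind P + ind Q.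
Proof.
have [p|p] := pselect P; first by rewrite (indT p) (le_trans (ind_le1 _))// lerDl ind_ge0.
by rewrite (indF p) add0r; apply: ind_le => -[].
Qed.
End Indicator.
Arguments ind {R} P.

Section Bernoulli.
Variables (R : realType) (E : choiceType) (p : R).
Implicit Types (l : seq E) (f g : set E -> R).

(** Expectation over a random subset of the list [l], each entry being kept with probability [p]. A
    repeated entry gets several independent chances, whence the [uniq] hypotheses below. *)
Fixpoint Ex l f : R :=
  if l is e :: l' then p * Ex l' (fun s => f (e |` s)) + (1 - p) * Ex l' f
  else f set0.

Definition Pr l (P : set E -> Prop) : R := Ex l (fun s => ind (P s)).

Lemma subset_cons e l (s : set E) :
  s `<=` [set` l] -> s `<=` [set` e :: l].
Proof. by move=> h x /h /= xl; rewrite inE xl orbT. Qed.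

Lemma subset_cons1 e l (s : set E) :
  s `<=` [set` l] -> e |` s `<=` [set` e :: l].
Proof. by move=> h x [->|/h /= xl] /=; rewrite inE ?eqxx ?xl ?orbT. Qed.

Lemma Ex_ext l f g : (forall s, s `<=` [set` l] -> f s = g s) -> Ex l f = Ex l g.
Proof.
elim: l f g => [|e l IH] f g h /=; first exact: h.
congr (_ * _ + _ * _); apply: IH => s sl; apply: h; first exact: subset_cons1.
exact: subset_cons.
Qed.

Lemma ExD l f g : Ex l (fun s => f s + g s) = Ex l f + Ex l g.
Proof. by elim: l f g => [//|e l IH] f g /=; rewrite !IH; ring. Qed.

Lemma ExZ l c f : Ex l (fun s => c * f s) = c * Ex l f.
Proof. by elim: l f => [//|e l IH] f /=; rewrite !IH; ring. Qed.

Lemma Ex_cst l c : Ex l (fun=> c) = c.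
Proof. by elim: l => [//|e l /= ->]; ring. Qed.

Lemma ExB l f g : Ex l (fun s => f s - g s) = Ex l f - Ex l g.
Proof. by elim: l f g => [//|e l IH] f g /=; rewrite !IH; ring. Qed.

Lemma Ex_sum l I (r : seq I) (F : I -> set E -> R) :
  Ex l (fun s => \sum_(i <- r) F i s) = \sum_(i <- r) Ex l (F i).
Proof.
elim: r => [|i r IH].
  by rewrite big_nil -[RHS](Ex_cst l); apply: Ex_ext => s _; rewrite big_nil.
by rewrite big_cons -IH -ExD; apply: Ex_ext => s _; rewrite big_cons.
Qed.

Lemma Ex_cat l1 l2 f :
  Ex (l1 ++ l2) f = Ex l1 (fun s1 => Ex l2 (fun s2 => f (s1 `|` s2))).
Proof.
elim: l1 f => [|e l1 IH] f /=; first by apply: Ex_ext => s _; rewrite set0U.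
rewrite !IH; congr (_ * _ + _ * _); apply: Ex_ext => s1 _; apply: Ex_ext => s2 _.
by rewrite setUA.
Qed.

Lemma Ex_exchange l1 l2 (F : set E -> set E -> R) :
  Ex l1 (fun s1 => Ex l2 (F s1)) = Ex l2 (fun s2 => Ex l1 (F^~ s2)).
Proof.
elim: l1 F => [//|e l1 IH] F /=.
by rewrite (IH (fun s1 => F (e |` s1))) IH ExD !ExZ.
Qed.

Lemma Ex_perm l1 l2 f : perm_eq l1 l2 -> Ex l1 f = Ex l2 f.
Proof.
move: l1 l2; apply: catCA_perm_subst => l1 l2 l3.
rewrite !Ex_cat; under [in LHS]Ex_ext => s1 _ do rewrite Ex_cat.
under [in RHS]Ex_ext => s1 _ do rewrite Ex_cat.
rewrite Ex_exchange; apply: Ex_ext => s1 _; apply: Ex_ext => s2 _.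
by apply: Ex_ext => s3 _; rewrite setUCA.
Qed.

Lemma Ex_split l e f : e \in l ->
  Ex l f = p * Ex (rem e l) (fun s => f (e |` s)) + (1 - p) * Ex (rem e l) f.
Proof. by move=> el; rewrite (Ex_perm _ (perm_to_rem el)). Qed.

Definition depends f (X : set E) := forall s s', s `&` X = s' `&` X -> f s = f s'.

Lemma depends_setU1 f X e : depends f X -> depends (fun s => f (e |` s)) X.
Proof. by move=> h s s' ss'; apply: h; rewrite !setIUl ss'. Qed.

Lemma depends_out f X e s : depends f X -> ~ X e -> f (e |` s) = f s.
Proof.
move=> h Xe; apply: h; rewrite setIUl; apply/seteqP; split=> x /=.
  by move=> [[->]|].
by move=> sx; right.
Qed.

Lemma Ex_indep l f g X : depends f X -> depends g (~` X) ->
  Ex l (fun s => f s * g s) = Ex l f * Ex l g.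
Proof.
elim: l f g => [//|e l IH] f g hf hg /=.
rewrite (IH (fun s => f (e |` s)) (fun s => g (e |` s)))//; try exact: depends_setU1.
rewrite IH//; have [Xe|Xe] := pselect (X e).
  have -> : Ex l (fun s => g (e |` s)) = Ex l g.
    by apply: Ex_ext => s _; apply: (depends_out _ hg) => /(_ Xe).
  ring.
have -> : Ex l (fun s => f (e |` s)) = Ex l f.
  by apply: Ex_ext => s _; apply: (depends_out _ hf).
ring.
Qed.

Fixpoint confs l : seq (set E) :=
  if l is e :: l' then [seq e |` s | s <- confs l'] ++ confs l' else [:: set0].

Lemma Ex_confs l f g : (forall s, s \in confs l -> f s = g s) -> Ex l f = Ex l g.
Proof.
elim: l f g => [|e l IH] f g h /=; first by apply: h; rewrite inE.
congr (_ * _ + _ * _); apply: IH => s sl; apply: h; rewrite mem_cat.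
  by rewrite map_f.
by rewrite sl orbT.
Qed.

(** Law of total expectation; finitely many values suffice because [confs l] lists all
    configurations. It serves to condition on an explored ball. *)
Lemma Ex_partition l (T : eqType) (A : set E -> T) : exists vals : seq T,
  uniq vals /\
  forall f, Ex l f = \sum_(a <- vals) Ex l (fun s => ind (A s = a) * f s).
Proof.
exists (undup [seq A s | s <- confs l]); split; first exact: undup_uniq.
move=> f; rewrite -Ex_sum; apply: Ex_confs => s sl.
rewrite (bigD1_seq (A s)) ?undup_uniq ?mem_undup ?map_f//=.
rewrite indT// mul1r big1 ?addr0// => a ha; rewrite indF ?mul0r// => Aa.
by rewrite Aa eqxx in ha.
Qed.

Lemma Ex_map (phi : E -> E) l f :
  Ex (map phi l) f = Ex l (fun s => f (phi @` s)).
Proof.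
elim: l f => [|e l IH] f /=; first by rewrite image_set0.
rewrite !IH; congr (_ * _ + _ * _); apply: Ex_ext => s _.
by rewrite image_setU image_set1.
Qed.

Hypotheses (p0 : 0 <= p) (p1 : p <= 1).

Lemma Ex_le l f g : (forall s, s `<=` [set` l] -> f s <= g s) -> Ex l f <= Ex l g.
Proof.
elim: l f g => [|e l IH] f g h /=; first exact: h.
apply: lerD; apply: ler_wpM2l; rewrite ?subr_ge0//; apply: IH => s sl; apply: h.
  exact: subset_cons1.
exact: subset_cons.
Qed.

Lemma Ex_ge0 l f : (forall s, s `<=` [set` l] -> 0 <= f s) -> 0 <= Ex l f.
Proof. by move=> h; rewrite -(Ex_cst l 0); apply: Ex_le. Qed.

Lemma Pr_ge0 l P : 0 <= Pr l P. Proof. by apply: Ex_ge0 => s _; exact: ind_ge0. Qed.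

Lemma Pr_le l (P Q : set E -> Prop) :
  (forall s, s `<=` [set` l] -> P s -> Q s) -> Pr l P <= Pr l Q.
Proof. by move=> h; apply: Ex_le => s sl; apply: ind_le; exact: h. Qed.

Lemma Pr_or l (P Q : set E -> Prop) :
  Pr l (fun s => P s \/ Q s) <= Pr l P + Pr l Q.
Proof. by rewrite /Pr -ExD; apply: Ex_le => s sl; exact: ind_or_le. Qed.

Lemma Pr_exists l (T : eqType) (r : seq T) (P : T -> set E -> Prop) :
  Pr l (fun s => exists2 x, x \in r & P x s) <= \sum_(x <- r) Pr l (P x).
Proof.
rewrite /Pr -Ex_sum; apply: Ex_le => s _.
elim: r => [|x r IH]; first by rewrite big_nil indF// => -[].
rewrite big_cons; apply: le_trans (lerD (lexx _) IH).
apply: le_trans (ind_or_le _ _ _); apply: ind_le => -[y].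
rewrite inE => /orP[/eqP ->|yr] Py; [by left|by right; exists y].
Qed.

Lemma markov_Pr l f (c : R) (P : set E -> Prop) : 0 <= c ->
  (forall s, s `<=` [set` l] -> 0 <= f s) ->
  (forall s, s `<=` [set` l] -> P s -> c <= f s) -> c * Pr l P <= Ex l f.
Proof.
move=> c0 f0 h; rewrite /Pr -ExZ; apply: Ex_le => s sl.
have [Ps|nPs] := pselect (P s); first by rewrite indT// mulr1; exact: h.
by rewrite indF// mulr0; exact: f0.
Qed.

Definition increasing f := forall s s' : set E, s `<=` s' -> f s <= f s'.

Lemma increasing_setU1 f e : increasing f -> increasing (fun s => f (e |` s)).
Proof. by move=> h s s' ss'; apply: h; apply: setUS. Qed.

(** Induction on the edges. Once the induction hypothesis is applied with the first edge open and
    with it closed, the remaining defect is the covariance of two increasing functions of this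
    single edge: [p (1 - p)] times the product of two nonnegative increments. *)
Lemma harris l f g : increasing f -> increasing g ->
  Ex l f * Ex l g <= Ex l (fun s => f s * g s).
Proof.
elim: l f g => [//|e l IH] f g hf hg /=.
have h1 := IH _ _ (@increasing_setU1 f e hf) (@increasing_setU1 g e hg).
have h0 := IH _ _ hf hg.
have lef : Ex l f <= Ex l (fun s => f (e |` s)).
  by apply: Ex_le => s _; apply: hf; exact: subsetUr.
have leg : Ex l g <= Ex l (fun s => g (e |` s)).
  by apply: Ex_le => s _; apply: hg; exact: subsetUr.
have q0 : 0 <= 1 - p by rewrite subr_ge0.
apply: le_trans (lerD (ler_wpM2l p0 h1) (ler_wpM2l q0 h0)).
rewrite -subr_ge0; set a := Ex l _ in lef *; set b := Ex l _ in leg *.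
set a' := Ex l _ in lef *; set b' := Ex l _ in leg *.
rewrite (_ : _ - _ = p * (1 - p) * ((a' - a) * (b' - b))); last by ring.
by rewrite !mulr_ge0 ?subr_ge0.
Qed.

Lemma increasing_ind (P : set E -> Prop) :
  (forall s s' : set E, s `<=` s' -> P s -> P s') -> increasing (fun s => ind (P s)).
Proof. by move=> h s s' ss'; apply: ind_le; exact: h. Qed.

Lemma harris_Pr l (P Q : set E -> Prop) :
  (forall s s' : set E, s `<=` s' -> P s -> P s') ->
  (forall s s' : set E, s `<=` s' -> Q s -> Q s') ->
  Pr l P * Pr l Q <= Pr l (fun s => P s /\ Q s).
Proof.
move=> hP hQ; apply: le_trans (harris _ (increasing_ind hP) (increasing_ind hQ)) _.
by apply: Ex_le => s _; rewrite ind_and.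
Qed.

Lemma Ex_sub l l' f : increasing f -> uniq l -> {subset l <= l'} ->
  Ex l f <= Ex l' f.
Proof.
move=> hf ul; elim: l ul l' f hf => [|e l IH] /= ul l' f hf ll'.
  by rewrite -(Ex_cst l' (f set0)); apply: Ex_le => s _; apply: hf.
rewrite (Ex_split (l := l') f (ll' e _)) ?inE ?eqxx//.
case/andP: ul => el ul.
have sub : {subset l <= rem e l'}.
  move=> x xl; have xe : x != e by apply: contraNneq el => <-.
  have := ll' x; rewrite inE xl orbT => /(_ isT) xl'.
  by move: xl'; rewrite (perm_mem (perm_to_rem (ll' e (mem_head _ _)))) inE (negbTE xe).
apply: lerD; apply: ler_wpM2l; rewrite ?subr_ge0//; apply: IH => //.
exact: increasing_setU1.
Qed.

Lemma Pr_sub l l' (P : set E -> Prop) :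
  (forall s s' : set E, s `<=` s' -> P s -> P s') -> uniq l ->
  {subset l <= l'} -> Pr l P <= Pr l' P.
Proof. by move=> hP ul ll'; apply: Ex_sub => //; exact: increasing_ind. Qed.

Lemma Ex_depends_eq l l' f X : depends f X -> uniq l -> uniq l' ->
  (forall e, X e -> (e \in l) = (e \in l')) -> Ex l f = Ex l' f.
Proof.
move=> hf.
have hX k : Ex k f = Ex [seq e <- k | e \in X] f.
  have : perm_eq k ([seq e <- k | e \in X] ++ [seq e <- k | e \notin X]).
    by rewrite perm_sym; apply/permPl; exact: perm_filterC.
  move/Ex_perm ->; rewrite Ex_cat; apply: Ex_ext => s1 _.
  rewrite -[RHS](Ex_cst [seq e <- k | e \notin X]); apply: Ex_ext => s2 hs2.
  apply: hf; rewrite setIUl; apply/seteqP; split=> x /=.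
    move=> [//|[/hs2 /=]]; rewrite mem_filter => /andP[+ _] Xx.
    by rewrite mem_set.
  by move=> ?; left.
move=> ul ul' h; rewrite hX [RHS]hX; apply: Ex_perm; apply: uniq_perm.
- exact: filter_uniq.
- exact: filter_uniq.
- move=> e; rewrite !mem_filter; case: (boolP (e \in X)) => //= eX.
  by apply: h; rewrite inE in eX.
Qed.

Lemma Pr_closed l (X : set E) n : (count [in X] l <= n)%N ->
  (1 - p) ^+ n <= Pr l (fun s => s `&` X = set0).
Proof.
have q0 : 0 <= 1 - p by rewrite subr_ge0.
have q1 : 1 - p <= 1 by rewrite gerBl.
elim: l n => [|e l IH] n /=.
  by move=> _; rewrite /Pr /= indT ?set0I// exprn_ile1.
rewrite /Pr /=; case: (boolP (e \in X)) => eX /=.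
  case: n => [|n]; rewrite ?ltnS// => hn; rewrite exprS.
  apply: ler_wpDl; last by apply: ler_wpM2l => //; exact: IH.
  by rewrite mulr_ge0// Ex_ge0// => s _; exact: ind_ge0.
rewrite add0n => hn.
have -> : Ex l (fun s => ind ((e |` s) `&` X = set0)) =
          Ex l (fun s => ind (s `&` X = set0) : R).
  apply: Ex_ext => s _; apply: ind_eq; rewrite setIUl.
  by have -> : [set e] `&` X = set0;
    [rewrite -subset0 => x [-> Xe]; rewrite notin_setE in eX|rewrite set0U].
by rewrite -mulrDl (_ : p + (1 - p) = 1) ?mul1r; [exact: IH|ring].
Qed.

Lemma Pr_open l (X : set E) n : X `<=` [set` l] -> (count [in X] l <= n)%N ->
  p ^+ n <= Pr l (fun s => X `<=` s).
Proof.
elim: l X n => [|e l IH] X n /=.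
  by move=> X0 _; rewrite /Pr /= indT ?exprn_ile1// => x /X0.
move=> Xl; rewrite /Pr /=; case: (boolP (e \in X)) => eX /= hn.
  case: n hn => [//|n]; rewrite ltnS => hn; rewrite exprS.
  apply: ler_wpDr; first by rewrite mulr_ge0 ?subr_ge0// Ex_ge0// => s _; exact: ind_ge0.
  apply: ler_wpM2l => //.
  have [el|el] := boolP (e \in l).
    apply: le_trans (IH X n _ hn) _; first by move=> x /Xl /=; rewrite inE => /orP[/eqP->|].
    by apply: Pr_le => s _ Xs x /Xs; right.
  apply: le_trans (IH (X `\ e) n _ _) _.
  - by move=> x [/Xl /=]; rewrite inE => /orP[/eqP->|].
  - by apply: leq_trans hn; apply: sub_count => x; rewrite !inE => -[].
  apply: Pr_le => s _ Xs x Xx; have [->|xe] := eqVneq x e; [by left|right].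
  by apply: Xs; split=> //; apply/eqP.
rewrite add0n in hn.
have h0 : p ^+ n <= Pr l (fun s => X `<=` s).
  apply: IH => // x Xx; move: (Xl x Xx); rewrite /= inE => /orP[/eqP xe|//].
  by exfalso; move/negP: eX; apply; rewrite inE -xe.
have h1 : Pr l (fun s => X `<=` s) <= Pr l (fun s => X `<=` e |` s).
  by apply: Pr_le => s _ Xs x /Xs; right.
rewrite (_ : p ^+ n = p * p ^+ n + (1 - p) * p ^+ n); last by ring.
apply: lerD; apply: ler_wpM2l; rewrite ?subr_ge0//; exact: le_trans h0 h1.
Qed.

Lemma Ex_variance l f :
  Ex l (fun s => (f s - Ex l f) ^+ 2) = Ex l (fun s => f s ^+ 2) - (Ex l f) ^+ 2.
Proof.
set m := Ex l f.
rewrite (@Ex_ext _ _ (fun s => f s ^+ 2 + (- (2 * m) * f s + m ^+ 2))); last by move=> s _; ring.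
by rewrite (ExD l (fun s => f s ^+ 2)) (ExD l (fun s => - (2 * m) * f s)) ExZ Ex_cst -/m; ring.
Qed.

Lemma Ex_sqr l f : (Ex l f) ^+ 2 <= Ex l (fun s => f s ^+ 2).
Proof.
by rewrite -subr_ge0 -Ex_variance; apply: Ex_ge0 => s _; exact: sqr_ge0.
Qed.

(** Conditioning on the first edge splits the variance into the mean of the two conditional
    variances, handled by induction, and [p (1 - p)] times the squared difference of the conditional
    means, which Jensen's inequality bounds by the term of this edge. *)
Lemma efron_stein l f : uniq l ->
  Ex l (fun s => f s ^+ 2) - (Ex l f) ^+ 2 <=
  \sum_(e <- l) Ex l (fun s => ind (s e) * (f s - f (s `\ e)) ^+ 2).
Proof.
elim: l f => [|e l IH] f; first by rewrite big_nil /= subrr.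
move=> /= /andP[el ul]; rewrite big_cons.
have nel s : s `<=` [set` l] -> ~ s e by move=> sl /sl /=; apply/negP.
pose f1 s := f (e |` s).
have h1 := IH f1 ul; have h0 := IH f ul.
have q0 : 0 <= 1 - p by rewrite subr_ge0.
set S1 := \sum_(e <- l) _ in h1; set S0 := \sum_(e <- l) _ in h0.
have He : Ex l (fun s => ind ((e |` s) e) * (f (e |` s) - f ((e |` s) `\ e)) ^+ 2) =
    Ex l (fun s => (f1 s - f s) ^+ 2).
  apply: Ex_ext => s /nel se; rewrite indT ?mul1r; last by left.
  congr ((_ - f _) ^+ 2); apply/seteqP; split=> x /=; first by move=> [[]].
  by move=> sx; split; [right|move=> xe; rewrite xe in sx].
have He0 : 0 <= Ex l (fun s => ind (s e) * (f s - f (s `\ e)) ^+ 2).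
  by apply: Ex_ge0 => s _; rewrite mulr_ge0 ?ind_ge0 ?sqr_ge0.
have Hs : \sum_(j <- l) (p * Ex l (fun s => ind ((e |` s) j) *
     (f (e |` s) - f ((e |` s) `\ j)) ^+ 2) +
     (1 - p) * Ex l (fun s => ind (s j) * (f s - f (s `\ j)) ^+ 2)) = p * S1 + (1 - p) * S0.
  rewrite big_split -!mulr_sumr /=; congr (_ * _ + _).
  rewrite [LHS]big_seq [RHS]big_seq; apply: eq_bigr => j jl.
  have je : j != e by apply: contraNneq el => <-.
  apply: Ex_ext => s _; congr (_ * (_ - f _) ^+ 2).
    by apply: ind_eq; split=> [[/= jee|//]|]; [rewrite jee eqxx in je|right].
  apply/seteqP; split=> x /=; first by move=> [[->|sx] xj]; [left|right].
  by move=> [->|[sx xj]]; split; [left|apply/eqP; rewrite eq_sym|right|].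
rewrite He Hs -/f1.
have hsq := Ex_sqr l (fun s => f1 s - f s); rewrite ExB in hsq.
set a1 := Ex l f1 in h1 hsq *; set a0 := Ex l f in h0 hsq *.
set b1 := Ex l (fun s => f1 s ^+ 2) in h1 *; set b0 := Ex l (fun s => f s ^+ 2) in h0 *.
set d := Ex l (fun s => (f1 s - f s) ^+ 2) in hsq *.
set He' := Ex l (fun s => ind (s e) * _) in He0 *.
have e1 : p * b1 + (1 - p) * b0 - (p * a1 + (1 - p) * a0) ^+ 2 =
  p * (b1 - a1 ^+ 2) + (1 - p) * (b0 - a0 ^+ 2) + p * ((1 - p) * (a1 - a0) ^+ 2) by ring.
rewrite e1.
have h2 : p * ((1 - p) * (a1 - a0) ^+ 2) <= p * d.
  apply: ler_wpM2l => //; apply: le_trans hsq.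
  by rewrite ler_piMl ?sqr_ge0// gerBl.
have h3 := ler_wpM2l p0 h1; have h4 := ler_wpM2l q0 h0.
have h5 := mulr_ge0 q0 He0.
lra.
Qed.

(** The edge [e] is independent of the others, so opening it trades a factor [1 - p] for a factor
    [p]. This is insertion tolerance as an exact identity. *)
Lemma insertion l e (h : set E -> R) : uniq l -> e \in l ->
  p * Ex l (fun s => ind (~ s e) * h (e |` s)) = (1 - p) * Ex l (fun s => ind (s e) * h s).
Proof.
move=> ul el; rewrite !(Ex_split _ el).
have nel s : s `<=` [set` rem e l] -> ~ s e.
  by move=> sl /sl /=; rewrite mem_rem_uniq// inE eqxx.
rewrite (@Ex_ext _ (fun s => ind (~ (e |` s) e) * _) (fun=> 0)); last first.
  by move=> s _; rewrite indF ?mul0r//; apply; left.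
rewrite (@Ex_ext _ (fun s => ind (s e) * _) (fun=> 0)); last first.
  by move=> s /nel se; rewrite indF ?mul0r.
rewrite !Ex_cst !mulr0 add0r addr0.
rewrite (@Ex_ext _ (fun s => ind (~ s e) * _) (fun s => h (e |` s))); last first.
  by move=> s /nel se; rewrite indT ?mul1r.
rewrite [in RHS](@Ex_ext _ _ (fun s => h (e |` s))); last first.
  by move=> s _; rewrite indT ?mul1r//; left.
ring.
Qed.

(** Chebyshev's inequality at distance half the mean. The 8 is the constant that the Efron-Stein
    inequality yields for capacities, and [32 = 4 * 8]. *)
Lemma chebyshev_lower l f : uniq l -> (forall s, s `<=` [set` l] -> 0 <= f s) ->
  Ex l (fun s => f s ^+ 2) - (Ex l f) ^+ 2 <= 8 * Ex l f ->
  Ex l f * Pr l (fun s => f s < Ex l f / 2) <= 32.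
Proof.
move=> ul f0 hv; set m := Ex l f in hv *.
have m0 : 0 <= m by exact: Ex_ge0.
have [->|mn0] := eqVneq m 0; first by rewrite mul0r ler0n.
have mgt0 : 0 < m by rewrite lt_neqAle eq_sym mn0.
have := @markov_Pr l (fun s => (f s - m) ^+ 2) ((m / 2) ^+ 2) (fun s => f s < m / 2).
move=> /(_ (sqr_ge0 _)) /(_ (fun s _ => sqr_ge0 _)).
have h : forall s, s `<=` [set` l] -> f s < m / 2 -> (m / 2) ^+ 2 <= (f s - m) ^+ 2.
  move=> s sl fs; have := f0 s sl => f0s.
  rewrite -[(f s - m) ^+ 2]sqrrN opprB; rewrite ler_sqr ?nnegrE; lra.
move=> /(_ h); rewrite Ex_variance -/m => hm.
have : (m / 2) ^+ 2 * Pr l (fun s => f s < m / 2) <= 8 * m.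
  exact: le_trans hm hv.
rewrite (_ : (m / 2) ^+ 2 * _ = m / 4 * (m * Pr l (fun s => f s < m / 2))); last by field.
set P := m * Pr _ _ => hP.
have : m / 4 * P <= m / 4 * 32 by lra.
by rewrite ler_pM2l// divr_gt0.
Qed.

End Bernoulli.

(** * Paths and balls *)

Section CardinalOfSets.
Variable T : choiceType.
Implicit Types A B : set T.

Definition nb A : nat := #|` fset_set A|.

Lemma nb_le A B : finite_set B -> A `<=` B -> (nb A <= nb B)%N.
Proof.
move=> fB AB; apply: fsubset_leq_card.
by rewrite -fset_set_sub//; exact: sub_finite_set AB fB.
Qed.

Lemma nb_seq (s : seq T) A : A `<=` [set` s] -> (nb A <= size s)%N.
Proof.
move=> As; rewrite /nb; apply: (@uniq_leq_size _ (enum_fset (fset_set A))) => [|x].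
  exact: fset_uniq.
have fA : finite_set A by apply: sub_finite_set As _; exact: finite_seq.
by rewrite in_fset_set// inE => /As.
Qed.

Lemma enum_setP A : finite_set A ->
  exists r : seq T, [/\ uniq r, size r = nb A & forall x, (x \in r) <-> A x].
Proof.
move=> fA; exists (enum_fset (fset_set A)); split=> //.
by move=> x; rewrite in_fset_set// inE.
Qed.

Lemma nb_setU A B : finite_set A -> finite_set B -> (nb (A `|` B) <= nb A + nb B)%N.
Proof. by move=> fA fB; rewrite /nb fset_setU// cardfsU leq_subr. Qed.

Lemma nb_gt0 A : finite_set A -> A !=set0 -> (0 < nb A)%N.
Proof.
move=> fA [x Ax]; rewrite cardfs_gt0; apply/fset0Pn; exists x.
by rewrite in_fset_set// inE.
Qed.

Lemma nb_disjoint A B : finite_set A -> finite_set B -> A `&` B = set0 ->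
  nb (A `|` B) = (nb A + nb B)%N.
Proof.
move=> fA fB AB; rewrite /nb fset_setU// cardfsU -fset_setI// AB fset_set0.
by rewrite cardfs0 subn0.
Qed.

End CardinalOfSets.

Lemma nb_image (T U : choiceType) (f : T -> U) (A : set T) :
  finite_set A -> (nb (f @` A) <= nb A)%N.
Proof.
move=> /enum_setP[r [_ <- rA]]; rewrite -(size_map f); apply: nb_seq.
by move=> _ [x /rA xr <-] /=; exact: map_f.
Qed.

Lemma nb_bigcup (T T' : choiceType) (A : set T) (F : T -> set T') D : finite_set A ->
  (forall x, A x -> finite_set (F x) /\ (nb (F x) <= D)%N) ->
  finite_set (\bigcup_(x in A) F x) /\ (nb (\bigcup_(x in A) F x) <= D * nb A)%N.
Proof.
move=> fA hF; split; first by apply: bigcup_finite => // x /hF[].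
have [r [_ <- rA]] := enum_setP fA.
pose s := flatten [seq enum_fset (fset_set (F x)) | x <- r].
apply: (@leq_trans (size s)).
  apply: nb_seq => e [x Ax ex]; apply/flattenP.
  exists (enum_fset (fset_set (F x))); first by apply: map_f; exact/rA.
  by rewrite in_fset_set ?inE//; case: (hF x Ax).
rewrite /s; have : forall x, x \in r -> (nb (F x) <= D)%N by move=> x /rA/hF[].
elim: r {rA s} => [//|x r IH] h /=.
rewrite size_cat mulnS; apply: leq_add; first by apply: h; exact: mem_head.
by apply: IH => y yr; apply: h; rewrite inE yr orbT.
Qed.

(** * Connections, exits from a vertex set, and balls in a configuration *)

Section Graph.
Variable G : multigraph.
Local Notation V := (vertex G).
Local Notation E := (edge G).
Implicit Types (w : set E) (x y z u : V) (A B : set V) (e : E).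

Definition joins e x y := ends e = (x, y) \/ ends e = (y, x).
Definition touch A : set E := [set e | A (ends e).1 \/ A (ends e).2].
Definition inside A : set E := [set e | A (ends e).1 /\ A (ends e).2].
Definition off A : set E := ~` touch A.
Definition conn w x y := cluster_of w x y.

Lemma joins_sym e x y : joins e x y -> joins e y x.
Proof. by case=> h; [right|left]. Qed.

Lemma joins_touch e x y A : joins e x y -> A x -> touch A e.
Proof. by case=> h Ax; rewrite /touch /= h; [left|right]. Qed.

Lemma touch_joins e x y A : joins e x y -> touch A e -> A x \/ A y.
Proof. by case=> h; rewrite /touch /= h /=; tauto. Qed.

Lemma joins_off e x y A : joins e x y -> ~ A x -> ~ A y -> off A e.
Proof. by move=> j nx ny /(touch_joins j)[]. Qed.

Lemma joins_inside e x y A : joins e x y -> A x -> A y -> inside A e.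
Proof. by case=> h Ax Ay; rewrite /inside /= h. Qed.

Lemma inside_joins e x y A : joins e x y -> inside A e -> A x /\ A y.
Proof. by case=> h; rewrite /inside /= h /=; tauto. Qed.

Lemma joins_uniq e x y x' y' : joins e x y -> joins e x' y' ->
  (x = x' /\ y = y') \/ (x = y' /\ y = x').
Proof. by rewrite /joins => -[->|->] [[-> ->]|[-> ->]]; tauto. Qed.

Lemma touch_sub A B : A `<=` B -> touch A `<=` touch B.
Proof. by move=> AB e [/AB|/AB]; [left|right]. Qed.

Lemma inside_sub_touch A : inside A `<=` touch A.
Proof. by move=> e []; left. Qed.

Lemma joins_ends e : joins e (ends e).1 (ends e).2.
Proof. by left; case: (ends e). Qed.

Lemma adjacentP w x y : Defs.adjacent w x y <-> exists2 e, w e & joins e x y.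
Proof.
split=> [[[e b] [/= we <- <-]]|[e we [|] h]].
- exists e => //; rewrite /dart_tail /dart_head /=; case: b; rewrite /joins.
    by right; case: (ends e).
  by left; case: (ends e).
- by exists (e, false); split; rewrite /dart_tail /dart_head /= ?h.
- by exists (e, true); split; rewrite /dart_tail /dart_head /= ?h.
Qed.

Lemma conn_refl w x : conn w x x. Proof. exact: rt_refl. Qed.

Lemma conn_trans w x y z : conn w x y -> conn w y z -> conn w x z.
Proof. exact: rt_trans. Qed.

Lemma conn_edge w e x y : w e -> joins e x y -> conn w x y.
Proof. by move=> we j; apply: rt_step; apply/adjacentP; exists e. Qed.

Lemma conn_step w e x y z : conn w x y -> w e -> joins e y z -> conn w x z.
Proof. by move=> h we j; apply: conn_trans h _; exact: conn_edge we j. Qed.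

Lemma conn_ind w (P : V -> Prop) x y :
  (forall z z' e, P z -> w e -> joins e z z' -> P z') -> conn w x y -> P x -> P y.
Proof.
move=> hP; elim=> [a b /adjacentP[e we j] Pa|//|a b c _ h1 _ h2 /h1/h2//].
exact: hP Pa we j.
Qed.

Lemma conn_sym w x y : conn w x y -> conn w y x.
Proof.
move=> h; apply: (@conn_ind w (fun z => conn w z x) x) => [z z' e c we j|//|].
  by apply: conn_trans c; exact: conn_edge we (joins_sym j).
exact: conn_refl.
Qed.

Lemma conn_finer w w' x y : conn w x y ->
  (forall z z' e, conn w x z -> w e -> joins e z z' -> w' e) -> conn w' x y.
Proof.
move=> c h.
suff : conn w x y /\ conn w' x y by case.
apply: (@conn_ind w (fun y => conn w x y /\ conn w' x y) x _ _ c) => [z z' e [c1 c2] we j|].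
  by split; [exact: conn_step c1 we j|exact: conn_step c2 (h _ _ _ c1 we j) j].
by split; exact: conn_refl.
Qed.

Lemma conn_mono w w' x y : w `<=` w' -> conn w x y -> conn w' x y.
Proof. by move=> ww' c; apply: conn_finer c _ => z z' e _ /ww'. Qed.

(** Followed backwards from [y], the walk stays outside [A] until it enters it for the first time.
    That edge is the exit, and what comes after it uses only edges without endpoint in [A]. *)
Lemma last_exit w A x y : conn w x y -> A x -> ~ A y ->
  exists e u u', [/\ w e, joins e u u', A u, ~ A u' &
    conn w x u /\ conn (w `&` off A) u' y].
Proof.
move=> /conn_sym c Ax nAy.
suff : (~ A x /\ conn (w `&` off A) x y) \/
  exists e u u', [/\ w e, joins e u u', A u, ~ A u' &
    conn w x u /\ conn (w `&` off A) u' y] by case=> // -[].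
apply: (@conn_ind w (fun x => (~ A x /\ conn (w `&` off A) x y) \/
  exists e u u', [/\ w e, joins e u u', A u, ~ A u' &
    conn w x u /\ conn (w `&` off A) u' y]) y _ _ c); last first.
  by left; split=> //; exact: conn_refl.
move=> z z' e [[nAz cz]|[f [u [u' [wf ju Au nAu' [c1 c2]]]]]] we j; last first.
  right; exists f, u, u'; split=> //; split=> //.
  by apply: conn_trans c1; exact: conn_edge we (joins_sym j).
have [Az'|nAz'] := pselect (A z').
  right; exists e, z', z; split=> //; first exact: joins_sym.
  by split=> //; exact: conn_refl.
left; split=> //; apply: conn_trans cz; apply: (conn_edge _ (joins_sym j)).
by split=> //; exact: joins_off j _ _.
Qed.

Lemma first_exit w A x y : conn w x y -> A x -> ~ A y ->
  exists e u u', [/\ w e, joins e u u', A u, ~ A u' & conn (w `&` inside A) x u].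
Proof.
move=> c Ax nAy; apply: contrapT => h.
suff [] : A y /\ conn (w `&` inside A) x y by [].
apply: (@conn_ind w (fun y => A y /\ conn (w `&` inside A) x y) x _ _ c);
  last by split=> //; exact: conn_refl.
move=> z z' e [Az cz] we j; have [Az'|nAz'] := pselect (A z').
  split=> //; apply: (conn_step cz _ j); split=> //; exact: joins_inside j _ _.
by exfalso; apply: h; exists e, z, z'.
Qed.

Fixpoint ball w x (n : nat) : set V :=
  if n is m.+1 then
    ball w x m `|` [set y | exists z e, [/\ ball w x m z, w e & joins e z y]]
  else [set x].

Lemma ball_S w x n z y e : ball w x n z -> w e -> joins e z y -> ball w x n.+1 y.
Proof. by move=> bz we j; right; exists z, e. Qed.

Lemma ball_le w x n m : (n <= m)%N -> ball w x n `<=` ball w x m.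
Proof.
elim: m => [|m IH]; first by rewrite leqn0 => /eqP ->.
by rewrite leq_eqVlt => /orP[/eqP ->//|]; rewrite ltnS => /IH h y /h; left.
Qed.

Lemma ball_center w x n : ball w x n x.
Proof. exact: (@ball_le w x 0). Qed.

Lemma ball_conn_inside w x n y : ball w x n y -> conn (w `&` inside (ball w x n)) x y.
Proof.
elim: n y => [|n IH] y; first by move=> /= ->; exact: conn_refl.
have sub : w `&` inside (ball w x n) `<=` w `&` inside (ball w x n.+1).
  by move=> e [we [h1 h2]]; split=> //; split; left.
move=> /= [/IH|[z [e [bz we j]]]]; first exact: conn_mono.
apply: (conn_step (conn_mono sub (IH _ bz)) _ j).
by split=> //; apply: (joins_inside j); [left|right; exists z, e].
Qed.

Lemma conn_ball w x y : conn w x y -> exists n, ball w x n y.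
Proof.
move=> c; apply: (@conn_ind w (fun y => exists n, ball w x n y) x _ _ c); last by exists 0%N.
by move=> z z' e [n bz] we j; exists n.+1; apply: (ball_S bz we j).
Qed.

Lemma ball_trans w x y z n m : ball w x n y -> ball w y m z -> ball w x (n + m) z.
Proof.
move=> bxy; elim: m z => [|m IH] z /=; first by move=> ->; rewrite addn0.
by rewrite addnS => -[/IH|[u [e [/IH bu we j]]]]; [left|right; exists u, e].
Qed.

Lemma ball_sym w x y n : ball w x n y -> ball w y n x.
Proof.
elim: n y => [|n IH] y /=; first by move=> ->.
move=> [/IH|[z [e [/IH bz we j]]]]; first by left.
have h : ball w y 1 z by right; exists y, e; split=> //; exact: joins_sym.
by have := ball_trans h bz; rewrite add1n.
Qed.

Lemma ball_stationary w x n m : ball w x n.+1 `<=` ball w x n ->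
  ball w x m `<=` ball w x n.
Proof.
move=> h; elim: m => [|m IH]; first exact: ball_le.
move=> y /= [/IH//|[z [e [/IH bz we j]]]]; apply: h; exact: ball_S bz we j.
Qed.

(** Exploring a ball of radius [n] reveals only edges that touch it, and these already decide the
    ball of radius [n + 1]. Hence the event that a ball equals a given set is decided by the edges
    touching this set. *)
Lemma ball_agree w w' x n :
  w `&` touch (ball w x n) = w' `&` touch (ball w x n) ->
  forall i, (i <= n.+1)%N -> ball w' x i = ball w x i.
Proof.
move=> h; elim=> [//|i IH] hi; have hi' : (i <= n)%N by [].
rewrite /= IH; last exact: leqW.
congr (_ `|` _); apply/seteqP; split=> y [z [e [bz we j]]]; exists z, e; split=> //.
- have : (w' `&` touch (ball w x n)) e.
    by split=> //; apply: (joins_touch j); exact: ball_le bz.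
  by rewrite -h => -[].
- have : (w `&` touch (ball w x n)) e.
    by split=> //; apply: (joins_touch j); exact: ball_le bz.
  by rewrite h => -[].
Qed.

Lemma ball_path w x n u : ball w x n u -> exists s : seq E,
  [/\ (size s <= n)%N, [set` s] `<=` w `&` inside (ball w x n) & conn [set` s] x u].
Proof.
elim: n u => [|n IH] u; first by move=> /= ->; exists [::]; split=> //; exact: conn_refl.
have sub : w `&` inside (ball w x n) `<=` w `&` inside (ball w x n.+1).
  by move=> e [we [h1 h2]]; split=> //; split; left.
move=> /= [/IH[s [h1 h2 h3]]|[z [e [bz we j]]]].
  by exists s; split=> //; [exact: leqW|exact: subset_trans sub].
have [s [h1 h2 h3]] := IH _ bz; exists (e :: s); split => //.
  move=> f /=; rewrite inE => /orP[/eqP ->|fs]; last exact/sub/h2.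
  by split=> //; apply: (joins_inside j); [left|right; exists z, e].
have h4 : [set` s] `<=` [set` e :: s] by move=> f /= fs; rewrite inE fs orbT.
by apply: (conn_step (conn_mono h4 h3) _ j); rewrite /= inE eqxx.
Qed.

Definition hasdeg D := forall x, finite_set (touch [set x]) /\ (nb (touch [set x]) <= D)%N.

Lemma touch_bigcup A : touch A = \bigcup_(x in A) touch [set x].
Proof.
apply/seteqP; split=> [e [h|h]|e [x Ax [/= h|/= h]]].
- by exists (ends e).1 => //; left.
- by exists (ends e).2 => //; right.
- by left; rewrite h.
- by right; rewrite h.
Qed.

Section Degree.
Variable D : nat.
Hypothesis hD : hasdeg D.

Lemma finite_touch A : finite_set A -> finite_set (touch A).
Proof.
move=> fA; rewrite touch_bigcup; apply: bigcup_finite => // x _.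
by case: (hD x).
Qed.

Definition nbhd A : set V := [set y | exists x e, A x /\ joins e x y].

Lemma nbhd1_finite x : finite_set (nbhd [set x]) /\ (nb (nbhd [set x]) <= D)%N.
Proof.
have [fx nx] := hD x.
pose other e := if (ends e).1 == x then (ends e).2 else (ends e).1.
have sub : nbhd [set x] `<=` other @` touch [set x].
  move=> y [_ [e [-> j]]]; exists e; first exact: joins_touch j _.
  by rewrite /other; case: j => -> /=; rewrite ?eqxx//; case: eqP.
have fi : finite_set (other @` touch [set x]) by exact: finite_image.
split; first exact: sub_finite_set sub fi.
apply: leq_trans (nb_le fi sub) _; apply: leq_trans nx.
exact: nb_image.
Qed.

End Degree.
End Graph.

Arguments ball : simpl never.

(** * Capacities *)

Section Capacity.
Variables (R : realType) (E : choiceType).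

(* A route is a finite open edge set joining a source to the outside, possibly
   preceded by one contact edge that need not be open. *)
Definition route : choiceType := (option E * set E)%type.
Implicit Types (mu nu : seq (R * route)) (w : set E).

Definition fp (x : route) : set E := [set g | x.1 = Some g \/ x.2 g].
Definition mass mu : R := \sum_(x <- mu) x.1.
Definition load mu (g : E) : R := \sum_(x <- mu) x.1 * ind (fp x.2 g).
Definition cload mu (g : E) : R := \sum_(x <- mu) x.1 * ind (x.2.1 = Some g).

Definition nonneg mu := forall x, x \in mu -> 0 <= x.1.

Definition scale (c : R) mu : seq (R * route) := [seq (c * x.1, x.2) | x <- mu].

Lemma mass_cat mu nu : mass (mu ++ nu) = mass mu + mass nu.
Proof. by rewrite /mass big_cat. Qed.
Lemma load_cat mu nu g : load (mu ++ nu) g = load mu g + load nu g.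
Proof. by rewrite /load big_cat. Qed.
Lemma cload_cat mu nu g : cload (mu ++ nu) g = cload mu g + cload nu g.
Proof. by rewrite /cload big_cat. Qed.
Lemma mass_scale c mu : mass (scale c mu) = c * mass mu.
Proof. by rewrite /mass big_map mulr_sumr. Qed.
Lemma load_scale c mu g : load (scale c mu) g = c * load mu g.
Proof. by rewrite /load big_map mulr_sumr; apply: eq_bigr => x _; rewrite mulrA. Qed.
Lemma cload_scale c mu g : cload (scale c mu) g = c * cload mu g.
Proof. by rewrite /cload big_map mulr_sumr; apply: eq_bigr => x _; rewrite mulrA. Qed.

Lemma sumr_seq_ge0 (T : eqType) (s : seq T) (F : T -> R) :
  (forall x, x \in s -> 0 <= F x) -> 0 <= \sum_(x <- s) F x.
Proof. by move=> h; rewrite big_seq; apply: sumr_ge0. Qed.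

Lemma ler_sum_seq (T : eqType) (s : seq T) (F F' : T -> R) :
  (forall x, x \in s -> F x <= F' x) -> \sum_(x <- s) F x <= \sum_(x <- s) F' x.
Proof. by move=> h; rewrite big_seq [leRHS]big_seq; apply: ler_sum. Qed.

Lemma mass_ge0 mu : nonneg mu -> 0 <= mass mu.
Proof. by move=> h; apply: sumr_seq_ge0. Qed.
Lemma load_ge0 mu g : nonneg mu -> 0 <= load mu g.
Proof. by move=> h; apply: sumr_seq_ge0 => x /h ?; rewrite mulr_ge0 ?ind_ge0. Qed.
Lemma cload_ge0 mu g : nonneg mu -> 0 <= cload mu g.
Proof. by move=> h; apply: sumr_seq_ge0 => x /h ?; rewrite mulr_ge0 ?ind_ge0. Qed.
Lemma cload_le_load mu g : nonneg mu -> cload mu g <= load mu g.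
Proof.
by move=> h; apply: ler_sum_seq => x /h ?; rewrite ler_wpM2l//; apply: ind_le; left.
Qed.
Lemma load_gt0 mu g : load mu g != 0 -> exists2 x, x \in mu & fp x.2 g.
Proof.
move=> h; apply: contrapT => hn; move: h; rewrite /load big_seq big1 ?eqxx// => x xmu.
by rewrite indF ?mulr0// => hx; apply: hn; exists x.
Qed.

Variables (l : seq E) (r : nat).

(** A contact edge also counts in the load, so [r] is an additional price. It stands for [r] edges
    in series, the length of a connection from [o] to the contact inside a ball of radius [r]. *)
Definition en (th ka : E -> R) : R :=
  \sum_(g <- l) th g ^+ 2 + r%:R * \sum_(g <- l) ka g ^+ 2.
Definition energy mu : R := en (load mu) (cload mu).

Lemma en_ge0 th ka : 0 <= en th ka.
Proof. by rewrite addr_ge0 ?mulr_ge0// sumr_ge0// => g _; exact: sqr_ge0. Qed.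

Lemma en_le th ka th' ka' : (forall g, g \in l -> 0 <= th g <= th' g) ->
  (forall g, g \in l -> 0 <= ka g <= ka' g) -> en th ka <= en th' ka'.
Proof.
move=> h1 h2; apply: lerD; last apply: ler_wpM2l => //.
  apply: ler_sum_seq => g /h1 /andP[a b].
  by rewrite ler_sqr ?nnegrE// (le_trans a b).
apply: ler_sum_seq => g /h2 /andP[a b].
by rewrite ler_sqr ?nnegrE// (le_trans a b).
Qed.

Lemma energy_scale c mu : energy (scale c mu) = c ^+ 2 * energy mu.
Proof.
rewrite /energy /en mulrDr; congr (_ + _).
  by rewrite mulr_sumr; apply: eq_bigr => g _; rewrite load_scale exprMn.
rewrite mulrCA; congr (_ * _).
by rewrite mulr_sumr; apply: eq_bigr => g _; rewrite cload_scale exprMn.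
Qed.

Lemma sum_load_sqr mu : \sum_(g <- l) load mu g ^+ 2 <= energy mu.
Proof. by rewrite lerDl mulr_ge0// sumr_ge0// => g _; exact: sqr_ge0. Qed.

Lemma sum_cload_sqr mu : r%:R * \sum_(g <- l) cload mu g ^+ 2 <= energy mu.
Proof. by rewrite lerDr sumr_ge0// => g _; exact: sqr_ge0. Qed.

Variable ok : route -> Prop.
Hypothesis hok : forall x, ok x -> exists2 g, g \in l & fp x g.

Definition valid w mu :=
  forall x, x \in mu -> [/\ 0 <= x.1, ok x.2 & x.2.2 `<=` w].

Lemma valid_nonneg w mu : valid w mu -> nonneg mu.
Proof. by move=> h x /h[]. Qed.

Lemma valid_nil w : valid w [::]. Proof. by []. Qed.

Lemma valid_cat w mu nu : valid w mu -> valid w nu -> valid w (mu ++ nu).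
Proof. by move=> h1 h2 x; rewrite mem_cat => /orP[/h1|/h2]. Qed.

Lemma valid_scale w c mu : 0 <= c -> valid w mu -> valid w (scale c mu).
Proof. by move=> c0 h _ /mapP[x /h[a b d] ->]; split=> //=; rewrite mulr_ge0. Qed.

Lemma valid_mono w w' mu : w `<=` w' -> valid w mu -> valid w' mu.
Proof. by move=> ww' h x /h[a b c]; split=> //; exact: subset_trans ww'. Qed.

Lemma mass_le_loads w mu : valid w mu -> mass mu <= \sum_(g <- l) load mu g.
Proof.
move=> h; rewrite /load exchange_big /=; apply: ler_sum_seq => x /h[x0 okx _].
have [g gl fg] := hok okx; rewrite -mulr_sumr ler_peMr//.
rewrite (big_rem g)//= indT// lerDl sumr_ge0// => i _; exact: ind_ge0.
Qed.

Definition cap_set w : set R := [set 2 * mass mu - energy mu | mu in valid w].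
(** Over the multiples of one measure the maximum of [2 * mass - energy] is [mass ^ 2 / energy]. So
    this is the supremum of the inverse energies of probability measures on routes, a form of
    effective conductance. *)
Definition Cap w : R := sup (cap_set w).

(** Every route uses an edge of [l], so the mass is at most the total load, and an edge with load
    [x] contributes at most [2 x - x ^ 2 <= 1]. Hence the supremum defining [Cap] is finite. *)
Lemma value_le_size w mu : valid w mu -> 2 * mass mu - energy mu <= (size l)%:R.
Proof.
move=> h; have h1 := mass_le_loads h.
have h2 := sum_load_sqr mu.
apply: le_trans (_ : \sum_(g <- l) (2 * load mu g - load mu g ^+ 2) <= _).
  by rewrite sumrB -mulr_sumr; lra.
rewrite -sum1_size natr_sum; apply: ler_sum => g _.
by have := sqr_ge0 (load mu g - 1); rewrite sqrrB1 -mulr_natl; lra.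
Qed.

Lemma cap_has_sup w : has_sup (cap_set w).
Proof.
split.
  by exists (2 * mass [::] - energy [::]), [::] => //; exact: valid_nil.
by exists (size l)%:R => _ [mu vmu <-]; exact: value_le_size vmu.
Qed.

Lemma Cap_ub w mu : valid w mu -> 2 * mass mu - energy mu <= Cap w.
Proof. by move=> vmu; apply: (sup_upper_bound (cap_has_sup w)); exists mu. Qed.

Lemma energy_nil : energy [::] = 0.
Proof.
rewrite /energy /en !big1 ?mulr0 ?addr0// => g _; first by rewrite /cload big_nil expr0n.
by rewrite /load big_nil expr0n.
Qed.

Lemma mass_nil : mass [::] = 0. Proof. by rewrite /mass big_nil. Qed.

Lemma Cap_ge0 w : 0 <= Cap w.
Proof.
by have := Cap_ub (valid_nil w); rewrite energy_nil mass_nil mulr0 subrr.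
Qed.

Lemma Cap_le w c : (forall mu, valid w mu -> 2 * mass mu - energy mu <= c) -> Cap w <= c.
Proof.
by move=> h; apply: sup_le_ub; [case: (cap_has_sup w)|move=> _ [mu v <-]; exact: h].
Qed.

Lemma Cap_mono w w' : w `<=` w' -> Cap w <= Cap w'.
Proof. by move=> ww'; apply: Cap_le => mu /(valid_mono ww'); exact: Cap_ub. Qed.

(* Rescaling a nearly optimal measure makes its mass equal to its energy. *)
Lemma Cap_near w (d : R) : 0 < d ->
  exists mu, [/\ valid w mu, energy mu = mass mu, Cap w - d <= mass mu & mass mu <= Cap w].
Proof.
move=> d0; have [_ [mu vmu <-] hmu] := sup_adherent d0 (cap_has_sup w).
rewrite -/(Cap w) in hmu.
have m0 := mass_ge0 (valid_nonneg vmu).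
have [E0|E0] := eqVneq (energy mu) 0.
  have L0 g : g \in l -> load mu g = 0.
    move=> gl; apply/eqP; rewrite -sqrf_eq0 eq_le sqr_ge0 andbT -E0.
    apply: le_trans (sum_load_sqr mu); rewrite (big_rem g)//= lerDl.
    by rewrite sumr_ge0// => i _; exact: sqr_ge0.
  have mz : mass mu = 0.
    apply/eqP; rewrite eq_le m0 andbT; apply: le_trans (mass_le_loads vmu) _.
    by rewrite big_seq big1// => g /L0.
  exists [::]; rewrite energy_nil mass_nil; split=> //; last exact: Cap_ge0.
  by move: hmu; rewrite mz E0; lra.
have Epos : 0 < energy mu by rewrite lt_neqAle eq_sym E0 en_ge0.
set c := mass mu / energy mu; exists (scale c mu).
have c0 : 0 <= c by rewrite divr_ge0 ?en_ge0.
have v := valid_scale c0 vmu.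
have eqm : energy (scale c mu) = mass (scale c mu).
  by rewrite energy_scale mass_scale /c expr2 -!mulrA mulVf// mulr1.
have hub := Cap_ub v; rewrite eqm in hub.
split=> //; last lra.
apply: ltW; apply: lt_le_trans hmu _; rewrite mass_scale /c.
rewrite -subr_ge0 (_ : _ - _ = (mass mu - energy mu) ^+ 2 / energy mu); last by field.
by rewrite divr_ge0 ?sqr_ge0// ltW.
Qed.

Lemma energy_filter (P : pred (R * route)) mu : nonneg mu ->
  energy [seq x <- mu | P x] <= energy mu.
Proof.
move=> mu0; have nf : nonneg [seq x <- mu | P x].
  by move=> x; rewrite mem_filter => /andP[_ /mu0].
apply: en_le => g _.
  rewrite load_ge0//= /load big_filter big_mkcond; apply: ler_sum_seq => x /mu0 x0.
  by case: (P x) => //; rewrite mulr_ge0 ?ind_ge0.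
rewrite cload_ge0//= /cload big_filter big_mkcond; apply: ler_sum_seq => x /mu0 x0.
by case: (P x) => //; rewrite mulr_ge0 ?ind_ge0.
Qed.

(** Discard the routes whose open part uses [e]: the mass drops by at most [load mu e], and the
    energy does not increase. *)
Lemma Cap_removal w mu e d : valid w mu -> energy mu = mass mu -> Cap w - d <= mass mu ->
  Cap w - Cap (w `\ e) <= 2 * load mu e + d.
Proof.
move=> v em hd; pose P (x : R * route) := e \notin x.2.2.
have v' : valid (w `\ e) [seq x <- mu | P x].
  move=> x; rewrite mem_filter => /andP[Px /v[a b c]]; split=> // g xg; split; first exact: c.
  by move=> ge; move: Px; rewrite /P notin_setE -ge.
have h1 := Cap_ub v'; have h2 := energy_filter P (valid_nonneg v).
have h3 : mass mu - load mu e <= mass [seq x <- mu | P x].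
  rewrite lerBlDr /mass big_filter [X in _ <= X + _]big_mkcond /= /load -big_split /=.
  apply: ler_sum_seq => x /v[x0 _ _]; rewrite /P.
  case: (boolP (e \in x.2.2)) => /= h; last by rewrite lerDl mulr_ge0 ?ind_ge0.
  by rewrite add0r indT ?mulr1//; right; rewrite inE in h.
lra.
Qed.

(** By [Cap_removal] each influence is at most twice a load plus an error [d], and
    [(2 x + d) ^ 2 <= 8 x ^ 2 + 2 d ^ 2]. The squared loads add up to at most the energy, which
    equals the mass. *)
Lemma Cap_sum_sqr w : \sum_(e <- l) (Cap w - Cap (w `\ e)) ^+ 2 <= 8 * Cap w.
Proof.
apply/ler_addgt0Pr => eps eps0.
(* Both [d <= 1] and [d (2 n + 1) <= eps] are wanted, so that the total error [2 d ^ 2 n] is at most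
   [eps]. *)
pose n : R := (size l)%:R; pose d := Num.min 1 (eps / (2 * n + 1)).
have n0 : 0 <= n by [].
have d0 : 0 < d by rewrite lt_min ltr01 divr_gt0//; lra.
have d1 : d <= 1 by rewrite ge_min lexx.
have [mu [v em h1 h2]] := Cap_near w d0.
apply: le_trans (_ : \sum_(e <- l) (8 * load mu e ^+ 2 + 2 * d ^+ 2) <= _).
  apply: ler_sum => e _; have h := Cap_removal e v em h1.
  have c0 : 0 <= Cap w - Cap (w `\ e) by rewrite subr_ge0 Cap_mono//; exact: subDsetl.
  apply: le_trans (_ : (2 * load mu e + d) ^+ 2 <= _).
    by rewrite ler_sqr ?nnegrE// (le_trans c0 h).
  by have := sqr_ge0 (2 * load mu e - d); nra.
rewrite big_split /= -mulr_sumr big_const_seq count_predT iter_addr addr0 -mulr_natr -/n.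
have := sum_load_sqr mu; rewrite em => h3.
suff : 2 * d ^+ 2 * n <= eps by lra.
have : d * (2 * n + 1) <= eps.
  have h : d <= eps / (2 * n + 1) by rewrite ge_min lexx orbT.
  rewrite -ler_pdivlMr//; lra.
nra.
Qed.

Lemma Cap_depends X : (forall x, ok x -> x.2 `<=` X) -> depends Cap X.
Proof.
move=> hX w w' ww'.
have vv a b mu : a `&` X = b `&` X -> valid a mu -> valid b mu.
  move=> ab v x /v[h1 h2 h3]; split=> // g xg.
  have : (a `&` X) g by split; [exact: h3|exact: (hX _ h2)].
  by rewrite ab => -[].
rewrite /Cap /cap_set; congr sup; apply/seteqP.
by split=> _ [mu v <-]; exists mu => //; [apply: vv v|apply: vv v; exact: esym].
Qed.

Lemma Cap_variance (p : R) (k : seq E) : 0 <= p -> p <= 1 -> uniq k -> k = l ->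
  Ex p k (fun s => Cap s ^+ 2) - (Ex p k Cap) ^+ 2 <= 8 * Ex p k Cap.
Proof.
move=> p0 p1 uk kl; apply: le_trans (efron_stein p0 p1 Cap uk) _.
rewrite -Ex_sum -ExZ; apply: Ex_le => // s _; apply: le_trans (Cap_sum_sqr s).
rewrite kl; apply: ler_sum => e _; rewrite ler_piMl ?sqr_ge0//; exact: ind_le1.
Qed.

End Capacity.

(** * Routes to the outside of a finite set *)

Section Counting.
Variable R : realType.

Lemma sum_ind_count (T : choiceType) (l : seq T) (P : T -> Prop) :
  \sum_(g <- l) ind (P g) = (count (fun g => `[< P g >]) l)%:R :> R.
Proof.
elim: l => [|x l IH]; first by rewrite big_nil.
by rewrite big_cons IH /= natrD.
Qed.

Lemma sum_ind_seq (T : choiceType) (l s : seq T) : uniq l ->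
  \sum_(g <- l) ind ([set` s] g) <= (size s)%:R :> R.
Proof.
move=> ul; rewrite sum_ind_count ler_nat -size_filter; apply: uniq_leq_size.
  exact: filter_uniq.
by move=> x; rewrite mem_filter => /andP[/asboolP].
Qed.

Lemma sum_ind_nb (T : choiceType) (l : seq T) (A : set T) : uniq l -> finite_set A ->
  \sum_(g <- l) ind (A g) <= (nb A)%:R :> R.
Proof.
move=> ul /enum_setP[s [_ <- sA]]; apply: le_trans (sum_ind_seq s ul).
by apply: ler_sum => g _; apply: ind_le => /sA.
Qed.

Lemma amgm (a x y : R) : 0 < a -> x * y <= a / 2 * x ^+ 2 + y ^+ 2 / (2 * a).
Proof.
move=> a0; rewrite -subr_ge0.
rewrite (_ : _ - _ = (a * x - y) ^+ 2 / (2 * a)); last by field; rewrite gt_eqF.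
by rewrite divr_ge0 ?sqr_ge0// mulr_ge0// ltW.
Qed.
End Counting.

Section Systems.
Variables (R : realType) (G : multigraph).
Local Notation V := (vertex G).
Local Notation E := (edge G).
Implicit Types (w : set E) (y z u o : V) (U A B : set V) (e : E).

Definition reach U w y := exists2 z, ~ U z & conn w y z.

Lemma reach_mono U w w' y : w `<=` w' -> reach U w y -> reach U w' y.
Proof. by move=> ww' [z Uz c]; exists z => //; exact: conn_mono ww' c. Qed.

Lemma reach_conn U w (x : V) y : conn w x y -> reach U w y -> reach U w x.
Proof. by move=> c [z Uz c']; exists z => //; exact: conn_trans c c'. Qed.

Lemma nb_touch D A : hasdeg G D -> finite_set A -> (nb (touch A) <= D * nb A)%N.
Proof.
move=> hD fA; rewrite (touch_bigcup A).
by have [_] := nb_bigcup fA (fun x _ => hD x).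
Qed.

Lemma count_touch D A (l : seq E) : hasdeg G D -> uniq l -> finite_set A ->
  (count [in touch A] l <= D * nb A)%N.
Proof.
move=> hD ul fA; apply: leq_trans (nb_touch hD fA).
have ft := finite_touch hD fA.
rewrite -size_filter /nb; apply: uniq_leq_size; first exact: filter_uniq.
by move=> e; rewrite mem_filter => /andP[h _]; rewrite in_fset_set.
Qed.

Variable l : seq E.

Definition okO U o (x : route E) : Prop :=
  [/\ x.1 = None, reach U x.2 o & x.2 `<=` [set` l]].

(** The open part avoids all edges touching [A], so that [capA] is independent of the edges explored
    in order to find [A]. It may be empty when [u'] is already outside [U]. *)
Definition okA U A (x : route E) : Prop :=
  exists e u u', [/\ x.1 = Some e, e \in l, joins e u u', A u /\ ~ A u' &
    x.2 `<=` off A `&` [set` l] /\ reach U x.2 u'].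

Definition capO U o w : R := Cap R l 0 (okO U o) w.
Definition capA r U A w : R := Cap R l r (okA U A) w.

Lemma okO_edge U o : U o -> forall x, okO U o x -> exists2 g, g \in l & fp x g.
Proof.
move=> Uo x [_ [z Uz c] xl].
have [e [u [u' [we _ _ _ _]]]] := first_exit c Uo Uz.
by exists e; [exact: xl|right].
Qed.

Lemma okA_edge U A x : okA U A x -> exists2 g, g \in l & fp x g.
Proof. by move=> [e [u [u' [xe el _ _ _]]]]; exists e => //; left. Qed.

Lemma capA_depends r U A : depends (capA r U A) (off A).
Proof.
apply: Cap_depends => x [e [u [u' [_ _ _ _ [h _]]]]].
by apply: subset_trans h _; exact: subIsetl.
Qed.

(** Mass [1 / n] on a single route of at most [n] edges has value at least [2 / n - n / n ^ 2]. *)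
Lemma capO_route U o w (s : seq E) n : U o -> uniq l -> w `<=` [set` l] -> (0 < n)%N ->
  (size s <= n)%N -> [set` s] `<=` w -> reach U [set` s] o -> n%:R^-1 <= capO U o w.
Proof.
move=> Uo ul wl n0 sn sw rs.
pose mu : seq (R * route E) := [:: (n%:R^-1, (None, [set` s]))].
have vmu : valid (okO U o) w mu.
  move=> x; rewrite inE => /eqP ->; split => //=.
  by split => //; exact: subset_trans wl.
apply: le_trans (Cap_ub 0 (okO_edge Uo) vmu).
have n0' : (0 : R) < n%:R by rewrite ltr0n.
rewrite /mass /mu big_seq1 /= /energy /en mul0r addr0.
have -> : \sum_(g <- l) load mu g ^+ 2 = n%:R^-1 ^+ 2 * \sum_(g <- l) ind ([set` s] g) :> R.
  rewrite mulr_sumr; apply: eq_bigr => g _; rewrite /load /mu big_seq1 /= exprMn.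
  congr (_ * _); have [gs|gs] := pselect ([set` s] g).
    by rewrite (indT _ gs) indT ?expr1n//; right.
  by rewrite (indF _ gs) indF ?expr0n// => -[].
have : n%:R^-1 ^+ 2 * \sum_(g <- l) ind ([set` s] g) <= n%:R^-1 ^+ 2 * n%:R :> R.
  apply: ler_wpM2l; first exact: sqr_ge0.
  by apply: (le_trans (sum_ind_seq R s ul)); rewrite ler_nat.
have -> : n%:R^-1 ^+ 2 * n%:R = n%:R^-1 :> R by field; rewrite gt_eqF.
move=> h.
by rewrite mulr_natl mulr2n -[leLHS](addrK n%:R^-1) lerD2l lerN2.
Qed.

(** Used in the other direction: a capacity below [1 / r] keeps the open ball of radius [r] inside
    [U]. *)
Lemma capO_ball U o w r : U o -> uniq l -> w `<=` [set` l] -> (0 < r)%N ->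
  ~ (ball w o r `<=` U) -> r%:R^-1 <= capO U o w.
Proof.
move=> Uo ul wl r0 /existsNP[u /not_implyP[bu nUu]].
have [s [sr sw c]] := ball_path bu.
by apply: (capO_route Uo ul wl r0 sr) => [e /sw[]|]//; exists u.
Qed.

End Systems.

(** * Growth of clusters *)

Section Growth.
Variables (R : realType) (G : multigraph) (p : R) (D : nat).
Local Notation V := (vertex G).
Local Notation E := (edge G).
Hypotheses (p0 : 0 <= p) (p1 : p <= 1) (hD : hasdeg G D).
Implicit Types (w : set E) (A B U : set V) (o : V).

Definition sphere w o n : set V := ball w o n.+1 `\` ball w o n.

Lemma ball_setC_sphere w o n : ball w o n.+1 = ball w o n `|` sphere w o n.
Proof. by rewrite /sphere setDUK//; exact: ball_le. Qed.

(** The balls of radius [n] and [n + 1] are decided by the edges touching the smaller one. The other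
    edges touching the sphere number at most [m D] and are still independent; closing all of them
    stops the growth. *)
Lemma closed_sphere (l : seq E) U o n m : uniq l -> finite_set U ->
  Pr p l (fun w => [/\ ball w o n.+1 `<=` U, sphere w o n !=set0 & (nb (sphere w o n) <= m)%N])
    * (1 - p) ^+ (m * D) <=
  Pr p l (fun w => sphere w o n !=set0 /\ ball w o n.+2 `<=` ball w o n.+1).
Proof.
move=> ul fU.
have [vals [_ hv]] := Ex_partition p l (fun w => (ball w o n, ball w o n.+1)).
rewrite /Pr !hv mulr_suml; apply: ler_sum => -[A B] _.
pose good := [/\ B `<=` U, (B `\` A) !=set0 & (nb (B `\` A) <= m)%N].
have [gd|gd] := pselect good; last first.
  rewrite (_ : Ex _ _ _ = 0); last first.
    rewrite -[RHS](Ex_cst p l 0); apply: Ex_ext => s _.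
    have [h|h] := pselect ((ball s o n, ball s o n.+1) = (A, B)); last first.
      by rewrite indF// mul0r.
    have sA : ball s o n = A := congr1 fst h; have sB : ball s o n.+1 = B := congr1 snd h.
    by rewrite (indF _ (P := [/\ _, _ & _])) ?mulr0// /sphere sA sB.
  rewrite mul0r; apply: Ex_ge0 => // s _.
  by rewrite mulr_ge0 ?ind_ge0.
case: gd => BU S0 Sm.
have fS : finite_set (B `\` A) by apply: sub_finite_set fU; apply: subset_trans BU; exact: subDsetl.
pose X := touch (B `\` A) `\` touch A.
have cX : (count [in X] l <= m * D)%N.
  apply: (leq_trans (n := count [in touch (B `\` A)] l)).
    by apply: sub_count => e; rewrite !inE => -[].
  by apply: leq_trans (count_touch hD ul fS) _; rewrite mulnC leq_mul2r Sm orbT.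
have h1 := Pr_closed p0 p1 cX.
have h2 : Ex p l (fun s => ind ((ball s o n, ball s o n.+1) = (A, B)) * ind (s `&` X = set0)) =
  Ex p l (fun s => ind ((ball s o n, ball s o n.+1) = (A, B))) * Pr p l (fun s => s `&` X = set0).
  apply: (@Ex_indep _ _ _ _ _ _ (touch A)).
    move=> s s' ss'; apply: ind_eq.
    have ag (u v : set E) : u `&` touch A = v `&` touch A ->
        (ball u o n, ball u o n.+1) = (A, B) -> (ball v o n, ball v o n.+1) = (A, B).
      move=> uv uAB; have uA : ball u o n = A := congr1 fst uAB.
      by rewrite -{}uA in uv; have h := ball_agree uv; rewrite -uAB !h.
    by split; exact: ag.
  move=> s s' ss'; apply: ind_eq.
  have e : forall v : set E, v `&` X = v `&` ~` touch A `&` X.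
    by move=> v; rewrite -setIA; congr (_ `&` _); rewrite /X setDE setICA setIid setIC.
  by rewrite (e s) (e s') ss'.
apply: (@le_trans _ _ (Ex p l (fun s => ind ((ball s o n, ball s o n.+1) = (A, B)) * ind (s `&` X = set0)))).
  rewrite h2; apply: ler_pM => //.
  - by apply: Ex_ge0 => // s _; rewrite mulr_ge0 ?ind_ge0.
  - by rewrite exprn_ge0// subr_ge0.
  - by apply: Ex_le => // s _; rewrite ler_piMr ?ind_ge0 ?ind_le1.
apply: Ex_le => // s _.
have [sAB|h] := pselect ((ball s o n, ball s o n.+1) = (A, B)); last by rewrite indF// !mul0r.
rewrite indT// !mul1r; apply: ind_le => sX.
have sA : ball s o n = A := congr1 fst sAB; have sB : ball s o n.+1 = B := congr1 snd sAB.
split; first by rewrite /sphere sA sB.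
move=> y [//|[z [e [zB we ezy]]]].
have [zA|zA] := pselect (ball s o n z); first exact: ball_S zA we ezy.
have : ~ X e by move=> Xe; have : (s `&` X) e by []; rewrite sX.
move=> /not_andP[|/contrapT].
  by case; apply: (joins_touch ezy); split; rewrite -?sA// -sB.
move=> /(touch_joins ezy); rewrite -sA => -[//|yA].
exact: (ball_le (leqnSn n)).
Qed.

(** If the ball has fewer than [M r] points, then at least half of its spheres have at most [2 M]
    points, and none is empty because [o] reaches the complement of [U]. *)
Lemma ball_growth (l : seq E) U o r M : uniq l -> finite_set U -> (0 < M)%N ->
  Pr p l (fun w => [/\ reach U w o, ball w o r `<=` U & (nb (ball w o r) < M * r)%N])
   * (r%:R / 2) * (1 - p) ^+ (2 * M * D) <= 1.
Proof.
move=> ul fU M0.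
set P := fun w => [/\ _, _ & _].
pose F i w := [/\ ball w o i.+1 `<=` U, sphere w o i !=set0 & (nb (sphere w o i) <= 2 * M)%N].
pose H i w := sphere w o i !=set0 /\ ball w o i.+2 `<=` ball w o i.+1.
have q0 : 0 <= 1 - p by rewrite subr_ge0.
(* Closing the sphere of radius [i] stops the growth there, and growth can stop
   at one radius only. *)
have hH : \sum_(0 <= i < r) Pr p l (H i) <= 1.
  rewrite -Ex_sum -[leRHS](Ex_cst p l 1); apply: Ex_le => // w _.
  have [[i0 [ir Hi]]|none] := pselect (exists i, (i < r)%N /\ H i w); last first.
    rewrite big_nat big1 ?ler01// => i /andP[_ ir]; rewrite indF// => Hi.
    by apply: none; exists i.
  rewrite (bigD1_seq i0) ?mem_index_iota ?iota_uniq//= big1 ?addr0 ?ind_le1// => i ii0.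
  have disj j k : (j < k)%N -> H j w -> ~ H k w.
    move=> jk [_ h1] [[y [yb ny]] _]; apply: ny.
    by apply: (ball_le jk); exact: (ball_stationary h1 yb).
  rewrite indF// => Hi'; have [lt|ge] := ltnP i i0; first exact: disj lt Hi' Hi.
  by apply: (disj i0 i) Hi Hi'; rewrite ltn_neqAle eq_sym ii0.
apply: le_trans hH.
apply: (@le_trans _ _ ((\sum_(0 <= i < r) Pr p l (F i)) * (1 - p) ^+ (2 * M * D))); last first.
  by rewrite mulr_suml; apply: ler_sum => i _; exact: closed_sphere.
apply: ler_wpM2r; first exact: exprn_ge0.
rewrite mulrC /Pr -ExZ -Ex_sum; apply: Ex_le => // w _.
have [Pw|nPw] := pselect (P w); last first.
  by rewrite indF// mulr0; apply: sumr_ge0 => i _; exact: ind_ge0.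
rewrite indT// mulr1; case: Pw => -[z Uz cz] rU nr.
have iU i : (i <= r)%N -> ball w o i `<=` U by move=> ir; apply: subset_trans rU; exact: ball_le.
have fb i : (i <= r)%N -> finite_set (ball w o i).
  by move=> /iU h; exact: sub_finite_set fU.
have small i : (i < r)%N -> (2 * M)%:R * (1 - ind (F i w)) <= (nb (sphere w o i))%:R :> R.
  move=> ir; have [Fi|nF] := pselect (F i w); first by rewrite indT// subrr mulr0.
  rewrite indF// subr0 mulr1 ler_nat leqNgt; apply/negP => lt; apply: nF; split.
  - exact: iU.
  - apply/set0P/negP => /eqP S0; apply: Uz; have [n bn] := conn_ball cz.
    apply: (iU i (ltnW ir)); apply: (ball_stationary _ bn).
    by rewrite ball_setC_sphere S0 setU0.
  - exact: ltnW.
have total n : (n <= r)%N -> (\sum_(0 <= i < n) nb (sphere w o i) <= nb (ball w o n))%N.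
  elim: n => [|n IH] nr'; first by rewrite big_nil.
  have fS : finite_set (sphere w o n) by apply: sub_finite_set (fb _ nr'); exact: subDsetl.
  have dj : ball w o n `&` sphere w o n = set0 by rewrite /sphere setDE setICA setICr setI0.
  rewrite big_nat_recr//= ball_setC_sphere (nb_disjoint (fb _ (ltnW nr')) fS dj).
  by rewrite leq_add2r IH// ltnW.
have h : \sum_(0 <= i < r) (2 * M)%:R * (1 - ind (F i w)) <= (M * r)%:R :> R.
  apply: (@le_trans _ _ (\sum_(0 <= i < r) nb (sphere w o i))%:R).
    by rewrite natr_sum; apply: ler_sum_nat => i /andP[_ ?]; exact: small.
  by rewrite ler_nat; apply: leq_trans (total r (leqnn r)) _; exact: ltnW.
move: h; rewrite -mulr_sumr sumrB [X in _ * (X - _)](_ : _ = r%:R); last first.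
  by rewrite big_const_nat subn0 iter_addr_0.
rewrite !natrM; set S := \sum_(_ <= _ < _) _.
have M0' : (0 : R) < M%:R by rewrite ltr0n.
rewrite (_ : 2%:R * M%:R * (r%:R - S) = M%:R * (2 * (r%:R - S))); last by ring.
by rewrite ler_pM2l// => h; lra.
Qed.

End Growth.

(** * Concentration of exit capacities *)

Section Concentration.
Variables (R : realType) (G : multigraph) (p : R).
Local Notation V := (vertex G).
Local Notation E := (edge G).
Hypotheses (p0 : 0 <= p) (p1 : p <= 1).
Implicit Types (w : set E) (A B U : set V) (o : V).

Lemma depends_ball o n A (S : V) : depends (fun s => ind (ball s o n = A) : R) (touch A).
Proof.
move=> s s' ss'; apply: ind_eq.
have ag (u v : set E) : u `&` touch A = v `&` touch A -> ball u o n = A -> ball v o n = A.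
  by move=> uv uA; rewrite -{}uA in uv *; rewrite (ball_agree uv).
by split; exact: ag.
Qed.

(** For each value [A] of the ball, the event that the ball equals [A] is independent of the
    capacity of [A]. This capacity has mean at least [M / K] and variance at most 8 times its mean,
    so [chebyshev_lower] applies. *)
Lemma capA_concentrated (l : seq E) U o r (K M : R) : uniq l -> (0 < r)%N -> 0 < K -> 0 < M ->
  (forall A, A `<=` U -> A !=set0 ->
     (nb A)%:R / (K * r%:R) <= Ex p l (capA R l r U A)) ->
  Pr p l (fun w => [/\ ball w o r `<=` U, M * r%:R <= (nb (ball w o r))%:R &
    capA R l r U (ball w o r) w < (nb (ball w o r))%:R / (2 * K * r%:R)]) <= 32 * K / M.
Proof.
move=> ul r0 K0 M0 hE; have r0' : 0 < r%:R :> R by rewrite ltr0n.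
set P := fun w => [/\ _, _ & _].
have [vals [_ hv]] := Ex_partition p l (fun w => ball w o r).
have KM0 : 0 <= 32 * K / M by rewrite !mulr_ge0 ?invr_ge0// ltW.
have h1 := hv (fun=> 1); rewrite Ex_cst in h1.
rewrite /Pr hv -[leRHS]mulr1 [X in _ <= _ * X]h1 mulr_sumr; apply: ler_sum => A _.
pose T w := ind (capA R l r U A w < (nb A)%:R / (2 * K * r%:R)) : R.
have [[AU NA]|bad] := pselect (A `<=` U /\ M * r%:R <= (nb A)%:R); last first.
  rewrite (_ : Ex _ _ _ = 0).
    by apply: mulr_ge0 => //; apply: Ex_ge0 => // s _; rewrite mulr1 ind_ge0.
  rewrite -[RHS](Ex_cst p l 0); apply: Ex_ext => s _.
  have [sA|nA] := pselect (ball s o r = A); last by rewrite indF// mul0r.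
  by rewrite (indF _ (P := P s)) ?mulr0// /P sA => -[*]; apply: bad.
apply: (@le_trans _ _ (Ex p l (fun s => ind (ball s o r = A) * T s))).
  apply: Ex_le => // s _; have [sA|nA] := pselect (ball s o r = A); last by rewrite indF// !mul0r.
  by apply: ler_wpM2l; [exact: ind_ge0|apply: ind_le; rewrite /P sA => -[]].
rewrite (@Ex_indep _ _ _ _ _ _ (touch A)); last 2 first.
- exact: depends_ball.
- move=> s s' ss'; have dA : depends (capA R l r U A) (off A) by exact: capA_depends.
  by rewrite /T (dA s s').
have -> : Ex p l (fun s => ind (ball s o r = A) * 1) = Ex p l (fun s => ind (ball s o r = A)).
  by apply: Ex_ext => s _; rewrite mulr1.
rewrite mulrC; apply: ler_wpM2r; first by apply: Ex_ge0 => // s _; exact: ind_ge0.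
have A0 : A !=set0.
  apply/set0P/negP => /eqP A0; have := lt_le_trans (mulr_gt0 M0 r0') NA.
  by rewrite A0 /nb fset_set0 cardfs0 ltxx.
have hm := hE A AU A0; set m := Ex p l (capA R l r U A) in hm *.
have mM : M / K <= m.
  apply: le_trans hm; rewrite ler_pdivrMr// mulrAC ler_pdivlMr ?mulr_gt0//.
  by rewrite mulrCA mulrC ler_pM2r//; apply: le_trans NA; rewrite mulrC.
have cheb : m * Pr p l (fun s => capA R l r U A s < m / 2) <= 32.
  apply: chebyshev_lower => //; first by move=> s _; apply: Cap_ge0; exact: okA_edge.
  by apply: Cap_variance => //; exact: okA_edge.
have : M / K * Ex p l T <= 32.
  apply: le_trans cheb; apply: ler_pM => //.
  - by rewrite divr_ge0// ltW.
  - by apply: Ex_ge0 => // s _; exact: ind_ge0.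
  - apply: Ex_le => // s _; apply: ind_le => h; apply: lt_le_trans h _.
    rewrite ler_pdivlMr// (le_trans _ hm)// le_eqVlt; apply/orP; left; apply/eqP.
    by field; rewrite !gt_eqF.
by rewrite mulrAC ler_pdivrMr// mulrC -ler_pdivlMr// => h; rewrite mulrAC; lra.
Qed.
End Concentration.

(** * Pivotal contact edges *)

Section Extension.
Variables (R : realType) (E : choiceType) (l : seq E).
Hypothesis ul : uniq l.
Implicit Types (mu nu : seq (R * route E)).

Definition at_contact e mu := [seq x <- mu | x.2.1 == Some e].

Lemma sum_contacts mu (F : R * route E -> R) :
  (forall x, x \in mu -> exists2 e, x.2.1 = Some e & e \in l) ->
  \sum_(x <- mu) F x = \sum_(e <- l) \sum_(x <- at_contact e mu) F x.
Proof.
move=> hc; rewrite [RHS](eq_bigr (fun e => \sum_(x <- mu) F x * ind (x.2.1 = Some e))).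
  rewrite exchange_big; apply: eq_big_seq => x /hc[e xe el].
  rewrite (bigD1_seq e)//= indT// mulr1 big1 ?addr0// => e' ne.
  by rewrite indF ?mulr0// xe => -[ee']; rewrite ee' eqxx in ne.
move=> e _; rewrite /at_contact big_filter big_mkcond /=; apply: eq_bigr => x _.
by case: eqP => h; [rewrite indT ?mulr1|rewrite indF ?mulr0].
Qed.

Lemma mass_at_contact e mu : mass (at_contact e mu) = cload mu e.
Proof.
rewrite /mass /at_contact /cload big_filter big_mkcond /=; apply: eq_bigr => x _.
by case: eqP => h; [rewrite indT ?mulr1|rewrite indF ?mulr0].
Qed.

Lemma sum_sqr_le (I : Type) (s : seq I) (F : I -> R) : (forall i, 0 <= F i) ->
  \sum_(i <- s) F i ^+ 2 <= (\sum_(i <- s) F i) ^+ 2.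
Proof.
move=> F0; elim: s => [|i s IH]; first by rewrite !big_nil expr0n.
have h : 0 <= F i * (\sum_(j <- s) F j) *+ 2 by rewrite mulrn_wge0// mulr_ge0// sumr_ge0.
by rewrite !big_cons sqrrD lerD// lerDl.
Qed.

Lemma sum_load_at_contact mu : nonneg mu ->
  (forall x, x \in mu -> exists2 e, x.2.1 = Some e & e \in l) ->
  \sum_(e <- l) \sum_(g <- l) load (at_contact e mu) g ^+ 2 <= \sum_(g <- l) load mu g ^+ 2.
Proof.
move=> mu0 hc; rewrite exchange_big; apply: ler_sum => g _.
rewrite [X in _ <= X ^+ 2]/load (sum_contacts _ hc); apply: sum_sqr_le => e.
by apply: load_ge0 => x; rewrite mem_filter => /andP[_ /mu0].
Qed.

Definition fpath_load (pi : E -> set E) mu g : R :=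
  \sum_(x <- mu) x.1 * ind (exists2 e, x.2.1 = Some e & pi e g).

(** The contact edge and the path [pi e] leading to it become ordinary edges of a longer route,
    which therefore has no contact. *)
Definition extend (pi : E -> set E) mu : seq (R * route E) :=
  [seq (x.1, (None, [set g | fp x.2 g \/ exists2 e, x.2.1 = Some e & pi e g])) | x <- mu].

Lemma mass_extend pi mu : mass (extend pi mu) = mass mu.
Proof. by rewrite /mass big_map. Qed.

Lemma load_extend pi mu g : nonneg mu ->
  load (extend pi mu) g <= load mu g + fpath_load pi mu g.
Proof.
move=> mu0; rewrite /load big_map -big_split /=; apply: ler_sum_seq => x /mu0 x0.
rewrite -mulrDr; apply: ler_wpM2l => //; apply: le_trans (ind_or_le _ _ _).
by apply: ind_le => -[|].
Qed.

Lemma extend_nonneg pi mu : nonneg mu -> nonneg (extend pi mu).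
Proof. by move=> h _ /mapP[x xm ->] /=; exact: h. Qed.

Lemma fpath_load_ge0 pi mu g : nonneg mu -> 0 <= fpath_load pi mu g.
Proof. by move=> h; apply: sumr_seq_ge0 => x /h x0; rewrite mulr_ge0 ?ind_ge0. Qed.

(** The added paths may share edges, so only crude bounds are available: no edge carries more than
    the total mass, and the loads add up to at most [n] times the mass. *)
Lemma sum_fpath_load_sqr pi mu (n : R) : 0 <= n -> nonneg mu ->
  (forall e, \sum_(g <- l) ind (pi e g) <= n) ->
  \sum_(g <- l) fpath_load pi mu g ^+ 2 <= n * mass mu ^+ 2.
Proof.
move=> n0 mu0 hn.
have lem g : fpath_load pi mu g <= mass mu.
  by apply: ler_sum_seq => x /mu0 x0; rewrite ler_piMr ?ind_le1.
apply: (@le_trans _ _ (\sum_(g <- l) mass mu * fpath_load pi mu g)).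
  by apply: ler_sum => g _; rewrite expr2; apply: ler_wpM2r => //; exact: fpath_load_ge0.
rewrite -mulr_sumr expr2 mulrCA; apply: ler_wpM2l; first exact: mass_ge0.
rewrite exchange_big /= mulrC /mass mulr_suml; apply: ler_sum_seq => x /mu0 x0.
rewrite -mulr_sumr; apply: ler_wpM2l => //.
case xe : x.2.1 => [e|]; last first.
  by rewrite big1// => g _; rewrite indF// => -[].
apply: le_trans (hn e); apply: ler_sum => g _; apply: ind_le => -[e' [->]] //.
Qed.

End Extension.

(** * Closed contact edges whose opening raises the capacity *)

Section GoodContacts.
Variables (R : realType) (G : multigraph) (D : nat) (l : seq (edge G)).
Local Notation V := (vertex G).
Local Notation E := (edge G).
Hypotheses (hD : hasdeg G D) (D0 : (0 < D)%N) (ul : uniq l).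
Variables (U : set V) (o : V) (w : set E) (r : nat) (A : set V) (K : R).
Hypotheses (fU : finite_set U) (Uo : U o) (wl : w `<=` [set` l]) (r0 : (0 < r)%N).
Hypotheses (hA : A = ball w o r) (AU : A `<=` U) (K0 : 0 < K).
Local Notation N := (nb A)%:R.
Hypothesis hN : 256 * K * r%:R <= N :> R.
Hypothesis hO : capO R l U o w < (16 * r%:R)^-1.
Hypothesis hcap : N / (2 * K * r%:R) <= capA R l r U A w.

Let r0' : 0 < r%:R :> R. Proof. by rewrite ltr0n. Qed.
Let r1' : 1 <= r%:R :> R. Proof. by rewrite ler1n. Qed.

(** A point of the ball of radius [r] is joined to [o] inside it by at most [r] edges. Edges that do
    not leave [A] receive the empty path, so that a path can be chosen for every edge. *)
Lemma inner_path_exists e : exists g : set E, [/\ g `<=` w `&` inside A,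
  \sum_(f <- l) ind (g f) <= r%:R :> R &
  forall u u', joins e u u' -> A u -> ~ A u' -> conn g o u].
Proof.
have [[u [u' [j Au Au']]]|none] := pselect (exists u u', [/\ joins e u u', A u & ~ A u']).
  have := Au; rewrite {1}hA => /ball_path[s [sr sw c]].
  exists [set` s]; split; first by rewrite hA.
    by apply: le_trans (sum_ind_seq R s ul) _; rewrite ler_nat.
  by move=> v v' j' Av Av'; case: (joins_uniq j j') => -[? ?]; subst.
exists set0; split=> //; first by rewrite big1// => f _; exact: indF.
by move=> u u' j Au Au'; case: none; exists u, u'.
Qed.

(** A near-optimal measure for [capA] leaves mostly through closed contacts, since open ones would
    make [capO] large. A quarter of its mass passes through contacts behind which the flow has
    energy of order at most [r] times its square and overlaps little with a near-optimal measure for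
    [capO]. Opening such a contact allows an extra flow of order [1 / r]. *)
Lemma good_contacts : N / (64 * K) <= \sum_(e <- l)
  ind (~ w e /\ (8 * (2 + 512 * K * D%:R) * r%:R)^-1 <= capO R l U o (e |` w) - capO R l U o w).
Proof.
have [pi hpi] := choice inner_path_exists.
have pi_w e : pi e `<=` w by move=> f; case: (hpi e) => /(_ f) h _ _ /h[].
have pi_r e : \sum_(f <- l) ind (pi e f) <= r%:R :> R by case: (hpi e).
have okO1 := okO_edge (l := l) Uo.
have okA1 := @okA_edge G l U A.
(* [Y = 2 (1 + b)] with [b = 256 K D]: [b r] bounds the energy of a unit flow behind a good contact,
   [r] that of the path from [o] to it, and the 2 comes from the square of a sum. *)
set Y : R := 2 + 512 * K * D%:R.
have D0' : 0 < D%:R :> R by rewrite ltr0n.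
have KD0 : 0 < K * D%:R by rewrite mulr_gt0.
have Y2 : 2 <= Y by rewrite /Y; lra.
pose g : R := (4 * Y * r%:R)^-1.
have Y0 : 0 < Y by apply: lt_le_trans Y2.
have g0 : 0 < g by rewrite invr_gt0 !mulr_gt0.
have Kr0 : 0 < K * r%:R by rewrite mulr_gt0.
have N0 : 0 < N :> R by have := hN; rewrite -mulrA; lra.
have [nu [vnu nuE num nuM]] : exists nu, [/\ valid (okA l U A) w nu, energy l r nu = mass nu,
    N / (4 * K * r%:R) <= mass nu & mass nu <= capA R l r U A w].
  have d0 : 0 < N / (4 * K * r%:R) :> R by rewrite divr_gt0 ?mulr_gt0.
  have [nu [h1 h2 h3 h4]] := Cap_near r okA1 w d0.
  exists nu; split=> //; apply: le_trans h3; move: hcap; rewrite /capA.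
  have -> : N / (2 * K * r%:R) = N / (4 * K * r%:R) + N / (4 * K * r%:R) :> R.
    by field; rewrite !gt_eqF.
  by rewrite lerBrDr.
have nu0 := valid_nonneg vnu.
set m := mass nu in num nuE *.
have m64 : 64 <= m.
  apply: le_trans num; rewrite ler_pdivlMr ?mulr_gt0// (le_trans _ hN)//.
  by rewrite le_eqVlt; apply/orP; left; apply/eqP; ring.
have nuc x : x \in nu -> exists2 e, x.2.1 = Some e & e \in l.
  by case/vnu=> _ [e [_ [_ [xe el _ _ _]]]] _; exists e.
(* An exit route whose contact edge is open extends backwards to a route from [o]. *)
have vext w' mu : (forall x, x \in mu -> x \in nu /\ (exists2 e, x.2.1 = Some e & w' e)) ->
    w `<=` w' -> w' `<=` [set` l] -> valid (okO l U o) w' (extend pi mu).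
  move=> hmu ww' w'l _ /mapP[x /hmu[xnu [e xe w'e]] ->].
  have [x0 [e1 [u [u' [xe1 el j [Au Au'] [xoff rx]]]]] xw] := vnu _ xnu.
  have /= {xe1}ee1 : e1 = e by move: xe1; rewrite xe => -[].
  subst e1; have [_ _ /(_ _ _ j Au Au') cu] := hpi e.
  have sub : [set f | fp x.2 f \/ exists2 e, x.2.1 = Some e & pi e f] `<=` w'.
    move=> f [[|]|[e' ]].
    - by rewrite xe => -[<-].
    - by move=> /xw/ww'.
    - by rewrite xe => -[<-] /pi_w/ww'.
  split=> //=; split=> //=; last exact: subset_trans w'l.
  apply: (reach_conn (x := o) (y := u')).
    apply: (conn_step _ _ j); last by left; left.
    by apply: conn_mono cu => f pf; right; exists e.
  by apply: reach_mono rx => f xf; left; right.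
have en0 mu : energy l 0 mu = \sum_(f <- l) load mu f ^+ 2 :> R.
  by rewrite /energy /en mul0r addr0.
have loadnu : \sum_(f <- l) load nu f ^+ 2 <= m by rewrite -nuE; exact: sum_load_sqr.
have cloadnu : \sum_(e <- l) cload nu e ^+ 2 <= m / r%:R.
  by rewrite ler_pdivlMr// mulrC -nuE; exact: sum_cload_sqr.
have sqr2 (a b : R) : (a + b) ^+ 2 <= 2 * a ^+ 2 + 2 * b ^+ 2.
  by rewrite -subr_ge0 (_ : _ - _ = (a - b) ^+ 2) ?sqr_ge0//; ring.
have load_sqr2 (a b : E -> R) : \sum_(f <- l) (a f + b f) ^+ 2 <=
    2 * \sum_(f <- l) a f ^+ 2 + 2 * \sum_(f <- l) b f ^+ 2.
  by rewrite !mulr_sumr -big_split; apply: ler_sum => f _; exact: sqr2.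
(* If half of the mass left through open contacts, the extended routes would
   make [capO] too large. *)
have open_small : mass [seq x <- nu | `[< exists2 e, x.2.1 = Some e & w e >]] < m / 2.
  rewrite ltNge; apply/negP => mo.
  set no := [seq _ <- _ | _] in mo.
  have no0 : nonneg no by move=> x; rewrite mem_filter => /andP[_]; exact: nu0.
  have vo : valid (okO l U o) w (extend pi no).
    apply: vext => //; move=> x; rewrite mem_filter => /andP[/asboolP h xnu].
    by split.
  have noE : \sum_(f <- l) load no f ^+ 2 <= m.
    by rewrite -nuE; apply: le_trans (sum_load_sqr l r no) _; exact: energy_filter.
  set mo' := mass no in mo.
  have eE : energy l 0 (extend pi no) <= 2 * m + 2 * (r%:R * mo' ^+ 2).
    rewrite en0; apply: (@le_trans _ _ (\sum_(f <- l) (load no f + fpath_load pi no f) ^+ 2)).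
      apply: ler_sum => f _; rewrite ler_sqr ?nnegrE.
      - exact: load_extend.
      - by apply: load_ge0; exact: extend_nonneg.
      - by rewrite addr_ge0// ?load_ge0// fpath_load_ge0.
    apply: le_trans (load_sqr2 _ _) _; apply: lerD; first by rewrite ler_pM2l.
    by rewrite ler_pM2l//; apply: sum_fpath_load_sqr => //; rewrite ltW.
  have mo0 : 0 < mo' by lra.
  (* At this scale the value is at least [3 / (8 r) - 1 / (4 r ^ 2 mo')], which exceeds [1 / (16 r)]
     because [mo' >= 32]. *)
  pose t : R := (4 * r%:R * mo')^-1.
  have t0 : 0 < t by rewrite invr_gt0 !mulr_gt0.
  have := Cap_ub 0 okO1 (valid_scale (ltW t0) vo).
  rewrite mass_scale mass_extend energy_scale -/mo' -/(capO R l U o w) => h.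
  have : 2 * (t * mo') - t ^+ 2 * (2 * (2 * mo') + 2 * (r%:R * mo' ^+ 2)) <= capO R l U o w.
    apply: le_trans h; rewrite lerD2l lerN2; apply: ler_wpM2l; first exact: sqr_ge0.
    by apply: le_trans eE _; rewrite lerD2r; lra.
  rewrite (_ : _ - _ = 3 / (8 * r%:R) - (4 * r%:R ^+ 2 * mo')^-1); last first.
    by rewrite /t; field; rewrite !gt_eqF.
  have : (4 * r%:R ^+ 2 * mo')^-1 <= (16 * r%:R)^-1.
    rewrite lef_pV2 ?posrE ?mulr_gt0 ?exprn_gt0//.
    rewrite expr2 (_ : 4 * (r%:R * r%:R) * mo' = 4 * (r%:R * (r%:R * mo'))); last by ring.
    rewrite (_ : 16 * r%:R = 4 * (r%:R * 4)); last by ring.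
    rewrite ler_pM2l// ler_pM2l//; apply: (@le_trans _ _ (1 * mo')); first by lra.
    by apply: ler_wpM2r; [exact: ltW|exact: r1'].
  have e1 : 3 / (8 * r%:R) = 6 * (16 * r%:R)^-1 :> R by field; rewrite gt_eqF.
  have : 0 < (16 * r%:R)^-1 :> R by rewrite invr_gt0 mulr_gt0.
  rewrite e1; move: hO; lra.
have closed_mass : m / 2 <= \sum_(e <- l) ind (~ w e) * cload nu e.
  have <- : m - mass [seq x <- nu | `[< exists2 e, x.2.1 = Some e & w e >]] = 
      \sum_(e <- l) ind (~ w e) * cload nu e.
    rewrite /m /mass big_filter (bigID (fun x => `[< exists2 e, x.2.1 = Some e & w e >])) /=.
    rewrite addrAC subrr add0r big_mkcond (sum_contacts ul _ nuc); apply: eq_bigr => e _.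
    rewrite -mass_at_contact /mass mulr_sumr /at_contact; apply: eq_big_seq => x.
    rewrite mem_filter => /andP[/eqP xe _]; case: asboolP => /= [[e' xe' we']|ne].
      by move: xe'; rewrite xe => -[->]; rewrite indF ?mul0r.
    by rewrite indT ?mul1r// => we; apply: ne; exists e.
  by move: open_small; set mo := mass _; lra.
have [mu [vmu muE mu1 mu2]] : exists mu, [/\ valid (okO l U o) w mu, energy l 0 mu = mass mu,
    capO R l U o w - g / 2 <= mass mu & mass mu <= capO R l U o w].
  by apply: (Cap_near 0 okO1); rewrite divr_gt0.
have mu0 := valid_nonneg vmu; set c0 := mass mu in muE mu1 mu2.
have c0r : c0 <= (16 * r%:R)^-1 by apply: le_trans mu2 (ltW hO).
have c00 : 0 <= c0 by exact: mass_ge0.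
have loadmu : \sum_(f <- l) load mu f ^+ 2 = c0 by rewrite -en0.
pose X e : R := \sum_(f <- l) load mu f * load (at_contact e nu) f.
pose L e : R := \sum_(f <- l) load (at_contact e nu) f ^+ 2.
pose k e := cload nu e.
have nue0 e : nonneg (at_contact e nu) by move=> x; rewrite mem_filter => /andP[_]; exact: nu0.
have k0 e : 0 <= k e by exact: cload_ge0.
have L0 e : 0 <= L e by apply: sumr_ge0 => f _; exact: sqr_ge0.
have X0 e : 0 <= X e by apply: sumr_ge0 => f _; rewrite mulr_ge0 ?load_ge0.
pose b : R := 256 * K * D%:R.
have b0 : 0 < b by rewrite /b; lra.
(* Opening a closed contact [e] adds a flow through [e] of size of order [1/r]
   to [mu]; this pays off if the routes through [e] are spread out and overlap
   little with [mu]. The other closed contacts carry at most half of [m / 2]. *)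
pose good e := [/\ ~ w e, 0 < k e, L e <= b * r%:R * k e ^+ 2 & X e <= k e / 4].
have goodP e : e \in l -> good e ->
    (8 * Y * r%:R)^-1 <= capO R l U o (e |` w) - capO R l U o w.
  move=> el [we ke Le Xe].
  (* A flow [x] gains [2 x] from its mass and adds at most [3 x / 2] to the energy. The error
     [g / 2 = x / 4] in the choice of [mu] still leaves [x / 4]. *)
  pose x : R := (2 * Y * r%:R)^-1.
  have x0 : 0 < x by rewrite invr_gt0 !mulr_gt0.
  have xk0 : 0 <= x / k e by rewrite divr_ge0 ?k0// ltW.
  have ewl : e |` w `<=` [set` l] by move=> f [->|/wl].
  have v' : valid (okO l U o) (e |` w) (mu ++ scale (x / k e) (extend pi (at_contact e nu))).
    apply: valid_cat; first by apply: valid_mono vmu => f ?; right.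
    apply: valid_scale => //; apply: vext => //.
    move=> y; rewrite mem_filter => /andP[/eqP ye ynu]; split => //.
    by exists e => //; left.
  have := Cap_ub 0 okO1 v'; rewrite -/(capO R l U o (e |` w)) mass_cat mass_scale mass_extend.
  rewrite mass_at_contact -/(k e) divfK ?gt_eqF//.
  pose a f := load mu f; pose i f : R := ind (pi e f).
  pose B f := x / k e * load (at_contact e nu) f + x * i f.
  have B0 f : 0 <= B f.
    apply: addr_ge0; apply: mulr_ge0 => //; by [exact: load_ge0|exact: ltW|exact: ind_ge0].
  have ld f : load (extend pi (at_contact e nu)) f <= load (at_contact e nu) f + k e * i f.
    apply: le_trans (load_extend _ _ (nue0 e)) _; rewrite lerD2l -[k e](mass_at_contact e nu) /mass mulr_suml.
    rewrite /fpath_load; apply: ler_sum_seq => y; rewrite mem_filter => /andP[/eqP ye ynu].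
    by apply: ler_wpM2l; [exact: nu0|apply: ind_le; rewrite ye => -[e' [->]]].
  have eE : energy l 0 (mu ++ scale (x / k e) (extend pi (at_contact e nu))) <=
      \sum_(f <- l) (a f + B f) ^+ 2.
    rewrite en0; apply: ler_sum => f _; rewrite load_cat load_scale ler_sqr ?nnegrE.
    - rewrite lerD2l; apply: (le_trans (ler_wpM2l xk0 (ld f))).
      by rewrite mulrDr mulrA divfK ?gt_eqF.
    - apply: addr_ge0; first exact: load_ge0.
      by apply: mulr_ge0 => //; apply: load_ge0; exact: extend_nonneg.
    - by apply: addr_ge0 => //; exact: load_ge0.
  have s1 : \sum_(f <- l) a f * i f <= 1 / 4.
    apply: (@le_trans _ _ (\sum_(f <- l) (2 * r%:R * a f ^+ 2 + (8 * r%:R)^-1 * i f))).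
      apply: ler_sum => f _; apply: le_trans (@amgm _ (4 * r%:R) _ _ _) _; first by rewrite mulr_gt0.
      rewrite (_ : 4 * r%:R / 2 = 2 * r%:R); last by field.
      rewrite lerD2l mulrC (_ : 2 * (4 * r%:R) = 8 * r%:R); last by ring.
      apply: ler_wpM2l; first by rewrite invr_ge0 mulr_ge0// ltW.
      by rewrite expr2 ler_piMr ?ind_ge0 ?ind_le1.
    rewrite big_split /= -!mulr_sumr loadmu.
    apply: (@le_trans _ _ (2 * r%:R * (16 * r%:R)^-1 + (8 * r%:R)^-1 * r%:R)).
      by apply: lerD; apply: ler_wpM2l => //; exact: pi_r.
    by rewrite le_eqVlt; apply/orP; left; apply/eqP; field; rewrite gt_eqF.
  have s2 : \sum_(f <- l) a f * B f <= x / 2.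
    rewrite (eq_bigr (fun f => x / k e * (a f * load (at_contact e nu) f) + x * (a f * i f))); last first.
      by move=> f _; rewrite /B; ring.
    rewrite big_split /= -!mulr_sumr -/(X e).
    have h1 : x / k e * X e <= x / 4.
      by apply: (le_trans (ler_wpM2l xk0 Xe)); rewrite mulrA divfK ?gt_eqF.
    by have := ler_wpM2l (ltW x0) s1; lra.
  have s3 : \sum_(f <- l) B f ^+ 2 <= x / 2.
    apply: le_trans (load_sqr2 _ _) _.
    rewrite (eq_bigr (fun f => (x / k e) ^+ 2 * load (at_contact e nu) f ^+ 2)); last first.
      by move=> f _; rewrite exprMn.
    rewrite [X in _ + 2 * X](eq_bigr (fun f => x ^+ 2 * (i f * i f))); last first.
      by move=> f _; rewrite exprMn expr2.
    rewrite -!mulr_sumr -/(L e).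
    have h1 : (x / k e) ^+ 2 * L e <= x ^+ 2 * (b * r%:R).
      apply: (le_trans (ler_wpM2l (sqr_ge0 _) Le)).
      by rewrite le_eqVlt; apply/orP; left; apply/eqP; field; rewrite gt_eqF.
    have h2 : x ^+ 2 * (\sum_(f <- l) i f * i f) <= x ^+ 2 * r%:R.
      apply: ler_wpM2l; first exact: sqr_ge0.
      by apply: le_trans (pi_r e); apply: ler_sum => f _; rewrite ler_piMr ?ind_ge0 ?ind_le1.
    rewrite (_ : x / 2 = 2 * (x ^+ 2 * (b * r%:R)) + 2 * (x ^+ 2 * r%:R)); first by lra.
    have -> : 2 * (x ^+ 2 * (b * r%:R)) + 2 * (x ^+ 2 * r%:R) = x * (x * (Y * r%:R)).
      by rewrite /Y /b; ring.
    by congr (_ * _); rewrite /x; field; rewrite !gt_eqF.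
  have s4 : \sum_(f <- l) (a f + B f) ^+ 2 <= c0 + x + x / 2.
    rewrite (eq_bigr (fun f => a f ^+ 2 + 2 * (a f * B f) + B f ^+ 2)); last by move=> f _; ring.
    by rewrite !big_split /= -mulr_sumr loadmu; lra.
  have e1 : (8 * Y * r%:R)^-1 = x / 4 by rewrite /x; field; rewrite !gt_eqF.
  have e2 : g = x / 2 by rewrite /x /g; field; rewrite !gt_eqF.
  move: mu1; rewrite e1 e2 -/c0; lra.
(* The total overlap is at most [16 c0 + m / 64], where [16 c0 <= 1] since [capO] is small, and
   [1 <= m / 64]. *)
have sumX : \sum_(e <- l) X e <= m / 32.
  rewrite /X exchange_big /=.
  rewrite (eq_bigr (fun f => load mu f * load nu f)); last first.
    by move=> f _; rewrite -mulr_sumr; congr (_ * _); rewrite [RHS](sum_contacts ul _ nuc).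
  apply: (@le_trans _ _ (\sum_(f <- l) (16 * load mu f ^+ 2 + 64^-1 * load nu f ^+ 2))).
    apply: ler_sum => f _; apply: le_trans (@amgm _ 32 _ _ _) _ => //.
    by rewrite le_eqVlt; apply/orP; left; apply/eqP; field.
  rewrite big_split /= -!mulr_sumr loadmu.
  have : (16 * r%:R)^-1 <= 16^-1 :> R by rewrite lef_pV2 ?posrE ?mulr_gt0//; have := r1'; lra.
  by move: c0r loadnu m64; lra.
(* Chosen so that [be / 2 = b r / 16]: a contact with too much energy has [k e] at most [L e / 16]
   plus a constant, and these constants, summed over the edges touching [A], give at most
   [m / 16]. *)
pose be : R := 32 * D%:R * K * r%:R.
have be0 : 0 < be by rewrite !mulr_gt0.
have ktouch e : 0 < k e -> touch A e.
  move=> ke; apply: contrapT => nt; move: ke; rewrite /k /cload big_seq big1 ?ltxx// => x xnu.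
  rewrite indF ?mulr0// => xe; apply: nt.
  have [_ [e1 [u [u' [xe1 _ j [Au _] _]]]] _] := vnu _ xnu.
  by have [->] : Some e = Some e1; [rewrite -xe|exact: joins_touch j Au].
have kbad e : ind (~ w e) * k e <=
    ind (good e) * k e + 4 * X e + (16^-1 * L e + ind (touch A e) / (2 * be)).
  have nn : 0 <= 4 * X e + (16^-1 * L e + ind (touch A e) / (2 * be)).
    by rewrite !addr_ge0 ?mulr_ge0 ?ind_ge0 ?invr_ge0// ?mulr_ge0// ltW.
  have [we|we] := pselect (w e).
    rewrite (indF _ (P := ~ w e)) ?mul0r; last by move=> /(_ we).
    by rewrite -addrA addr_ge0// mulr_ge0 ?ind_ge0.
  rewrite indT// mul1r; have [ge|ng] := pselect (good e).
    by rewrite indT// mul1r -addrA lerDl.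
  rewrite indF// mul0r add0r; have [ke|] := ltP 0 (k e); last by move=> ke; apply: le_trans ke nn.
  have tA := ktouch e ke.
  have [Xe|Xe] := leP (X e) (k e / 4); last first.
    apply: (@le_trans _ _ (4 * X e)); first by lra.
    rewrite lerDl addr_ge0 ?mulr_ge0 ?ind_ge0 ?invr_ge0// ?mulr_ge0// ltW//.
  have Le : b * r%:R * k e ^+ 2 < L e by rewrite ltNge; apply/negP => Le; apply: ng.
  rewrite indT// -[leLHS]mulr1; apply: le_trans (@amgm _ be _ _ be0) _.
  rewrite expr1n -[leLHS]add0r; apply: lerD; first by rewrite mulr_ge0.
  rewrite lerD2r; apply: (@le_trans _ _ (16^-1 * (b * r%:R * k e ^+ 2))).
    by rewrite le_eqVlt; apply/orP; left; apply/eqP; rewrite /be /b; field.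
  by rewrite ler_pM2l// ltW.
have good_mass : m / 4 <= \sum_(e <- l) ind (good e) * k e.
  have := le_trans closed_mass (ler_sum _ (fun e _ => kbad e)).
  rewrite !big_split /= -!mulr_sumr -mulr_suml.
  have h1 : \sum_(e <- l) L e <= m by apply: le_trans (sum_load_at_contact ul nu0 nuc) _.
  have h2 : (\sum_(e <- l) ind (touch A e)) / (2 * be) <= m / 16.
    apply: (@le_trans _ _ ((D%:R * N) / (2 * be))).
      apply: ler_wpM2r; first by rewrite invr_ge0 mulr_ge0// ltW.
      have fA := sub_finite_set AU fU.
      apply: (le_trans (sum_ind_nb R ul (finite_touch hD fA))).
      by rewrite -natrM ler_nat; exact: nb_touch.
    move: num; rewrite ler_pdivrMr ?mulr_gt0// => num; rewrite ler_pdivrMr ?mulr_gt0//.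
    apply: (le_trans (ler_wpM2l (ltW D0') num)).
    by rewrite le_eqVlt; apply/orP; left; apply/eqP; rewrite /be; field.
  lra.
(* This is where the price of contacts enters: [r] times the sum of the [k e ^ 2] is at most [m], so
   a mass [m / 4] needs at least [m r / 16] contacts. *)
have good_count : m * r%:R / 16 <= \sum_(e <- l) ind (good e).
  have : m / 4 <= \sum_(e <- l) (r%:R / 8 * k e ^+ 2 + 2 / r%:R * ind (good e)).
    apply: le_trans good_mass _; apply: ler_sum => e _; rewrite mulrC.
    apply: le_trans (@amgm _ (r%:R / 4) _ _ _) _; first by rewrite divr_gt0.
    rewrite (_ : r%:R / 4 / 2 = r%:R / 8); last by field.
    rewrite lerD2l (_ : (2 * (r%:R / 4))^-1 = 2 / r%:R); last by field; rewrite gt_eqF.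
    rewrite mulrC; apply: ler_wpM2l; first by rewrite divr_ge0// ltW.
    by rewrite expr2 ler_piMr ?ind_ge0 ?ind_le1.
  rewrite big_split /= -!mulr_sumr => h.
  have h2 : r%:R / 8 * (\sum_(e <- l) k e ^+ 2) <= m / 8.
    apply: (@le_trans _ _ (r%:R / 8 * (m / r%:R))).
      by apply: ler_wpM2l => //; rewrite divr_ge0// ltW.
    by rewrite le_eqVlt; apply/orP; left; apply/eqP; field; rewrite gt_eqF.
  have h3 : m / 8 <= 2 / r%:R * (\sum_(e <- l) ind (good e)) by lra.
  have := ler_wpM2l (ltW r0') h3.
  set S := \sum_(_ <- _) _; rewrite (_ : r%:R * (2 / r%:R * S) = 2 * S); last by field; rewrite gt_eqF.
  lra.
apply: (@le_trans _ _ (m * r%:R / 16)).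
  move: num; rewrite ler_pdivrMr ?mulr_gt0// => num; rewrite ler_pdivrMr ?mulr_gt0//.
  by apply: le_trans num _; rewrite le_eqVlt; apply/orP; left; apply/eqP; field.
apply: le_trans good_count _; rewrite big_seq [leRHS]big_seq; apply: ler_sum => e el.
by apply: ind_le => ge; split; [case: ge|exact: goodP].
Qed.
End GoodContacts.

(** * Weak escapes are unlikely *)

Section WeakEscape.
Variables (R : realType) (G : multigraph) (D : nat) (p : R).
Local Notation V := (vertex G).
Local Notation E := (edge G).
Hypotheses (hD : hasdeg G D) (D0 : (0 < D)%N) (p0 : 0 < p) (p1 : p < 1).
Implicit Types (l : seq E) (w : set E) (U A : set V) (o : V).

Lemma nat_above (x : R) : exists n : nat, x <= n%:R.
Proof.
have [x0|x0] := leP 0 x; last by exists 0%N; exact: ltW.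
by exists (Num.bound x); apply: ltW; exact: archi_boundP.
Qed.

(** An edge with a large influence carries a load of the same order in a near-optimal measure, and
    the squared loads add up to at most [c]. For [c < 1 / (4 r)] the drop [1 / (8 Y r)] is used;
    otherwise removing the edge leaves at most [c / 4], so its load is at least [c / 4]. *)
Lemma pivotal_count l U o r w (Y : R) : U o -> (0 < r)%N -> 1 <= Y ->
  \sum_(e <- l) ind (capO R l U o (w `\ e) < (16 * r%:R)^-1 /\
     (8 * Y * r%:R)^-1 <= capO R l U o w - capO R l U o (w `\ e)) <= 256 * Y ^+ 2 * r%:R :> R.
Proof.
move=> Uo r0 Y1; have okO1 := okO_edge (l := l) Uo.
have r0' : 0 < r%:R :> R by rewrite ltr0n.
have Y0 : 0 < Y by apply: lt_le_trans Y1.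
pose piv e := capO R l U o (w `\ e) < (16 * r%:R)^-1 /\
     (8 * Y * r%:R)^-1 <= capO R l U o w - capO R l U o (w `\ e).
rewrite (eq_bigr (fun e => ind (piv e)))//.
set c := capO R l U o w.
(* Few edges carry a load [>= t], since the squared loads add up to at most [c]. *)
have few (t d : R) : 0 < t -> 0 < d -> (forall e, piv e -> 2 * t + d <= c - capO R l U o (w `\ e)) ->
    (\sum_(e <- l) ind (piv e)) * t ^+ 2 <= c.
  move=> t0 d0 ht; have [mu [vmu muE mu1 mu2]] := Cap_near 0 okO1 w d0.
  apply: le_trans mu2; rewrite -muE; apply: le_trans (sum_load_sqr l 0 mu).
  rewrite mulr_suml; apply: ler_sum => e _.
  have [pe|pe] := pselect (piv e); last by rewrite indF// mul0r sqr_ge0.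
  rewrite indT// mul1r ler_sqr ?nnegrE; [|exact: ltW|exact: load_ge0 (valid_nonneg vmu)].
  have := le_trans (ht e pe) (Cap_removal okO1 e vmu muE mu1).
  by rewrite lerD2r ler_pM2l.
have S0 : 0 <= \sum_(e <- l) ind (piv e) :> R by apply: sumr_ge0 => e _; exact: ind_ge0.
set S := \sum_(e <- l) _ in few S0 *.
have e16 : (16 * r%:R)^-1 = (4 * r%:R)^-1 / 4 :> R by field; rewrite gt_eqF.
have [cs|cl] := ltP c (4 * r%:R)^-1.
  (* Chosen so that [2 t + 2 t / 3 = 1 / (8 Y r)], where [2 t / 3] is the error allowed in the
     choice of the measure. *)
  pose t : R := 3 / 64 / (Y * r%:R).
  have t0 : 0 < t by rewrite divr_gt0// mulr_gt0.
  have t1 : 0 < 2 * t / 3 by rewrite divr_gt0// mulr_gt0.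
  have : S * t ^+ 2 <= c.
    apply: (few t _ t0 t1) => e [_]; apply: le_trans.
    by rewrite le_eqVlt; apply/orP; left; apply/eqP; rewrite /t; field; rewrite !gt_eqF.
  move=> /le_trans/(_ (ltW cs)); rewrite -ler_pdivlMr ?exprn_gt0// => /le_trans; apply.
  rewrite (_ : _ / _ = 1024 / 9 * (Y ^+ 2 * r%:R)); last first.
    by rewrite /t; field; rewrite !gt_eqF.
  have : 0 <= Y ^+ 2 * r%:R by rewrite mulr_ge0 ?sqr_ge0.
  lra.
have c0 : 0 < c by apply: lt_le_trans cl; rewrite invr_gt0 mulr_gt0.
have : S * (c / 4) ^+ 2 <= c.
  apply: (few _ (c / 4)); rewrite ?divr_gt0// => e [h _]; move: h; rewrite e16; move: cl; lra.
rewrite (_ : S * _ = c * (S * c / 16)); last by field.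
rewrite -[leRHS]mulr1 ler_pM2l// => h.
have : S * (4 * r%:R)^-1 <= 16 by apply: le_trans (ler_wpM2l S0 cl) _; lra.
rewrite ler_pdivrMr ?mulr_gt0// => /le_trans; apply.
have : 1 * r%:R <= Y ^+ 2 * r%:R by rewrite ler_pM2r// expr_ge1// ltW.
lra.
Qed.

(** Double counting of pairs of a configuration in the event and a good closed contact. Each
    configuration has at least [M r / (64 K)] such contacts, and a configuration obtained by opening
    one arises at most [256 Y ^ 2 r] times. The powers of [r] cancel. *)
Lemma good_event l U o r (K M : R) : uniq l -> finite_set U -> U o -> (0 < r)%N -> 0 < K ->
  256 * K <= M ->
  Pr p l (fun w => [/\ ball w o r `<=` U, M * r%:R <= (nb (ball w o r))%:R,
      capO R l U o w < (16 * r%:R)^-1 &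
      (nb (ball w o r))%:R / (2 * K * r%:R) <= capA R l r U (ball w o r) w])
    * (p * M) <= 256 * 64 * K * (2 + 512 * K * D%:R) ^+ 2.
Proof.
move=> ul fU Uo r0 K0 KM; set P := fun w => [/\ _, _, _ & _].
have r0' : 0 < r%:R :> R by rewrite ltr0n.
set Y : R := 2 + 512 * K * D%:R.
have Y1 : 1 <= Y.
  have : 0 <= K * D%:R by rewrite mulr_ge0// ltW.
  by rewrite /Y; lra.
pose h e s : R := ind (capO R l U o (s `\ e) < (16 * r%:R)^-1 /\
     (8 * Y * r%:R)^-1 <= capO R l U o s - capO R l U o (s `\ e)).
have M0 : 0 < M by lra.
have h1 : M * r%:R / (64 * K) * Pr p l P <= \sum_(e <- l) Ex p l (fun s => ind (~ s e) * h e (e |` s)).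
  rewrite -Ex_sum; apply: markov_Pr; rewrite ?(ltW p0) ?(ltW p1)//.
  - by rewrite divr_ge0// mulr_ge0// ltW.
  - by move=> s _; apply: sumr_ge0 => e _; rewrite mulr_ge0 ?ind_ge0.
  move=> s sl [sU sN sO sA].
  have := good_contacts hD D0 ul fU Uo sl r0 (erefl (ball s o r)) sU K0.
  move=> /(_ (le_trans _ sN)) /= /(_ _ sO sA) gc.
  apply: (@le_trans _ _ ((nb (ball s o r))%:R / (64 * K))).
    by rewrite ler_pM2r// invr_gt0 mulr_gt0.
  apply: le_trans (gc _) _; first by rewrite ler_pM2r.
  apply: ler_sum => e _; rewrite -ind_and; apply: ind_le => -[ne hh]; split=> //.
  have -> : (e |` s) `\ e = s; last by [].
  apply/seteqP; split=> f /=; first by move=> [[|]].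
  by move=> sf; split; [right|move=> fe; apply: ne; rewrite -fe].
have h2 : p * (M * r%:R / (64 * K) * Pr p l P) <= 256 * Y ^+ 2 * r%:R.
  apply: (le_trans (ler_wpM2l (ltW p0) h1)); rewrite mulr_sumr.
  apply: (@le_trans _ _ (\sum_(e <- l) Ex p l (fun s => h e s))).
    apply: ler_sum_seq => e el; rewrite insertion//.
    apply: (@le_trans _ _ (1 * Ex p l (fun s => ind (s e) * h e s))).
      apply: ler_wpM2r; last by rewrite gerBl ltW.
      by apply: Ex_ge0 => [||s _]; rewrite ?(ltW p0) ?(ltW p1)// mulr_ge0 ?ind_ge0.
    rewrite mul1r; apply: Ex_le; rewrite ?(ltW p0) ?(ltW p1)// => s _.
    by rewrite ler_piMl ?ind_ge0 ?ind_le1.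
  rewrite -Ex_sum -[leRHS](Ex_cst p l); apply: Ex_le; rewrite ?(ltW p0) ?(ltW p1)// => s _.
  exact: pivotal_count.
rewrite -(ler_pM2r r0').
rewrite (_ : _ * r%:R = 64 * K * (p * (M * r%:R / (64 * K) * Pr p l P))); last first.
  by field; rewrite gt_eqF.
apply: (le_trans (ler_wpM2l _ h2)); first by rewrite mulr_ge0// ltW.
by rewrite le_eqVlt; apply/orP; left; apply/eqP; ring.
Qed.

Definition exit_bound l U r (K : R) := forall A, A `<=` U -> A !=set0 ->
  (nb A)%:R / (K * r%:R) <= Ex p l (capA R l r U A).

(** A weak escape keeps the ball of radius [r] inside [U]; then this ball is small, or has a low
    exit capacity, or is in the situation of [good_event]. Each of the three has probability at most
    [eps / 3]. That [r0] depends neither on [U] nor on [l] is essential for the bootstrap. *)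
Lemma weak_escape_unlikely (K eps : R) : 0 < K -> 0 < eps -> exists r0, forall r, (r0 <= r)%N ->
  forall l U o, uniq l -> finite_set U -> U o -> exit_bound l U r K ->
  Pr p l (fun w => reach U w o /\ capO R l U o w < (16 * r%:R)^-1) <= eps.
Proof.
move=> K0 e0; have [C hC C0] : exists2 C : R, C = 256 * 64 * K * (2 + 512 * K * D%:R) ^+ 2 & 0 <= C.
  eexists; first by []; apply: mulr_ge0 (sqr_ge0 _); apply: mulr_ge0 (ltW K0).
  by apply: mulr_ge0; exact: ler0n.
(* [M] is dictated by the bounds of concentration and insertion, which do not involve [r].
   Afterwards [r] is taken large in terms of [M], which makes small balls unlikely. *)
have [M hM] := nat_above (256 * K + 96 * K / eps + 3 * C / (eps * p) + 1).
have [h1 h2 h3] : [/\ 0 < 256 * K, 0 <= 96 * K / eps & 0 <= 3 * C / (eps * p)].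
  split; first by lra.
    by apply: divr_ge0 (ltW e0); apply: mulr_ge0 (ltW K0); exact: ler0n.
  by apply: divr_ge0; [apply: mulr_ge0 C0; exact: ler0n|apply: mulr_ge0; exact: ltW].
set a : R := (1 - p) ^+ (2 * M * D).
have a0 : 0 < a by rewrite exprn_gt0// subr_gt0.
have [r0 hr0] := nat_above (6 / (eps * a) + 1).
have ea0 : 0 < eps * a by rewrite mulr_gt0.
have h4 : 0 <= 6 / (eps * a) by rewrite divr_ge0// ltW.
exists r0 => r r0r l U o ul fU Uo hE.
have hr : 6 / (eps * a) + 1 <= r%:R by apply: le_trans hr0 _; rewrite ler_nat.
have rr : 0 < r%:R :> R by apply: lt_le_trans hr; lra.
have r1 : (0 < r)%N by rewrite -(ltr0n R).
have MM : 0 < M%:R :> R by apply: lt_le_trans hM; lra.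
have M1 : (0 < M)%N by rewrite -(ltr0n R).
have p0' := ltW p0; have p1' := ltW p1.
have g1 := ball_growth p0' p1' hD o r ul fU M1.
have g2 := capA_concentrated p0' p1' o ul r1 K0 MM hE.
have g3 := @good_event l U o r K M%:R ul fU Uo r1 K0.
move: g1 g2 g3; set P1 := Pr p l _; set P2 := Pr p l _; set P3 := Pr p l _ => g1 g2 g3.
have P10 : 0 <= P1 by apply: Pr_ge0.
have P30 : 0 <= P3 by apply: Pr_ge0.
have b1 : P1 <= eps / 3.
  have : P1 * (r%:R / 2 * a) <= 1 by rewrite mulrA.
  rewrite -ler_pdivlMr ?mulr_gt0// => /le_trans; apply.
  rewrite ler_pdivrMr ?mulr_gt0//.
  have : 6 / (eps * a) <= r%:R by lra.
  rewrite ler_pdivrMr// => h; rewrite (_ : _ / 3 * _ = r%:R * (eps * a) / 6); first by lra.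
  by field.
have b2 : P2 <= eps / 3.
  apply: le_trans g2 _; rewrite ler_pdivrMr//.
  have : 96 * K / eps <= M%:R by lra.
  rewrite ler_pdivrMr// => h; lra.
have b3 : P3 <= eps / 3.
  have : P3 * (p * M%:R) <= C by rewrite hC; apply: g3; lra.
  rewrite -ler_pdivlMr ?mulr_gt0// => /le_trans; apply.
  rewrite ler_pdivrMr ?mulr_gt0//.
  have : 3 * C / (eps * p) <= M%:R by lra.
  rewrite ler_pdivrMr ?mulr_gt0// => h; rewrite (_ : _ / 3 * _ = M%:R * (eps * p) / 3); first by lra.
  by field.
apply: (@le_trans _ _ (P1 + (P2 + P3))); last by lra.
have hor (A1 A2 A3 : set E -> Prop) :
    Pr p l (fun s => A1 s \/ (A2 s \/ A3 s)) <= Pr p l A1 + (Pr p l A2 + Pr p l A3).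
  apply: (le_trans (Pr_or p0' p1' l A1 _)).
  by have := Pr_or p0' p1' l A2 A3; lra.
apply: le_trans (hor _ _ _); rewrite {hor P1 P2 P3 g1 g2 g3 b1 b2 b3 P10 P30}.
apply: Pr_le => // s sl [rs so].
have bU : ball s o r `<=` U.
  apply: contrapT => /(capO_ball R Uo ul sl r1) h; have := le_lt_trans h so.
  rewrite ltf_pV2 ?posrE ?mulr_gt0//; lra.
have [N1|N1] := leqP (M * r) (nb (ball s o r)); last by left.
right; have N1' : M%:R * r%:R <= (nb (ball s o r))%:R :> R by rewrite -natrM ler_nat.
by have [h|h] := ltP (capA R l r U (ball s o r) s) ((nb (ball s o r))%:R / (2 * K * r%:R));
  [left|right]; split.
Qed.
End WeakEscape.

(** * Packings of routes *)

Section Packing.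
Variables (R : realType) (E : choiceType) (l : seq E) (r : nat) (ok : route E -> Prop).
Hypothesis ul : uniq l.
Hypothesis hok : forall x, ok x -> exists2 g, g \in l & fp x g.

Lemma sum_sqr_few (I : eqType) (s : seq I) (S : I -> Prop) (a : I -> R) (k : R) :
  0 < k -> (forall i, i \in s -> a i != 0 -> S i) -> \sum_(i <- s) ind (S i) <= k ->
  (\sum_(i <- s) a i) ^+ 2 <= k * \sum_(i <- s) a i ^+ 2.
Proof.
move=> k0 aS sk; set T := \sum_(i <- s) a i.
have : 0 <= \sum_(i <- s) (a i - T / k * ind (S i)) ^+ 2 by apply: sumr_ge0 => i _; exact: sqr_ge0.
rewrite [X in 0 <= X](_ : _ = \sum_(i <- s) a i ^+ 2 - 2 * (T / k) * T + (T / k) ^+ 2 * \sum_(i <- s) ind (S i)).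
  move=> h; have h2 := ler_wpM2l (sqr_ge0 (T / k)) sk.
  have {h h2} : 0 <= \sum_(i <- s) a i ^+ 2 - 2 * (T / k) * T + (T / k) ^+ 2 * k by lra.
  rewrite (_ : _ - _ + _ = \sum_(i <- s) a i ^+ 2 - T ^+ 2 / k); last by field; rewrite gt_eqF.
  by rewrite subr_ge0 ler_pdivrMr// mulrC.
rewrite {2}/T !mulr_sumr -sumrB -big_split /=; apply: eq_big_seq => i si.
rewrite [in LHS](_ : (_ - _) ^+ 2 = a i ^+ 2 - 2 * (T / k) * (a i * ind (S i)) + (T / k) ^+ 2 * (ind (S i) * ind (S i))); last by ring.
rewrite -ind_and [in X in _ + X](_ : ind (S i /\ S i) = ind (S i)); last by apply: ind_eq; split => [[]|].
congr (_ - _ + _); have [->|/(aS i si) h] := eqVneq (a i) 0; first by rewrite mul0r.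
by rewrite indT// mulr1.
Qed.

Lemma mass_flatten (I : Type) (s : seq I) (nu : I -> seq (R * route E)) :
  mass (flatten (map nu s)) = \sum_(i <- s) mass (nu i).
Proof. by elim: s => [|i s IH] /=; rewrite ?big_nil ?mass_nil// big_cons mass_cat IH. Qed.

Lemma load_flatten (I : Type) (s : seq I) (nu : I -> seq (R * route E)) g :
  load (flatten (map nu s)) g = \sum_(i <- s) load (nu i) g.
Proof.
by elim: s => [|i s IH] /=; rewrite ?big_nil ?big_cons ?load_cat ?IH// /load big_nil.
Qed.

Lemma cload_flatten (I : Type) (s : seq I) (nu : I -> seq (R * route E)) g :
  cload (flatten (map nu s)) g = \sum_(i <- s) cload (nu i) g.
Proof.
by elim: s => [|i s IH] /=; rewrite ?big_nil ?big_cons ?cload_cat ?IH// /cload big_nil.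
Qed.

Lemma sum_cload_le_mass mu : nonneg mu -> \sum_(g <- l) cload mu g <= mass mu :> R.
Proof.
move=> mu0; rewrite /cload exchange_big /= /mass; apply: ler_sum_seq => x /mu0 x0.
rewrite -mulr_sumr ler_piMr//; case xe : x.2.1 => [e|]; last first.
  by rewrite big1 ?ler01// => g _; rewrite indF.
apply: le_trans (_ : \sum_(g <- l) ind ([set` [:: e]] g) <= 1).
  by apply: ler_sum => g _; apply: ind_le => -[->]; rewrite /= inE.
by apply: le_trans (sum_ind_seq R _ ul) _.
Qed.

(** The sum of the unit measures has mass [size s]. At most [k] of them use a given edge, so by
    Cauchy-Schwarz its energy is at most [k (M + r)] per measure; [r] suffices for the contacts
    because the squared contact flows of a unit measure add up to at most 1. The sum is then divided
    by [k (M + r)]. *)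
Lemma cap_packing (I : eqType) (s : seq I) (nu : I -> seq (R * route E))
    (S : I -> E -> Prop) (w : set E) (k M : R) : 0 < k -> 0 < M + r%:R ->
  (forall i, i \in s -> valid ok w (nu i)) ->
  (forall i, i \in s -> mass (nu i) = 1) ->
  (forall i, i \in s -> \sum_(g <- l) load (nu i) g ^+ 2 <= M) ->
  (forall i g, i \in s -> load (nu i) g != 0 -> S i g) ->
  (forall g, g \in l -> \sum_(i <- s) ind (S i g) <= k) ->
  (size s)%:R / (k * (M + r%:R)) <= Cap R l r ok w.
Proof.
move=> k0 M0 hv hm hM hS hk.
set mu := flatten (map nu s).
have vmu : valid ok w mu.
  by move=> x /flattenP[_ /mapP[i si ->]]; exact: hv.
have mmu : mass mu = (size s)%:R.
  rewrite mass_flatten (eq_big_seq (fun=> 1)) ?hm//.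
  by rewrite big_const_seq count_predT iter_addr_0.
have emu : energy l r mu <= k * (M + r%:R) * (size s)%:R.
  have -> : k * (M + r%:R) * (size s)%:R = k * (\sum_(i <- s) M) + r%:R * (k * \sum_(i <- s) 1).
    by rewrite !big_const_seq !count_predT !iter_addr_0 -[M *+ _]mulr_natr; ring.
  apply: lerD; last apply: ler_wpM2l => //.
    apply: (@le_trans _ _ (\sum_(g <- l) k * \sum_(i <- s) load (nu i) g ^+ 2)).
      apply: ler_sum_seq => g gl; rewrite load_flatten.
      by apply: (sum_sqr_few (S := fun i => S i g)) => //; [move=> i si; exact: hS|exact: hk].
    rewrite -mulr_sumr ler_pM2l// exchange_big /=; exact: ler_sum_seq.
  apply: (@le_trans _ _ (\sum_(g <- l) k * \sum_(i <- s) cload (nu i) g ^+ 2)).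
    apply: ler_sum_seq => g gl; rewrite cload_flatten.
    apply: (sum_sqr_few (S := fun i => S i g)) => //; last exact: hk.
    move=> i si c0; apply: hS => //; rewrite gt_eqF//.
    have n0 := valid_nonneg (hv i si).
    by apply: lt_le_trans (cload_le_load g n0); rewrite lt_def c0 cload_ge0.
  rewrite -mulr_sumr ler_pM2l// exchange_big /=; apply: ler_sum_seq => i si.
  have n0 := valid_nonneg (hv i si).
  apply: le_trans (sum_sqr_le _ _) _; first by move=> g; exact: cload_ge0.
  have := sum_cload_le_mass n0; rewrite hm// => h.
  by rewrite exprn_ile1// sumr_ge0// => g _; exact: cload_ge0.
have kM : 0 < k * (M + r%:R) by rewrite mulr_gt0.
have c0 : 0 <= (k * (M + r%:R))^-1 by rewrite invr_ge0 ltW.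
apply: le_trans (Cap_ub r hok (valid_scale c0 vmu)).
rewrite mass_scale energy_scale mmu.
have := ler_wpM2l (sqr_ge0 (k * (M + r%:R))^-1) emu.
rewrite (_ : _ ^+ 2 * (_ * _) = (k * (M + r%:R))^-1 * (size s)%:R).
  by rewrite mulrC; lra.
by rewrite expr2; move: (k * (M + r%:R)) kM => z z0; field; rewrite gt_eqF.
Qed.
End Packing.

(** * Disjoint branches at trifurcations *)

Lemma count_lt (T : eqType) (P Q : pred T) (s : seq T) z :
  (forall x, P x -> Q x) -> z \in s -> Q z -> ~~ P z -> (count P s < count Q s)%N.
Proof.
move=> PQ zs Qz Pz; have <- : (count P s + count (predI Q (predC P)) s = count Q s)%N.
  rewrite -count_predUI [X in (_ + X)%N](_ : _ = 0%N) ?addn0; last first.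
    by apply/eqP; rewrite -leqn0 leqNgt -has_count; apply/hasP => -[x _ /= /and3P[-> _]].
  by apply: eq_count => x /=; case: (boolP (P x)) => [/PQ ->|]; rewrite ?andbT.
by rewrite -[ltnLHS]addn0 ltn_add2l -has_count; apply/hasP; exists z => //=; rewrite Qz.
Qed.

Section BurtonKeane.
Variable G : multigraph.
Local Notation V := (vertex G).
Local Notation E := (edge G).
Variables (w : set E) (B : V -> set V) (C : V -> seq V).
Implicit Types (T : seq V) (v y c : V) (x : V * V).

Definition branch x : set V := [set v | conn (w `&` off (B x.1)) x.2 v].
(** Free branches play the part of the leaves in the forest formed by the trifurcations. *)
Definition free T x := forall v y, y \in T -> branch x v -> ~ B y v.

Record trifurcating T : Prop := Trifurcating {
  tri_open : forall y, y \in T -> touch (B y) `<=` w;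
  tri_conn : forall y u v, y \in T -> B y u -> B y v -> conn (inside (B y)) u v;
  tri_disj : forall y y' v, y \in T -> y' \in T -> B y v -> B y' v -> y = y';
  tri_inhabited : forall y, y \in T -> B y !=set0;
  tri_out : forall y c, y \in T -> c \in C y ->
    ~ B y c /\ exists b e, B y b /\ joins e b c;
  tri_sep : forall y c c', y \in T -> c \in C y -> c' \in C y ->
    conn (w `&` off (B y)) c c' -> c = c';
  tri_size : forall y, y \in T -> uniq (C y) /\ size (C y) = 3 }.

Lemma trifurcating_sub T T' : {subset T' <= T} -> trifurcating T -> trifurcating T'.
Proof.
move=> s [h1 h2 h3 h4 h5 h6 h7]; split; move=> *; eauto.
Qed.

Variable T : seq V.
Hypothesis tri : trifurcating T.

Lemma branch_out y c v : y \in T -> c \in C y -> branch (y, c) v -> ~ B y v.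
Proof.
move=> yT cC; have [nc _] := tri_out tri yT cC; move=> bv.
apply: (@conn_ind _ _ (fun v => ~ B y v) _ _ _ bv nc) => z z' e nz [_ oe] j Bz'.
by apply: oe; apply: (joins_touch (joins_sym j) Bz').
Qed.

Lemma branch_conn x v v' : branch x v -> conn (w `&` off (B x.1)) v v' -> branch x v'.
Proof. by move=> h h'; exact: (conn_trans h h'). Qed.

(* The ball of another point is connected and avoids [B y]. *)
Lemma branch_contains y c y' v u : y \in T -> y' \in T -> y' <> y ->
  branch (y, c) v -> B y' v -> B y' u -> branch (y, c) u.
Proof.
move=> yT y'T ne bv Bv Bu; apply: (branch_conn bv).
have := tri_conn tri y'T Bv Bu; apply: conn_mono => e ine; split.
  exact: (tri_open tri y'T (inside_sub_touch ine)).
by move=> [h|h]; apply: ne; [apply: (tri_disj tri y'T yT _ h)|apply: (tri_disj tri y'T yT _ h)];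
  case: ine.
Qed.

Lemma free_branch_sub y c y' c' v : y \in T -> c \in C y -> y' \in T ->
  free T (y, c) -> free T (y', c') -> branch (y, c) v -> branch (y', c') v ->
  forall u, branch (y, c) u -> branch (y', c') u.
Proof.
move=> yT cC y'T f f' bv bv' u bu; apply: (branch_conn bv').
have : conn (w `&` off (B y)) v u by apply: (conn_trans (conn_sym bv) bu).
move=> cvu; apply: (conn_finer cvu) => z z' e vz [we oe] j; split=> //.
have bz : branch (y, c) z by apply: branch_conn bv vz.
have bz' : branch (y, c) z' by apply: (branch_conn bz); apply: (conn_edge _ j); split.
by apply: (joins_off j); [apply: f y'T bz|apply: f y'T bz'].
Qed.

(** If the branches share a vertex but start from different balls, the first is contained in the
    second. The second then contains [c] and, across the open edges touching [B y], a point of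
    [B y], so it is not free. *)
Lemma free_branch_disjoint y c y' c' v : y \in T -> c \in C y -> y' \in T -> c' \in C y' ->
  free T (y, c) -> free T (y', c') -> branch (y, c) v -> branch (y', c') v -> (y, c) = (y', c').
Proof.
move=> yT cC y'T cC' f f' bv bv'.
have [e|ne] := pselect (y = y').
  subst y'; congr (_, _); apply: (tri_sep tri yT cC cC').
  exact: (conn_trans bv (conn_sym bv')).
have bc : branch (y', c') c.
  by apply: (free_branch_sub yT cC y'T f f' bv bv'); exact: conn_refl.
have [nBc [b [e [Bb j]]]] := tri_out tri yT cC.
have : branch (y', c') b.
  apply: (branch_conn bc); apply: (conn_edge _ (joins_sym j)); split.
    by apply: (tri_open tri yT); exact: (joins_touch j Bb).
  apply: joins_off j _ (f' _ _ y'T bc) => B'b; apply: ne.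
  exact: (tri_disj tri yT y'T Bb B'b).
by move=> /(f' _ _ yT).
Qed.

Definition meets x y := exists2 v, branch x v & B y v.

(** When the branch at [y] meets another ball [B y'], at most one of the three branches at [y']
    leads back to [B y]. Two others are contained in the branch at [y] and avoid [B y'], so they
    meet fewer balls; the induction is on the number of balls met. *)
Lemma free_pair_from n y c : y \in T -> c \in C y -> ~ free T (y, c) ->
  (count (fun y' => `[< meets (y, c) y' >]) T <= n)%N ->
  exists y' c1 c2, [/\ y' \in T, c1 \in C y', c2 \in C y', c1 != c2 &
    free T (y', c1) /\ free T (y', c2)].
Proof.
elim: n y c => [|n IH] y c yT cC nf hn.
  case: nf => v y' y'T bv Bv; move: hn; rewrite leqn0 -leqn0 leqNgt -has_count => /hasP; apply.
  by exists y' => //; apply/asboolP; exists v.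
have [y' [y'T [v [bv Bv]]]] : exists y', y' \in T /\ exists v, branch (y, c) v /\ B y' v.
  apply: contrapT => h; apply: nf => v y' y'T bv Bv; apply: h; exists y'; split => //.
  by exists v.
have ne : y' <> y by move=> e; subst y'; exact: (branch_out yT cC bv Bv).
have [b Bb] := tri_inhabited tri yT.
have one c1 c2 : c1 \in C y' -> c2 \in C y' -> meets (y', c1) y -> meets (y', c2) y -> c1 = c2.
  move=> C1 C2 [u1 b1 B1] [u2 b2 B2]; apply: (tri_sep tri y'T C1 C2).
  have b1' := branch_contains y'T yT (nesym ne) b1 B1 B2.
  exact: (conn_trans b1' (conn_sym b2)).
have lower c1 : c1 \in C y' -> ~ meets (y', c1) y ->
    (count (fun y1 => `[< meets (y', c1) y1 >]) T <= n)%N.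
  move=> C1 nm; rewrite -ltnS; apply: leq_trans hn.
  have bsub u : branch (y', c1) u -> branch (y, c) u.
    have [nBc [b' [e [Bb' j]]]] := tri_out tri y'T C1.
    have bb' := branch_contains yT y'T ne bv Bv Bb'.
    have bc1 : branch (y, c) c1.
      apply: (branch_conn bb'); apply: (conn_edge _ j); split.
        by apply: (tri_open tri y'T); exact: (joins_touch j Bb').
      apply: (joins_off j); first by move=> h; apply: ne; exact: (tri_disj tri y'T yT Bb' h).
      by move=> h; apply: nm; exists c1 => //; exact: conn_refl.
    move=> bu; apply: (branch_conn bc1); apply: (conn_finer bu) => z z' f hz [wf offB] jz; split=> //.
    apply: (joins_off jz) => h; apply: nm.
      by exists z.
    by exists z' => //; apply: (conn_trans hz); apply: (conn_edge _ jz); split.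
  apply: (count_lt (z := y')) => //.
  - by move=> y1 /asboolP[u bu Bu]; apply/asboolP; exists u => //; exact: bsub.
  - by apply/asboolP; exists v.
  - by apply/asboolP => -[u bu Bu]; exact: (branch_out y'T C1 bu Bu).
have [uC sC] := tri_size tri y'T.
have [c1 [c2 [C1 C2 c12 [n1 n2]]]] : exists c1 c2, [/\ c1 \in C y', c2 \in C y', c1 != c2 &
    ~ meets (y', c1) y /\ ~ meets (y', c2) y].
  move: uC sC one; case: (C y') => [|a [|a' [|a'' [|? ?]]]] //= /and3P[ua ua' _] _ one.
  move: ua ua'; rewrite !inE !negb_or => /andP[aa' aa''] a'a''.
  have [m|m] := pselect (meets (y', a) y).
    exists a', a''; rewrite !inE !eqxx !orbT; split=> //; split=> m'.
      by have := one a a'; rewrite !inE !eqxx !orbT => /(_ isT isT m m') h; rewrite h eqxx in aa'.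
    by have := one a a''; rewrite !inE !eqxx !orbT => /(_ isT isT m m') h; rewrite h eqxx in aa''.
  have [m'|m'] := pselect (meets (y', a') y).
    exists a, a''; rewrite !inE !eqxx !orbT; split=> //; split=> // m''.
    by have := one a' a''; rewrite !inE !eqxx !orbT => /(_ isT isT m' m'') h; rewrite h eqxx in a'a''.
  by exists a, a'; rewrite !inE !eqxx !orbT; split.
have [f1|f1] := pselect (free T (y', c1)); last exact: IH y'T C1 f1 (lower _ C1 n1).
have [f2|f2] := pselect (free T (y', c2)); last exact: IH y'T C2 f2 (lower _ C2 n2).
by exists y', c1, c2.
Qed.

Lemma free_pair : T != [::] -> exists y c1 c2,
  [/\ y \in T, c1 \in C y, c2 \in C y, c1 != c2 & free T (y, c1) /\ free T (y, c2)].
Proof.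
case eT : T => [//|y T'] _; have yT : y \in T by rewrite eT inE eqxx.
rewrite -eT; have [uC sC] := tri_size tri yT.
move: uC sC; case eC : (C y) => [|a [|a' [|a'' [|? ?]]]] //= /andP[ua _] _.
have Ca : a \in C y by rewrite eC !inE eqxx.
have Ca' : a' \in C y by rewrite eC !inE eqxx orbT.
have aa' : a != a' by move: ua; rewrite !inE negb_or => /andP[].
have [f|f] := pselect (free T (y, a)); last exact: (free_pair_from yT Ca f (leqnn _)).
have [f'|f'] := pselect (free T (y, a')); last exact: (free_pair_from yT Ca' f' (leqnn _)).
by exists y, a, a'.
Qed.
End BurtonKeane.

(** Remove a point [y] with two free branches and apply induction to the others. The free branches
    found there are disjoint, so at most one of them meets the connected set [B y]; it is lost, but
    the two branches at [y] are gained. *)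
Lemma free_branches (G : multigraph) (w : set (edge G)) (B : vertex G -> set (vertex G))
    (C : vertex G -> seq (vertex G)) (T : seq (vertex G)) : uniq T -> trifurcating w B C T ->
  exists F : seq (vertex G * vertex G), [/\ uniq F, (size T <= size F)%N &
    forall x, x \in F -> [/\ x.1 \in T, x.2 \in C x.1 & free w B T x]].
Proof.
elim: {T}(size T) {-2}T (erefl (size T)) => [|n IH] T sT uT tri.
  by exists [::]; rewrite sT.
have T0 : T != [::] by case: (T) sT.
have [y [c1 [c2 [yT C1 C2 c12 [f1 f2]]]]] := free_pair tri T0.
have sub : {subset rem y T <= T} by move=> z /mem_rem.
have triT := trifurcating_sub sub tri.
have sT' : size (rem y T) = n by rewrite size_rem// sT.
have [F [uF sF hF]] := IH _ sT' (rem_uniq y uT) triT.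
have F'free x : x \in F -> ~ meets w B x y -> free w B T x.
  move=> xF nm v y' y'T bv; have [_ _ fx] := hF _ xF.
  have [->|ne] := eqVneq y' y; first by move=> Bv; apply: nm; exists v.
  by apply: fx bv; rewrite mem_rem_uniq// inE ne.
have notF c x : x \in F -> x != (y, c).
  move=> xF; apply/eqP => e; have [+ _ _] := hF _ xF; rewrite e /=.
  by rewrite mem_rem_uniq// inE eqxx.
have one x x' : x \in F -> x' \in F -> meets w B x y -> meets w B x' y -> x = x'.
  move=> xF xF' [u bu Bu] [u' bu' Bu']; case: x xF bu => y1 d1 xF bu; case: x' xF' bu' => y2 d2 xF' bu'.
  have [/= yT1 Cd1 fx1] := hF _ xF; have [/= yT2 Cd2 fx2] := hF _ xF'.
  have y1y : y1 <> y by move=> e; have := yT1; rewrite e mem_rem_uniq// inE eqxx.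
  have bu2 := branch_contains tri (sub _ yT1) yT (nesym y1y) bu Bu Bu'.
  exact: (free_branch_disjoint triT yT1 Cd1 yT2 Cd2 fx1 fx2 bu2 bu').
have [[x0 [xF m0]]|none] := pselect (exists x, x \in F /\ meets w B x y); last first.
  exists ((y, c1) :: F); split.
  - by rewrite /= uF andbT; apply/negP => /(notF c1); rewrite eqxx.
  - by rewrite sT ltnS -sT'.
  move=> x; rewrite inE => /orP[/eqP ->//|xF]; have [h1 h2 _] := hF _ xF.
  by split=> //; [exact: sub|apply: F'free => // m; apply: none; exists x].
exists [:: (y, c1), (y, c2) & rem x0 F]; split.
- rewrite /= rem_uniq// andbT inE negb_or; apply/andP; split.
    by rewrite xpair_eqE eqxx /= c12 /=; apply/negP => /mem_rem/(notF c1); rewrite eqxx.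
  by apply/negP => /mem_rem/(notF c2); rewrite eqxx.
- by rewrite /= size_rem// sT prednK; [rewrite -sT'|case: (F) xF].
move=> x; rewrite !inE => /or3P[/eqP ->//|/eqP ->//|]; rewrite mem_rem_uniq// inE => /andP[xx0 xF'].
have [h1 h2 _] := hF _ xF'; split=> //; first exact: sub.
by apply: F'free => // m; move: xx0; rewrite (one _ _ xF' xF m m0) eqxx.
Qed.

(** * Exit measures built from short paths and from branches *)

Section ExitMeasures.
Variables (R : realType) (G : multigraph) (l : seq (edge G)) (r : nat).
Local Notation V := (vertex G).
Local Notation E := (edge G).
Hypothesis ul : uniq l.
Variables (U A : set V) (w : set E).
Hypotheses (AU : A `<=` U) (wl : w `<=` [set` l]).

(** Every route is cut at its last exit from [A]: the exit edge becomes the contact, and the rest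
    avoids [A]. Edges are only dropped, so no load increases. *)
Lemma cut_at_exit y (mu : seq (R * route E)) : A y -> valid (okO l U y) w mu ->
  exists nu, [/\ valid (okA l U A) w nu, mass nu = mass mu & forall g, load nu g <= load mu g].
Proof.
move=> Ay vmu.
have exit s : reach U s y -> exists e u u',
    [/\ s e, joins e u u', A u, ~ A u' & reach U (s `&` off A) u'].
  move=> [z Uz c].
  have [e [u [u' [se j Au Au' [_ cu']]]]] := last_exit c Ay (fun Az => Uz (AU Az)).
  by exists e, u, u'; split=> //; exists z.
(* The first route of a nonempty measure supplies the default edge [e0] needed for the choice of
   exits. *)
case: mu => [|y0 mu'] in vmu *; first by exists [::]; split.
set mu := y0 :: mu' in vmu *.
have [_ [_ /exit[e0 _] _] _] := vmu y0 (mem_head _ _).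
have /choice[phi hphi] : forall s : set E, exists e, reach U s y -> exists u u',
    [/\ s e, joins e u u', A u, ~ A u' & reach U (s `&` off A) u'].
  by move=> s; have [/exit[e h]|h] := pselect (reach U s y); [exists e|exists e0].
pose f (x : R * route E) := (x.1, (Some (phi x.2.2), x.2.2 `&` off A)).
exists (map f mu); split.
- move=> _ /mapP[x xmu ->]; have [x0 [_ rx xl] xw] := vmu _ xmu.
  have [u [u' [xe j Au Au' ru']]] := hphi _ rx; split=> //=.
    exists (phi x.2.2), u, u'; split=> //; first exact: xl.
    by split=> // e [xe' oe]; split=> //; exact: xl.
  by move=> e [/xw].
- by rewrite /mass big_map.
move=> g; rewrite /load big_map; apply: ler_sum_seq => x xmu.
have [x0 [_ rx xl] xw] := vmu _ xmu; apply: ler_wpM2l => //; apply: ind_le.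
have [u [u' [xe j Au Au' ru']]] := hphi _ rx.
by move=> [[<-]|[]]; right.
Qed.


(** Meant for points close to the complement of [U]: each sends a unit mass along its own small edge
    set. *)
Lemma near_packing (s : seq V) (gam : V -> set E) (n : nat) :
  (forall y, y \in s -> [/\ A y, gam y `<=` w, reach U (gam y) y &
    \sum_(g <- l) ind (gam y g) <= n%:R :> R]) ->
  (0 < n)%N ->
  (forall g, \sum_(y <- s) ind (gam y g) <= 3 :> R) ->
  (size s)%:R / (3 * (n%:R + r%:R)) <= capA R l r U A w.
Proof.
move=> hs n0 h3.
have /choice[nu hnu] : forall y, exists nu : seq (R * route E), y \in s ->
    [/\ valid (okA l U A) w nu, mass nu = 1 & forall g, load nu g <= ind (gam y g)].
  move=> y; have [ys|ys] := boolP (y \in s); last by exists [::].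
  have [Ay gw ry _] := hs _ ys.
  pose mu : seq (R * route E) := [:: (1, (None, gam y))].
  have v : valid (okO l U y) w mu.
    move=> x; rewrite inE => /eqP -> /=; split=> //.
    by split=> //; exact: subset_trans wl.
  have [nu [v' m' l']] := cut_at_exit Ay v; exists nu => _; split=> //.
    by rewrite m' /mass big_seq1.
  move=> g; apply: le_trans (l' g) _; rewrite /load big_seq1 mul1r.
  by apply: ind_le => -[].
have nu0 y : y \in s -> nonneg (nu y) by move=> /hnu[/valid_nonneg].
apply: (cap_packing ul (@okA_edge G l U A) (nu := nu) (S := fun y g => gam y g)) => //.
- by rewrite ltr_pwDl// ltr0n.
- by move=> y /hnu[].
- by move=> y /hnu[].
- move=> y ys; have [_ _ _ sn] := hs _ ys; apply: le_trans sn.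
  apply: ler_sum => g _; have [_ _ lg] := hnu _ ys.
  have lg0 := load_ge0 g (nu0 _ ys).
  rewrite -[leRHS]mulr1 expr2; apply: ler_pM => //.
  exact: le_trans (lg g) (ind_le1 _ _).
- move=> y g ys; apply: contraNP => ng; have [_ _ lg] := hnu _ ys.
  rewrite eq_le (load_ge0 g (nu0 _ ys)) andbT; apply: le_trans (lg g) _.
  by rewrite indF.
Qed.

Variables (B : V -> set V) (C : V -> seq V) (T : seq V) (n : nat) (a : R).
Hypotheses (uT : uniq T) (tri : trifurcating w B C T) (a0 : 0 < a).
Hypothesis TA : forall y, y \in T -> A y.
Hypothesis TC : forall y c, y \in T -> c \in C y -> U c.
Hypothesis BP : forall y b, y \in T -> B y b -> exists s : seq E,
  [/\ (size s <= n)%N, [set` s] `<=` inside (B y) & conn [set` s] y b].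
Hypothesis Ca : forall y c, y \in T -> c \in C y -> a <= capO R l U c (w `&` off (B y)).

(** Half of the capacity at [c], normalised to mass 1, has energy at most [2 / a]. It is connected
    to [y] by at most [n] edges inside [B y] and the edge to [c], which makes [n + 1]. The square of
    the sum doubles both terms. *)
Lemma branch_measure x : x.1 \in T -> x.2 \in C x.1 -> exists nu : seq (R * route E),
  [/\ valid (okA l U A) w nu, mass nu = 1,
    \sum_(g <- l) load nu g ^+ 2 <= 4 / a + 2 * n.+1%:R &
    forall g, load nu g != 0 -> inside (B x.1) g \/ (w g /\ touch (branch w B x) g)].
Proof.
case: x => y c /= yT cC.
have okO1 := okO_edge (l := l) (TC yT cC).
have [mu [vmu muE mu1 _]] : exists mu, [/\ valid (okO l U c) (w `&` off (B y)) mu,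
    energy l 0 mu = mass mu, a / 2 <= mass mu & mass mu <= capO R l U c (w `&` off (B y))].
  have a2 : 0 < a / 2 by rewrite divr_gt0.
  have [mu [h1 h2 h3 h4]] := Cap_near 0 okO1 (w `&` off (B y)) a2.
  exists mu; split=> //; apply: le_trans h3; have := Ca yT cC; rewrite /capO; lra.
have mu0 := valid_nonneg vmu.
set m := mass mu in muE mu1; have m0 : 0 < m by apply: lt_le_trans mu1; rewrite divr_gt0.
have [nBc [b [e0 [Bb j]]]] := tri_out tri yT cC.
have [s [sn sB cs]] := BP yT Bb.
have we0 : w e0 by apply: (tri_open tri yT); exact: (joins_touch j Bb).
pose P := [set` (e0 :: s)]; pose be := branch w B (y, c).
have bec : be c by exact: conn_refl.
have Pw : P `<=` w.
  move=> g; rewrite /P /= inE => /orP[/eqP -> //|gs]; apply: (tri_open tri yT).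
  by apply: inside_sub_touch; exact: sB.
have Psupp g : P g -> inside (B y) g \/ (w g /\ touch be g).
  rewrite /P /= inE => /orP[/eqP ->|/sB]; [right|by left]; split=> //.
  exact: (joins_touch (joins_sym j) bec).
have cP : conn P y c.
  apply: (conn_step _ _ j); last by rewrite /P /= inE eqxx.
  by apply: conn_mono cs => g gs; rewrite /P /= inE; apply/orP; right.
(* A route is a mere edge set and may contain edges away from the branch. Keeping only the edges
   that touch the branch preserves the connection and confines the loads. *)
pose f (x : R * route E) : R * route E := (m^-1 * x.1, (None, P `|` (x.2.2 `&` touch be))).
have vf : valid (okO l U y) w (map f mu).
  move=> _ /mapP[x xmu ->]; have [x0 [_ [z Uz cz] xl] xw] := vmu _ xmu.
  have sub : P `|` (x.2.2 `&` touch be) `<=` w by move=> g [/Pw//|[/xw[]]].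
  split=> /=; [by rewrite mulr_ge0// invr_ge0 ltW| |exact: sub].
  split=> //=; last exact: subset_trans wl.
  exists z => //; apply: (conn_trans (y := c)); first by apply: conn_mono cP => g; left.
  apply: (conn_finer cz) => v v' e cv xe jv; right; split=> //.
  by apply: (joins_touch jv); apply: conn_mono cv.
have [nu [vnu nuM nuL]] := cut_at_exit (TA yT) vf.
have nu0 := valid_nonneg vnu.
have massf : mass (map f mu) = 1.
  by rewrite /mass big_map -mulr_sumr mulVf// gt_eqF.
have loadf g : load (map f mu) g <= m^-1 * load mu g + ind (P g).
  rewrite -[ind (P g)]mul1r -massf /load /mass big_map mulr_sumr mulr_suml big_map -big_split /=.
  apply: ler_sum_seq => x xmu; have x0 := mu0 _ xmu.
  rewrite [X in _ <= X](_ : _ = m^-1 * x.1 * (ind (fp x.2 g) + ind (P g))); last by ring.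
  apply: ler_wpM2l; first by rewrite mulr_ge0// invr_ge0 ltW.
  apply: le_trans (ind_or_le _ _ _); apply: ind_le => -[//|[Pg|[xg _]]]; first by right.
  by left; right.
exists nu; split=> //; first by rewrite nuM.
  apply: (@le_trans _ _ (\sum_(g <- l) (2 * (m^-1 ^+ 2 * load mu g ^+ 2) + 2 * ind (P g)))).
    apply: ler_sum => g _; have h := le_trans (nuL g) (loadf g).
    apply: (@le_trans _ _ ((m^-1 * load mu g + ind (P g)) ^+ 2)).
      by rewrite ler_sqr ?nnegrE// ?(le_trans _ h)// load_ge0.
    rewrite -exprMn; set u := _ * load mu g; set v := ind _.
    have v2 : v ^+ 2 <= v by rewrite expr2 ler_piMr ?ind_ge0 ?ind_le1.
    have : 0 <= (u - v) ^+ 2 by exact: sqr_ge0.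
    by rewrite sqrrB sqrrD !mulr2n => ?; lra.
  rewrite big_split /= -!mulr_sumr; apply: lerD.
    apply: (@le_trans _ _ (2 * (m^-1 ^+ 2 * m))).
      rewrite ler_pM2l// ler_wpM2l ?sqr_ge0// -muE; exact: sum_load_sqr.
    rewrite (_ : m^-1 ^+ 2 * m = m^-1); last by field; rewrite gt_eqF.
    rewrite (_ : 4 / a = 2 * (a / 2)^-1); last by field; rewrite gt_eqF.
    by rewrite ler_pM2l// lef_pV2 ?posrE ?divr_gt0.
  rewrite ler_pM2l//; apply: (le_trans (sum_ind_seq R _ ul)).
  by rewrite ler_nat.
move=> g lg.
have : load (map f mu) g != 0.
  rewrite gt_eqF//; apply: lt_le_trans (nuL g); rewrite lt_def lg; exact: load_ge0.
move=> /load_gt0[_ /mapP[x xmu ->] [//|/= [/Psupp//|[xg tg]]]].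
by right; split=> //; have [_ _ /(_ _ xg)[]] := vmu _ xmu.
Qed.

(** An edge in the open part of a free branch serves one measure only; any other edge that is used
    lies inside a single ball [B y] and serves at most the three branches at [y]. Hence the factor
    3. *)
Lemma trifurcating_cap :
  (size T)%:R / (3 * (4 / a + 2 * n.+1%:R + r%:R)) <= capA R l r U A w.
Proof.
have [F [uF sF hF]] := free_branches uT tri.
have M0 : 0 < 4 / a + 2 * n.+1%:R :> R by rewrite addr_gt0 ?divr_gt0 ?mulr_gt0 ?ltr0n.
have M1 : 0 < 4 / a + 2 * n.+1%:R + r%:R by rewrite ltr_pwDl.
apply: (@le_trans _ _ ((size F)%:R / (3 * (4 / a + 2 * n.+1%:R + r%:R)))).
  by rewrite ler_pM2r ?invr_gt0 ?mulr_gt0// ler_nat.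
have /choice[nu hnu] : forall x, exists nu : seq (R * route E), x \in F ->
    [/\ valid (okA l U A) w nu, mass nu = 1,
    \sum_(g <- l) load nu g ^+ 2 <= 4 / a + 2 * n.+1%:R &
    forall g, load nu g != 0 -> inside (B x.1) g \/ (w g /\ touch (branch w B x) g)].
  move=> x; have [xF|xF] := boolP (x \in F); last by exists [::].
  by have [xT xC _] := hF _ xF; have [nu ?] := branch_measure xT xC; exists nu.
pose S (x : V * V) g := inside (B x.1) g \/ (w g /\ touch (branch w B x) g).
apply: (cap_packing ul (@okA_edge G l U A) (nu := nu) (S := S)) => //.
- by move=> x /hnu[].
- by move=> x /hnu[].
- by move=> x /hnu[].
- by move=> x g /hnu[_ _ _]; apply.
move=> g gl; rewrite sum_ind_count ler_nat -size_filter.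
have [[[y c] [xF [wg tg]]]|none] := pselect (exists x, x \in F /\ (w g /\ touch (branch w B x) g)).
  apply: (@leq_trans (size [:: (y, c)])) => //; apply: uniq_leq_size; first exact: filter_uniq.
  move=> [y' c']; rewrite mem_filter => /andP[/asboolP Sx x'F]; rewrite inE.
  have [/= yT cC f] := hF _ xF; have [/= yT' cC' f'] := hF _ x'F.
  have [v [v' [j bv]]] : exists v v', joins g v v' /\ branch w B (y, c) v.
    case: tg => h; first by exists (ends g).1, (ends g).2; split=> //; exact: joins_ends.
    by exists (ends g).2, (ends g).1; split=> //; exact: joins_sym (joins_ends g).
  case: Sx => /= [ins|[_ tg']].
    by have [Bv _] := inside_joins j ins; case: (f _ _ yT' bv Bv).
  apply/eqP; have [bv'|bv'] := touch_joins j tg'.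
    exact/esym/(free_branch_disjoint tri yT cC yT' cC' f f' bv bv').
  have bvv : branch w B (y, c) v'.
    have [h|h] := pselect (B y v'); first by case: (f' _ _ yT bv' h).
    apply: (branch_conn bv); apply: (conn_edge _ j); split=> //.
    by apply: (joins_off j) => //; exact: (f _ _ yT bv).
  exact/esym/(free_branch_disjoint tri yT cC yT' cC' f f' bvv bv').
case eF : [seq x <- F | _] => [//|[y c] F'].
have xF0 : (y, c) \in [seq x <- F | `[< S x g >]] by rewrite eF inE eqxx.
have inS x : x \in F -> S x g -> inside (B x.1) g.
  by move=> xF [//|h]; case: none; exists x.
rewrite -eF; move: xF0; rewrite mem_filter => /andP[/asboolP Sx xF].
have [/= yT cC _] := hF _ xF; have [uC sC] := tri_size tri yT.
apply: (@leq_trans (size (map (pair y) (C y)))); last by rewrite size_map sC.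
apply: uniq_leq_size; first exact: filter_uniq.
move=> [y' c']; rewrite mem_filter => /andP[/asboolP Sx' x'F].
have [/= yT' cC' _] := hF _ x'F.
have [h _] := inS _ xF Sx; have [h' _] := inS _ x'F Sx'.
by rewrite -(tri_disj tri yT yT' h h') in cC' *; exact: map_f.
Qed.

End ExitMeasures.

(** * Sizes of balls and separated subsets *)

Section Packings.
Variables (G : multigraph) (D : nat).
Local Notation V := (vertex G).
Hypothesis hD : hasdeg G D.

Lemma ball_card (w : set (edge G)) (y : V) n :
  finite_set (ball w y n) /\ (nb (ball w y n) <= D.+1 ^ n)%N.
Proof.
elim: n => [|n [fB nB]].
  rewrite expn0; split; first exact: finite_set1.
  by apply: (@nb_seq _ [:: y]) => z ->; rewrite /= inE.
have [f1 n1] : finite_set (\bigcup_(z in ball w y n) ([set z] `|` nbhd [set z])) /\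
    (nb (\bigcup_(z in ball w y n) ([set z] `|` nbhd [set z])) <= D.+1 * nb (ball w y n))%N.
  apply: nb_bigcup => // z _; have [fz nz] := nbhd1_finite hD z.
  split; first by rewrite finite_setU; split=> //; exact: finite_set1.
  apply: leq_trans (nb_setU (finite_set1 z) fz) _; rewrite -add1n; apply: leq_add => //.
  by apply: (@nb_seq _ [:: z]) => u ->; rewrite /= inE.
have sub : ball w y n.+1 `<=` \bigcup_(z in ball w y n) ([set z] `|` nbhd [set z]).
  move=> u [bu|[z [e [bz we j]]]]; first by exists u => //; left.
  by exists z => //; right; exists z, e.
split; first exact: sub_finite_set f1.
apply: leq_trans (nb_le f1 sub) _; apply: leq_trans n1 _.
by rewrite expnS leq_mul2l nB orbT.
Qed.

(** Keep a point, discard the at most [c] points related to it, and repeat. *)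
Lemma greedy_packing (N : V -> set V) (c : nat) (s : seq V) : uniq s ->
  (forall y, finite_set (N y) /\ (nb (N y) <= c)%N) -> (forall y, N y y) ->
  (forall y z, N y z -> N z y) ->
  exists t, [/\ uniq t, {subset t <= s}, (size s <= c * size t)%N &
    forall y z, y \in t -> z \in t -> N y z -> y = z].
Proof.
move=> us hN N0 Ns; elim: {s}(size s) {-2}s (leqnn (size s)) us => [|n IH] [|y s] // ss us;
  try by exists [::].
pose s1 := [seq z <- s | `[< ~ N y z >]].
have s1n : (size s1 <= n)%N by rewrite size_filter (leq_trans (count_size _ _)).
have us' : uniq s by case/andP: us.
have [t [ut ts st ht]] := IH _ s1n (filter_uniq _ us').
have tN z : z \in t -> ~ N y z by move=> /ts; rewrite mem_filter => /andP[/asboolP].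
exists (y :: t); split.
- by rewrite /= ut andbT; apply/negP => /tN; apply.
- move=> z; rewrite !inE => /orP[->//|/ts]; rewrite mem_filter => /andP[_ ->].
  by rewrite orbT.
- rewrite mulnS -(count_predC (fun z => `[< N y z >]) (y :: s)); apply: leq_add.
    have [fN nN] := hN y; apply: leq_trans nN; rewrite -size_filter /nb.
    apply: uniq_leq_size; first exact: filter_uniq.
    by move=> z; rewrite mem_filter => /andP[/asboolP h _]; rewrite in_fset_set ?inE.
  apply: leq_trans st; rewrite size_filter /= (asboolT (N0 y)) /= add0n.
  by rewrite leq_eqVlt; apply/orP; left; apply/eqP/eq_count => z /=; rewrite asbool_neg.
move=> z z'; rewrite !inE => /orP[/eqP ->|zt] /orP[/eqP ->|zt'] // h; last exact: ht.
- by case: (tN z').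
- by case: (tN z) => //; exact: Ns.
Qed.
End Packings.

(** * From trifurcations to exit capacities *)

Lemma larger_half a b n : (a + b = n)%N -> (2 * a < n)%N -> (n <= 2 * b)%N.
Proof. by lia. Qed.

Section Splitting.
Variables (R : realType) (G : multigraph) (D : nat) (p : R).
Local Notation V := (vertex G).
Local Notation E := (edge G).
Hypotheses (hD : hasdeg G D) (p0 : 0 < p) (p1 : p < 1).
Variable L : nat.
Local Notation B y := (ball setT y L).
Implicit Types (w : set E) (U A : set V) (y z c : V) (l : seq E).

(* [y] becomes a point of trifurcation once the ball [B y] is entirely open. *)
Definition splits l U (a : R) y w := exists C : seq V, [/\ uniq C, size C = 3,
  forall c, c \in C -> [/\ ~ B y c, exists b e, B y b /\ joins e b c &
    a <= capO R l U c (w `&` off (B y))] &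
  forall c c', c \in C -> c' \in C -> conn (w `&` off (B y)) c c' -> c = c'].

Lemma depends_splits l U a y : depends (fun w => ind (splits l U a y w) : R) (off (B y)).
Proof.
move=> w w' ww'; apply: ind_eq.
have ag (u v : set E) : u `&` off (B y) = v `&` off (B y) -> splits l U a y u -> splits l U a y v.
  by rewrite /splits => ->.
by split; apply: ag.
Qed.

Let bound : nat := D * D.+1 ^ L.+1.

Lemma count_touch_ball y n l : uniq l -> (n <= L.+1)%N ->
  (count [in touch (ball setT y n)] l <= bound)%N.
Proof.
move=> ul nL; have [fB nB] := ball_card hD setT y n.
apply: leq_trans (count_touch hD ul fB) _; rewrite leq_mul2l.
by rewrite (leq_trans nB) ?orbT// leq_pexp2l.
Qed.

Lemma ball_center_conn y n u v : ball setT y n u -> ball setT y n v ->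
  conn (inside (ball setT y n) : set E) u v.
Proof.
move=> /ball_conn_inside hu /ball_conn_inside hv; rewrite !setTI in hu hv.
exact: conn_trans (conn_sym hu) hv.
Qed.

Variables (l : seq E) (U : set V).
Hypotheses (ul : uniq l) (fU : finite_set U) (tU : touch U `<=` [set` l]).

(** Splitting at [y] depends only on edges off [B y], so it is independent of the event that all
    edges touching [B y] are open. Together they make [y] a trifurcation, and the separation of the
    points makes the balls disjoint. *)
Lemma far_exit_bound A (s : seq V) (a s2 : R) r : 0 < a -> A `<=` U ->
  uniq s -> (forall y, y \in s -> A y) -> (forall y, y \in s -> ball setT y L.+1 `<=` U) ->
  (forall y z, y \in s -> z \in s -> ball setT y (L + L) z -> y = z) ->
  (forall y, y \in s -> s2 <= Pr p l (splits l U a y)) ->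
  (size s)%:R * (p ^+ bound * s2) / (3 * (4 / a + 2 * L.+1%:R + r%:R)) <=
    Ex p l (capA R l r U A).
Proof.
move=> a0 AU us sA sU sep hs2; have [p0' p1'] := (ltW p0, ltW p1).
have M0 : 0 < 3 * (4 / a + 2 * L.+1%:R + r%:R).
  by rewrite mulr_gt0// ltr_pwDl// addr_gt0 ?divr_gt0 ?mulr_gt0 ?ltr0n.
pose ev y w := touch (B y) `<=` w /\ splits l U a y w.
apply: (@le_trans _ _ (Ex p l (fun w => (3 * (4 / a + 2 * L.+1%:R + r%:R))^-1 * \sum_(y <- s) ind (ev y w)))).
  rewrite ExZ Ex_sum mulrC ler_pM2l ?invr_gt0//.
  have -> : (size s)%:R * (p ^+ bound * s2) = \sum_(y <- s) (p ^+ bound * s2).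
    by rewrite big_const_seq count_predT iter_addr_0 mulr_natl.
  apply: ler_sum_seq => y ys.
  rewrite (Ex_ext _ _ (g := fun w => ind (touch (B y) `<=` w) * ind (splits l U a y w))); last first.
    by move=> w _; rewrite -ind_and.
  have bU : B y `<=` U by apply: subset_trans (sU y ys); exact: ball_le.
  rewrite (@Ex_indep _ _ _ _ _ _ (touch (B y))); last 2 first.
  - move=> w w' ww'; apply: ind_eq.
    have ag (u v : set E) : u `&` touch (B y) = v `&` touch (B y) -> touch (B y) `<=` u -> touch (B y) `<=` v.
      by move=> uv h e te; have : (u `&` touch (B y)) e; [split=> //; exact: h|rewrite uv => -[]].
    by split; apply: ag.
  - exact: depends_splits.
  have s20 : 0 <= Pr p l (splits l U a y) by exact: Pr_ge0.
  apply: (@le_trans _ _ (p ^+ bound * Pr p l (splits l U a y))).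
    by apply: ler_wpM2l; [exact: exprn_ge0|exact: hs2].
  apply: ler_wpM2r => //; apply: Pr_open => //; last exact: count_touch_ball.
  exact: subset_trans (touch_sub bU) tU.
apply: Ex_le => // w wl.
have /choice[C hC] : forall y, exists C : seq V, splits l U a y w -> [/\ uniq C, size C = 3,
  forall c, c \in C -> [/\ ~ B y c, exists b e, B y b /\ joins e b c &
    a <= capO R l U c (w `&` off (B y))] &
  forall c c', c \in C -> c' \in C -> conn (w `&` off (B y)) c c' -> c = c'].
  by move=> y; have [[C h]|h] := pselect (splits l U a y w); [exists C|exists [::]].
pose T := [seq y <- s | `[< ev y w >]].
have TP y : y \in T -> y \in s /\ ev y w by rewrite mem_filter => /andP[/asboolP].
have tri : trifurcating w (fun y => B y) C T.
  split.
  - by move=> y /TP[_ []].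
  - by move=> y u v _; exact: ball_center_conn.
  - move=> y y' v /TP[ys _] /TP[y's _] bv bv'; apply: sep => //.
    exact: ball_trans bv (ball_sym bv').
  - by move=> y _; exists y; exact: ball_center.
  - by move=> y c /TP[_ [_ /hC[_ _ h _]]] /h[].
  - by move=> y c c' /TP[_ [_ /hC[_ _ _ h]]]; exact: h.
  - by move=> y /TP[_ [_ /hC[]]].
have uT : uniq T by exact: filter_uniq.
rewrite sum_ind_count -size_filter mulrC.
apply: (trifurcating_cap r ul AU wl uT tri a0).
- by move=> y /TP[ys _]; exact: sA.
- move=> y c /TP[ys [_ /hC[_ _ h _]]] /h[_ [b [e [Bb j]]] _].
  by apply: (sU y ys); exact: ball_S Bb I j.
- move=> y b _ /ball_path[q [h1 h2 h3]]; exists q; split=> //.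
  by move=> e /h2[].
- by move=> y c /TP[_ [_ /hC[_ _ h _]]] /h[].
Qed.

(** Close to the complement of [U] it is enough to open a bounded set of edges in order to leave
    [U]. Points at distance more than [2 (L + 1)] have disjoint sets of this kind. *)
Lemma near_exit_bound A (s : seq V) r : A `<=` U ->
  uniq s -> (forall y, y \in s -> A y) -> (forall y, y \in s -> ~ (ball setT y L.+1 `<=` U)) ->
  (forall y z, y \in s -> z \in s -> ball setT y (L.+1 + L.+1) z -> y = z) -> (0 < bound)%N ->
  (size s)%:R * p ^+ bound / (3 * (bound%:R + r%:R)) <= Ex p l (capA R l r U A).
Proof.
move=> AU us sA sU sep b0; have [p0' p1'] := (ltW p0, ltW p1).
have M0 : 0 < 3 * (bound%:R + r%:R) :> R by rewrite mulr_gt0// ltr_pwDl// ltr0n.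
pose gam y : set E := touch U `&` inside (ball setT y L.+1).
have gaml y : gam y `<=` [set` l] by move=> e [/tU].
have gamn y : (count [in gam y] l <= bound)%N.
  apply: leq_trans (count_touch_ball y ul (leqnn L.+1)); apply: sub_count => e.
  by rewrite !inE => -[_ /inside_sub_touch].
have rgam y : y \in s -> reach U (gam y) y.
  move=> ys; have := sU y ys => /existsNP[z /not_implyP[bz Uz]].
  have [e [u [u' [[_ ie] j Uu Uu' c]]]] := first_exit (ball_conn_inside bz) (AU _ (sA y ys)) Uz.
  exists u' => //; apply: (conn_step _ _ j); last by split=> //; exact: (joins_touch j Uu).
  by apply: conn_mono c => f [[_ ?] /inside_sub_touch].
apply: (@le_trans _ _ (Ex p l (fun w => (3 * (bound%:R + r%:R))^-1 * \sum_(y <- s) ind (gam y `<=` w)))).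
  rewrite ExZ Ex_sum mulrC ler_pM2l ?invr_gt0//.
  have -> : (size s)%:R * p ^+ bound = \sum_(y <- s) (p ^+ bound).
    by rewrite big_const_seq count_predT iter_addr_0 mulr_natl.
  by apply: ler_sum_seq => y ys; apply: Pr_open.
apply: Ex_le => // w wl.
rewrite sum_ind_count -size_filter mulrC.
apply: (near_packing r ul AU wl (gam := gam)) => //.
  move=> y; rewrite mem_filter => /andP[/asboolP gw ys]; split=> //; [exact: sA|exact: rgam|].
  rewrite sum_ind_count ler_nat; apply: leq_trans (gamn y).
  by apply: sub_count => g /asboolP; rewrite inE.
move=> g; rewrite sum_ind_count ler_nat -size_filter.
set t := [seq _ <- _ | _]; have ut : uniq t by rewrite !filter_uniq.
have same y z : y \in t -> z \in t -> y = z.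
  rewrite !mem_filter => /andP[/asboolP[_ [h _]] /andP[_ ys]] /andP[/asboolP[_ [h' _]] /andP[_ zs]].
  by apply: sep => //; exact: ball_trans h (ball_sym h').
case: t ut same => [//|y [//|z t]] /= /andP[+ _] same.
by rewrite inE (same y z) ?inE ?eqxx ?orbT.
Qed.

(** At least half of [A] is far from the complement of [U], or at least half is near it, and a
    separated subset keeps a fixed proportion. The constant does not involve [r]: with
    [a = 1 / (32 r)] the energy [4 / a] is [128 r], and [131 = 128 + 2 + 1] collects the multiples
    of [r]. *)
Lemma exit_bound_of_splits s2 r : 0 < s2 -> s2 <= 1 -> (0 < r)%N -> (0 < D)%N ->
  (forall y, U y -> ball setT y L.+1 `<=` U ->
     s2 <= Pr p l (splits l U (32 * r%:R)^-1 y)) ->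
  exit_bound p l U r (6 * (D.+1 ^ (L.+1 + L.+1))%:R * (131 + 2 * L%:R + bound%:R) / (p ^+ bound * s2)).
Proof.
move=> s20 s21 r0 D0 hs A AU [y0 Ay0]; have r0' : 0 < r%:R :> R by rewrite ltr0n.
have fA := sub_finite_set AU fU.
have [q [uq sq qA]] := enum_setP fA.
set c := (D.+1 ^ (L.+1 + L.+1))%N.
have c0 : (0 < c)%N by rewrite expn_gt0.
have pack s : uniq s -> exists t, [/\ uniq t, {subset t <= s}, (size s <= c * size t)%N &
    forall y z, y \in t -> z \in t -> ball setT y (L.+1 + L.+1) z -> y = z].
  move=> us; apply: greedy_packing => //.
  - by move=> y; exact: ball_card.
  - by move=> y; exact: ball_center.
  - by move=> y z; exact: ball_sym.
pose far y := `[< ball setT y L.+1 `<=` U >].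
set m := 131 + 2 * L%:R + bound%:R.
have m0 : 131 <= m.
  by rewrite /m; have := ler0n R L; have := ler0n R bound; lra.
have m00 : 0 < m by lra.
have pb0 : 0 < p ^+ bound * s2 by rewrite mulr_gt0// exprn_gt0.
have b0 : (0 < bound)%N by rewrite muln_gt0 D0 expn_gt0.
have enough (t : seq V) (x : R) : (nb A <= 2 * (c * size t))%N -> 0 < x -> x <= 3 * m * r%:R ->
    (nb A)%:R / (6 * c%:R * m / (p ^+ bound * s2) * r%:R) <= (size t)%:R * (p ^+ bound * s2) / x.
  move=> ht x0 xm; have c0' : 0 < c%:R :> R by rewrite ltr0n.
  apply: (@le_trans _ _ ((size t)%:R * (p ^+ bound * s2) / (3 * m * r%:R))); last first.
    apply: ler_wpM2l; first by rewrite mulr_ge0// ltW.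
    by rewrite lef_pV2 ?posrE// !mulr_gt0.
  move: ht; rewrite -(ler_nat R) !natrM => ht.
  rewrite ler_pdivrMr; last by rewrite mulr_gt0// divr_gt0// !mulr_gt0.
  apply: le_trans ht _; rewrite le_eqVlt; apply/orP; left; apply/eqP.
  move: (p ^+ bound * s2) pb0 => z z0; field; rewrite !gt_eqF//.
have split_q : (size [seq y <- q | far y] + size [seq y <- q | ~~ far y] = nb A)%N.
  by rewrite !size_filter count_predC.
have [h|h] := leqP (nb A) (2 * size [seq y <- q | far y]).
  have [t [ut ts st ht]] := pack _ (filter_uniq far uq).
  have tP y : y \in t -> A y /\ ball setT y L.+1 `<=` U.
    by move=> /ts; rewrite mem_filter => /andP[/asboolP ? /qA].
  have M0 : 0 < 3 * (4 / (32 * r%:R)^-1 + 2 * L.+1%:R + r%:R) :> R.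
    by rewrite mulr_gt0// ltr_pwDl// addr_gt0 ?divr_gt0 ?mulr_gt0 ?ltr0n// invr_gt0 mulr_gt0.
  apply: (le_trans (enough t _ _ M0 _)).
  - by apply: leq_trans h _; rewrite leq_mul2l st.
  - rewrite -mulrA ler_pM2l// invrK.
    have : L.+1%:R <= L.+1%:R * r%:R :> R by rewrite ler_peMr// ler1n.
    have : 0 <= bound%:R * r%:R :> R by rewrite mulr_ge0.
    rewrite (_ : m * r%:R = 131 * r%:R + 2 * (L%:R * r%:R) + bound%:R * r%:R); last by rewrite /m; ring.
    rewrite -[L.+1%:R]natr1 mulrDl mul1r; lra.
  apply: far_exit_bound => //.
  - by rewrite invr_gt0 mulr_gt0.
  - by move=> y /tP[].
  - by move=> y /tP[].
  - move=> y z yt zt byz; apply: ht => //; apply: ball_le byz.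
    by apply: leq_add.
  - by move=> y /tP[/AU Uy h1]; exact: hs.
have [t [ut ts st ht]] := pack _ (filter_uniq (predC far) uq).
have tP y : y \in t -> A y /\ ~ (ball setT y L.+1 `<=` U).
  by move=> /ts; rewrite mem_filter => /andP[/asboolP ? /qA].
have M0 : 0 < 3 * (bound%:R + r%:R) :> R by rewrite mulr_gt0// ltr_pwDl// ltr0n.
apply: (le_trans (enough t _ _ M0 _)).
- apply: (@leq_trans (2 * size [seq y <- q | ~~ far y])); last by rewrite leq_mul2l st.
  exact: larger_half split_q h.
- rewrite -mulrA ler_pM2l//.
  have : bound%:R <= bound%:R * r%:R :> R by rewrite ler_peMr// ler1n.
  have : 0 <= L%:R * r%:R :> R by rewrite mulr_ge0.
  rewrite (_ : m * r%:R = 131 * r%:R + 2 * (L%:R * r%:R) + bound%:R * r%:R); last by rewrite /m; ring.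
  lra.
apply: le_trans (near_exit_bound r AU ut _ _ ht b0).
- apply: ler_wpM2r; first by rewrite invr_ge0 ltW.
  apply: ler_wpM2l => //; rewrite ler_piMr// exprn_ge0// ltW//.
- by move=> y /tP[].
- by move=> y /tP[].
Qed.

End Splitting.

(** * Bootstrapping *)

Section Bootstrap.
Variables (R : realType) (G : multigraph) (D : nat) (p : R).
Local Notation V := (vertex G).
Local Notation E := (edge G).
Hypotheses (hD : hasdeg G D) (D0 : (0 < D)%N) (p0 : 0 < p) (p1 : p < 1).
Variable L : nat.
Local Notation B y := (ball setT y L).
Implicit Types (w : set E) (U A : set V) (y z c : V) (l : seq E).

Definition three_ends U y w := exists X : seq V, [/\ uniq X, size X = 3,
  forall x, x \in X -> B y x /\ reach U w x &
  forall x x', x \in X -> x' \in X -> conn w x x' -> x = x'].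

Let bound : nat := D * D.+1 ^ L.+1.

(** The contacts are the vertices that follow the last exits from [B y]. They lie in distinct
    clusters of [w], hence are separated off [B y] as well. *)
Lemma three_ends_contacts U y w : B y `<=` U -> three_ends U y w -> exists C : seq V,
  [/\ uniq C, size C = 3,
  forall c, c \in C -> [/\ ~ B y c, exists b e, B y b /\ joins e b c & reach U (w `&` off (B y)) c] &
  forall c c', c \in C -> c' \in C -> conn (w `&` off (B y)) c c' -> c = c'].
Proof.
move=> BU [X [uX sX hX sep]].
have /choice[f hf] : forall x, exists c, x \in X -> [/\ ~ B y c,
    exists b e, B y b /\ joins e b c, reach U (w `&` off (B y)) c & conn w x c].
  move=> x; have [xX|_] := boolP (x \in X); last by exists x.
  have [Bx [z Uz cz]] := hX x xX.
  have [e [u [u' [we j Bu Bu' [cu cu']]]]] := last_exit cz Bx (fun h => Uz (BU _ h)).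
  exists u' => _; split=> //; first by exists u, e.
    by exists z.
  exact: conn_step cu we j.
have inj x x' : x \in X -> x' \in X -> conn w (f x) (f x') -> x = x'.
  move=> xX xX' c; apply: sep => //.
  have [_ _ _ h] := hf _ xX; have [_ _ _ h'] := hf _ xX'.
  by apply: (conn_trans h); apply: (conn_trans c); exact: conn_sym.
exists (map f X); split.
- rewrite map_inj_in_uniq// => x x' xX xX' e; apply: inj => //.
  by rewrite e; exact: conn_refl.
- by rewrite size_map.
- by move=> _ /mapP[x xX ->]; have [] := hf _ xX.
move=> _ _ /mapP[x xX ->] /mapP[x' xX' ->] c; congr f; apply: inj => //.
by apply: conn_mono c; exact: subIsetl.
Qed.

Lemma splits_weaken l U (a b : R) y w : a <= b -> splits L l U b y w -> splits L l U a y w.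
Proof.
move=> ab [C [h1 h2 h3 h4]]; exists C; split=> // c /h3[h5 h6 h7]; split=> //.
exact: le_trans h7.
Qed.

Variables (l : seq E) (U : set V).
Hypotheses (ul : uniq l) (fU : finite_set U) (tU : touch U `<=` [set` l]).

(** Starting point of the bootstrap: with [n] at least the number of edges, any escape has capacity
    at least [1 / n]. *)
Lemma three_ends_splits y n w : (size l <= n)%N -> (0 < n)%N -> ball setT y L.+1 `<=` U ->
  w `<=` [set` l] -> three_ends U y w -> splits L l U ((32 * n%:R)^-1 : R) y w.
Proof.
move=> sl n0 BU wl h3.
have [C [h1 h2 h3' h4]] := three_ends_contacts (subset_trans (ball_le (leqnSn L)) BU) h3.
exists C; split=> // c /h3'[h5 h6 [z Uz cz]]; split=> //.
have Uc : U c.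
  by case: h6 => b [e [Bb j]]; apply: BU; exact: ball_S Bb I j.
apply: (@le_trans _ _ n%:R^-1).
  have n0' : 0 < n%:R :> R by rewrite ltr0n.
  by rewrite lef_pV2 ?posrE ?mulr_gt0//; lra.
have off_l : w `&` off (B y) `<=` [set` l] by move=> e [/wl].
apply: (@capO_route _ _ _ _ _ _ [seq e <- l | `[< (w `&` off (B y)) e >]]) => //.
- by rewrite size_filter; apply: leq_trans sl; exact: count_size.
- by move=> e; rewrite /= mem_filter => /andP[/asboolP].
exists z => //; apply: conn_mono cz => e he; rewrite /= mem_filter; apply/andP; split.
  exact/asboolP.
exact: off_l.
Qed.

(** Three ends that do not split leave a contact with a weak escape off [B y]. Closing the edges
    touching [B y], at cost [(1 - p) ^ bound], turns it into a weak escape in the whole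
    configuration. The contact is one of the points of a ball of radius [L + 1]. *)
Lemma splits_step y (a eps : R) : ball setT y L.+1 `<=` U ->
  (forall c, U c -> Pr p l (fun w => reach U w c /\ capO R l U c w < a) <= eps) ->
  Pr p l (three_ends U y) <=
    Pr p l (splits L l U a y) + (D.+1 ^ L.+1)%:R * (eps / (1 - p) ^+ bound).
Proof.
move=> BU heps; have [p0' p1'] := (ltW p0, ltW p1).
have BU' : B y `<=` U by apply: subset_trans BU; exact: ball_le.
have q0 : 0 < (1 - p) ^+ bound by rewrite exprn_gt0// subr_gt0.
have [fB nB] := ball_card hD setT y L.+1.
have [N [uN sN NB]] := enum_setP fB.
pose bad c w := reach U (w `&` off (B y)) c /\ capO R l U c (w `&` off (B y)) < a.
apply: (@le_trans _ _ (Pr p l (fun w => splits L l U a y w \/ exists2 c, c \in N & bad c w))).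
  apply: Pr_le => // w wl /(three_ends_contacts BU')[C [h1 h2 h3 h4]].
  have [h|h] := pselect (exists2 c, c \in C & bad c w).
    right; case: h => c cC bc; exists c => //; apply/NB.
    by have [_ [b [e [Bb j]]] _] := h3 c cC; exact: ball_S Bb I j.
  left; exists C; split=> // c cC; have [h5 h6 h7] := h3 c cC; split=> //.
  by rewrite leNgt; apply/negP => ca; apply: h; exists c.
apply: le_trans (Pr_or _ _ _ _ _) _ => //; rewrite lerD2l.
apply: le_trans (Pr_exists _ _ _ _ _) _ => //.
have e0 : 0 <= eps.
  by apply: le_trans (heps y _); [exact: Pr_ge0|apply: BU; exact: ball_center].
have badP c : c \in N -> Pr p l (bad c) <= eps / (1 - p) ^+ bound.
  move=> cN; rewrite ler_pdivlMr//.
  have Uc : U c by apply: BU; exact/NB.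
  have dep : depends (fun w => ind (bad c w) : R) (~` touch (B y)).
    move=> w w' ww'; apply: ind_eq.
    have ag (u v : set E) : u `&` off (B y) = v `&` off (B y) -> bad c u -> bad c v.
      by rewrite /bad => ->.
    by split; apply: ag.
  apply: (@le_trans _ _ (Ex p l (fun w => ind (w `&` touch (B y) = set0) * ind (bad c w)))).
    rewrite (@Ex_indep _ _ _ _ _ _ (touch (B y))) => //; last first.
      by move=> w w' ww'; apply: ind_eq; rewrite ww'.
    rewrite mulrC; apply: ler_wpM2r; first exact: Pr_ge0.
    by apply: Pr_closed => //; exact: count_touch_ball.
  apply: le_trans (heps c Uc); apply: Ex_le => // w wl; rewrite -ind_and; apply: ind_le.
  move=> [w0]; rewrite /bad; suff -> : w `&` off (B y) = w by [].
  by apply/setIidl => e we te; have : (w `&` touch (B y)) e by []; rewrite w0.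
apply: (@le_trans _ _ (\sum_(c <- N) eps / (1 - p) ^+ bound)); first exact: ler_sum_seq.
have -> : \sum_(c <- N) eps / (1 - p) ^+ bound = (size N)%:R * (eps / (1 - p) ^+ bound).
  by rewrite big_const_seq count_predT iter_addr_0 mulr_natl.
apply: ler_wpM2r; first by rewrite divr_ge0// ltW.
by rewrite ler_nat sN.
Qed.
End Bootstrap.

(** Descending induction on [k]. Splitting with capacity [1 / (32 (k + 1))] gives the exit bound at
    [k + 1], so escapes weaker than [1 / (16 (k + 1))] are unlikely. As
    [1 / (32 k) <= 1 / (16 (k + 1))], splitting at [k] follows with the same [s2]. The descent stops
    at a level independent of [U]. *)
Lemma three_ends_exit_bound (R : realType) (G : multigraph) (D : nat) (p : R) (L : nat) (s : R) :
  hasdeg G D -> (0 < D)%N -> 0 < p -> p < 1 -> 0 < s ->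
  (forall l (U : set (vertex G)) y, uniq l -> finite_set U -> touch U `<=` [set` l] ->
     ball setT y L.+1 `<=` U -> s <= Pr p l (three_ends L U y)) ->
  exists (K : R) r1, [/\ 0 < K, (0 < r1)%N & forall r, (r1 <= r)%N ->
    forall l (U : set (vertex G)), uniq l -> finite_set U -> touch U `<=` [set` l] ->
    exit_bound p l U r K].
Proof.
move=> hD D0 p0 p1 s0 hs.
set n := (D * D.+1 ^ L.+1)%N.
pose s2 := Num.min (s / 2) 1.
have s20 : 0 < s2 by rewrite lt_min ltr01 andbT divr_gt0.
have s21 : s2 <= 1 by rewrite ge_min lexx orbT.
pose K : R := 6 * (D.+1 ^ (L.+1 + L.+1))%:R * (131 + 2 * L%:R + n%:R) / (p ^+ n * s2).
have K0 : 0 < K.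
  have m0 : 0 < 131 + 2 * L%:R + n%:R :> R by have := ler0n R L; have := ler0n R n; lra.
  apply: divr_gt0; last by rewrite mulr_gt0// exprn_gt0.
  by rewrite !mulr_gt0// ltr0n expn_gt0.
have q0 : 0 < (1 - p) ^+ n by rewrite exprn_gt0// subr_gt0.
(* Makes the loss in [splits_step] exactly [s / 2]. *)
pose eps := s / 2 * (1 - p) ^+ n / (D.+1 ^ L.+1)%:R.
have c0 : 0 < (D.+1 ^ L.+1)%:R :> R by rewrite ltr0n expn_gt0.
have e0 : 0 < eps by rewrite divr_gt0// mulr_gt0// divr_gt0.
have [r0 hr0] := weak_escape_unlikely hD D0 p0 p1 K0 e0.
exists K, (maxn r0 2); split=> // [|r rr l U ul fU tU]; first by rewrite leq_max orbT.
have half y a : ball setT y L.+1 `<=` U ->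
    (forall c, U c -> Pr p l (fun w => reach U w c /\ capO R l U c w < a) <= eps) ->
    s2 <= Pr p l (splits L l U a y).
  move=> BU ha; have := le_trans (hs l U y ul fU tU BU) (splits_step hD p0 p1 ul BU ha).
  rewrite -/n (_ : _ * (eps / _) = s / 2); last first.
    by rewrite /eps; field; rewrite !gt_eqF// subr_gt0.
  by rewrite ge_min => h; apply/orP; left; lra.
pose Psi k := forall y, U y -> ball setT y L.+1 `<=` U ->
  s2 <= Pr p l (splits L l U ((32 * k%:R)^-1 : R) y).
have eb k : (0 < k)%N -> Psi k -> exit_bound p l U k K.
  by move=> k0 h; exact: (exit_bound_of_splits hD p0 p1 ul fU tU s20 s21 k0 D0).
have step k : (maxn r0 2 <= k)%N -> Psi k.+1 -> Psi k.
  move=> hk hPsi y Uy BU; apply: half => // c Uc.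
  have k2 : (2 <= k)%N by apply: leq_trans hk; exact: leq_maxr.
  have kr : (r0 <= k.+1)%N by apply: leqW; apply: leq_trans hk; exact: leq_maxl.
  apply: le_trans (hr0 k.+1 kr l U c ul fU Uc (eb _ (ltn0Sn k) hPsi)).
  apply: Pr_le; rewrite ?ltW// => w wl [h1 h2]; split=> //; apply: lt_le_trans h2 _.
  have k0 : 2 <= k%:R :> R by rewrite ler_nat.
  have e1 : k.+1%:R = k%:R + 1 :> R by rewrite natr1.
  by rewrite lef_pV2 ?posrE; rewrite ?e1; lra.
have mono k k' : (0 < k)%N -> (k <= k')%N -> Psi k -> Psi k'.
  move=> k0 kk' h y Uy BU; apply: le_trans (h y Uy BU) _.
  apply: Pr_le; rewrite ?ltW// => w _; apply: splits_weaken.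
  have k0' : 0 < k%:R :> R by rewrite ltr0n.
  have kk'' : k%:R <= k'%:R :> R by rewrite ler_nat.
  by rewrite lef_pV2 ?posrE ?mulr_gt0//; lra.
have base : Psi (size l + maxn r0 2)%N.
  move=> y Uy BU; apply: (@le_trans _ _ s); first by rewrite ge_min; apply/orP; left; lra.
  apply: le_trans (hs l U y ul fU tU BU) _; apply: Pr_le; rewrite ?ltW// => w wl.
  apply: three_ends_splits => //; first exact: leq_addr.
  by rewrite addn_gt0 leq_max orbT orbT.
have down k : Psi (k + maxn r0 2)%N -> Psi (maxn r0 2).
  by elim: k => [//|k IH] h; apply: IH; apply: step; rewrite ?leq_addl// -addSn.
apply: eb; first by apply: leq_trans rr; rewrite leq_max orbT.
apply: mono rr (down _ base); by rewrite leq_max orbT.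
Qed.

(** * The marriage theorem *)

Section Hall.
Variables (T V : choiceType).
Local Open Scope fset_scope.

Lemma hall (v0 : V) (N : T -> {fset V}) (J : {fset T}) :
  (forall S, S `<=` J -> (#|` S| <= #|` \bigcup_(i <- S) N i|)%N) ->
  exists f : T -> V, (forall i, i \in J -> f i \in N i) /\
    (forall i j, i \in J -> j \in J -> f i = f j -> i = j).
Proof.
elim: {J}(#|` J|) {-2}J (leqnn #|` J|) N => [|n IH] J.
  rewrite leqn0 cardfs_eq0 => /eqP -> N _; exists (fun=> v0).
  by split=> [i|i j]; rewrite in_fset0.
move=> Jn N hall.
have [[S [SJ S0 SnJ NS]]|tight] := pselect (exists S, [/\ S `<=` J, S != fset0, S != J &
    (#|` \bigcup_(i <- S) N i| <= #|` S|)%N]).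
  have Sp : (#|` S| < #|` J|)%N by apply: fproper_ltn_card; rewrite fproperEneq SnJ.
  have Sn : (#|` S| <= n)%N by rewrite -ltnS (leq_trans Sp).
  have JSn : (#|` J `\` S| <= n)%N.
    rewrite cardfsDS// -ltnS (leq_trans _ Jn)// -[ltnRHS]subn0 ltn_sub2l//.
      by rewrite (leq_trans _ Sp).
    by rewrite cardfs_gt0.
  have [f1 [f1N f1i]] : exists f : T -> V, (forall i, i \in S -> f i \in N i) /\
      (forall i j, i \in S -> j \in S -> f i = f j -> i = j).
    by apply: IH => // S' S'S; apply: hall; exact: fsubset_trans SJ.
  set M := \bigcup_(i <- S) N i in NS.
  have [f2 [f2N f2i]] : exists f : T -> V, (forall i, i \in J `\` S -> f i \in N i `\` M) /\
      (forall i j, i \in J `\` S -> j \in J `\` S -> f i = f j -> i = j).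
    apply: IH => // S' S'J.
    have dj : [disjoint S' & S].
      by apply/fdisjointP => i /(fsubsetP S'J); rewrite inE => /andP[].
    have := hall (S' `|` S); rewrite fsubUset SJ andbT.
    rewrite (fsubset_trans S'J (fsubsetDl _ _)) => /(_ isT).
    rewrite cardfsU (_ : S' `&` S = fset0) ?cardfs0 ?subn0; last exact/eqP.
    set X := \bigcup_(i <- S') _.
    have sub : \bigcup_(i <- S' `|` S) N i `<=` X `|` M.
      apply/fsubsetP => v /bigfcupP[i]; rewrite andbT !inE => /orP[iS'|iS] vN.
        have [vM|vM] := boolP (v \in M); first by rewrite orbT.
        rewrite orbF; apply/bigfcupP; exists i; first by rewrite iS'.
        by rewrite inE vM.
      by apply/orP; right; apply/bigfcupP; exists i; rewrite ?iS.
    move=> /leq_trans/(_ (fsubset_leq_card sub)) h.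
    have := leq_trans h (leq_card_fsetU X M) => {}h.
    by rewrite -(leq_add2r #|` S|) (leq_trans h)// leq_add2l.
  exists (fun i => if i \in S then f1 i else f2 i); split.
    move=> i iJ; case: ifPn => iS; first exact: f1N.
    by have := f2N i; rewrite !inE iS iJ => /(_ isT)/andP[].
  have f1M i : i \in S -> f1 i \in M.
    by move=> iS; apply/bigfcupP; exists i; rewrite ?iS ?f1N.
  have f2M i : i \in J -> i \notin S -> f2 i \notin M.
    by move=> iJ iS; have := f2N i; rewrite !inE iS iJ => /(_ isT)/andP[].
  move=> i j iJ jJ; case: ifPn => iS; case: ifPn => jS.
  - exact: f1i.
  - by move=> e; have := f2M j jJ jS; rewrite -e f1M.
  - by move=> e; have := f2M i iJ iS; rewrite e f1M.
  - by apply: f2i; rewrite inE ?iS ?jS.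
have [J0|/fset0Pn[j0 j0J]] := eqVneq J fset0.
  exists (fun=> v0); rewrite J0; by split=> [i|i j]; rewrite in_fset0.
have loose S : S `<=` J -> S != fset0 -> S != J -> (#|` S| < #|` \bigcup_(i <- S) N i|)%N.
  by move=> SJ S0 SnJ; rewrite ltnNge; apply/negP => h; apply: tight; exists S.
have [v vN] : exists v, v \in N j0.
  apply/fset0Pn; have := hall [fset j0]; rewrite fsub1set j0J cardfs1 => /(_ isT).
  have sub : \bigcup_(i <- [fset j0]) N i `<=` N j0.
    by apply/fsubsetP => u /bigfcupP[i]; rewrite andbT inE => /eqP ->.
  by move=> /leq_trans/(_ (fsubset_leq_card sub)); rewrite cardfs_gt0.
have Jn' : (#|` J `\ j0| <= n)%N.
  by rewrite -ltnS (leq_trans _ Jn)// (cardfsD1 j0 J) j0J.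
have [f [fN fi]] : exists f : T -> V, (forall i, i \in J `\ j0 -> f i \in N i `\ v) /\
    (forall i j, i \in J `\ j0 -> j \in J `\ j0 -> f i = f j -> i = j).
  apply: IH => // S SJ.
  have [->|S0] := eqVneq S fset0; first by rewrite cardfs0.
  have j0S : j0 \notin S by apply/negP => /(fsubsetP SJ); rewrite !inE eqxx.
  have SnJ : S != J by apply: contraNneq j0S => ->.
  have := loose S (fsubset_trans SJ (fsubsetDl _ _)) S0 SnJ.
  have sub : \bigcup_(i <- S) N i `<=` v |` \bigcup_(i <- S) (N i `\ v).
    apply/fsubsetP => u /bigfcupP[i]; rewrite andbT !inE => iS uN.
    have [//|uv] := eqVneq u v; apply/bigfcupP; exists i; first by rewrite iS.
    by rewrite !inE uv.
  move=> /leq_trans/(_ (fsubset_leq_card sub)) h.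
  have := leq_trans h (leq_card_fsetU _ _); rewrite cardfs1 add1n ltnS.
  by [].
exists (fun i => if i == j0 then v else f i); split.
  move=> i iJ; case: eqP => [->//|/eqP ij]; have := fN i; rewrite !inE ij iJ => /(_ isT).
  by move=> /andP[].
have fv i : i \in J -> i != j0 -> f i != v.
  by move=> iJ ij; have := fN i; rewrite !inE ij iJ => /(_ isT)/andP[].
move=> i j iJ jJ; case: eqP => [->|/eqP ij]; case: eqP => [->//|/eqP jj].
- by move=> e; have := fv j jJ jj; rewrite -e eqxx.
- by move=> e; have := fv i iJ ij; rewrite e eqxx.
- by apply: fi; rewrite !inE ?ij ?jj.
Qed.
End Hall.

(** * Spreading random words *)

Section Words.
Variable K : nat.

Definition words n : seq (seq 'I_K) := [seq tval t | t <- enum {:n.-tuple 'I_K}].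

Lemma mem_words n s : (s \in words n) = (size s == n).
Proof.
apply/mapP/idP => [[t _ ->]|/eqP sn]; first by rewrite size_tuple.
by subst n; exists (in_tuple s); rewrite ?mem_enum.
Qed.

Lemma size_words n : size (words n) = (K ^ n)%N.
Proof. by rewrite size_map -cardE card_tuple card_ord. Qed.

Lemma uniq_words n : uniq (words n).
Proof. by rewrite map_inj_uniq ?enum_uniq//; exact: val_inj. Qed.
End Words.

(** * Injective walks driven by words *)

Section Spreading.
Variables (G : multigraph) (D : nat).
Local Notation V := (vertex G).
Hypothesis hD : hasdeg G D.
Variables (K k : nat).
Implicit Types (U W : set V) (v : V).

(** Replacing each vertex by [K] copies turns the expansion hypothesis into Hall's condition. *)
Lemma matching (Lam : set V) : finite_set Lam ->
  (forall W, finite_set W -> (K * nb W <= nb (\bigcup_(x in W) ball setT x k))%N) ->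
  exists psi : V -> 'I_K -> V, (forall v i, ball setT v k (psi v i)) /\
    (forall v v' i i', Lam v -> Lam v' -> psi v i = psi v' i' -> v = v' /\ i = i').
Proof.
move=> fL hexp.
have fball v : finite_set (ball setT v k) by have [] := ball_card hD setT v k.
have [[v0 _]|noV] := pselect (exists v : V, True); last first.
  by exists (fun v _ => v); split=> [v|v]; case: noV; exists v.
pose N (x : V * 'I_K) : {fset V} := fset_set (ball setT x.1 k).
pose J : {fset V * 'I_K} := [fset x in [seq (v, i) | v <- enum_fset (fset_set Lam), i <- enum 'I_K]]%fset.
have memJ x : (x \in J) = (x.1 \in Lam).
  rewrite /J in_fset /=; apply/allpairsP/idP => [[[v i] /= [vL _ ->]]|xL].
    by move: vL; rewrite in_fset_set.
  by exists x; rewrite in_fset_set// mem_enum; split=> //; case: x {xL}.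
have [f [fN fi]] : exists f : V * 'I_K -> V, (forall i, i \in J -> f i \in N i) /\
    (forall i j, i \in J -> j \in J -> f i = f j -> i = j).
  apply: (hall v0) => S SJ.
  pose W := [set` undup (map fst (enum_fset S))].
  have fW : finite_set W by exact: finite_seq.
  have nW : nb W = size (undup (map fst (enum_fset S))).
    rewrite /nb /W; apply/eqP; rewrite eqn_leq; apply/andP; split.
      by apply: nb_seq.
    apply: uniq_leq_size; first exact: undup_uniq.
    by move=> v vW; rewrite in_fset_set ?inE.
  apply: (@leq_trans (K * nb W)).
    have -> : (K * nb W)%N = size [seq (x, y) | x <- undup (map fst (enum_fset S)), y <- enum 'I_K].
      by rewrite size_allpairs -cardE card_ord mulnC nW.
    apply: uniq_leq_size => //; move=> [v i] xS; apply/allpairsP; exists (v, i) => /=.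
    by rewrite mem_undup mem_enum; split=> //; apply/mapP; exists (v, i).
  apply: leq_trans (hexp W fW) _; rewrite /nb; apply: fsubset_leq_card; apply/fsubsetP => v.
  rewrite in_fset_set; last by apply: bigcup_finite.
  rewrite inE => -[u]; rewrite /W /= mem_undup => /mapP[x xS ->] bu; apply/bigfcupP.
  by exists x; rewrite ?xS// in_fset_set ?inE.
exists (fun v i => if v \in Lam then f (v, i) else v); split=> [v i|v v' i i'].
  case: ifPn => vL; last exact: ball_center.
  by have := fN (v, i); rewrite memJ /= vL => /(_ isT); rewrite in_fset_set ?inE.
move=> vL vL'; rewrite !mem_set// => e.
by have := fi (v, i) (v', i'); rewrite !memJ !mem_set//= => /(_ isT isT e)[-> ->].
Qed.

Variable (psi : V -> 'I_K -> V).
Hypothesis psi_ball : forall v i, ball setT v k (psi v i).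

Lemma walk_ball x s : ball setT x (k * size s) (foldl psi x s).
Proof.
elim/last_ind: s => [|s i IH]; first by rewrite muln0; exact: ball_center.
by rewrite foldl_rcons size_rcons mulnS addnC; apply: ball_trans IH (psi_ball _ _).
Qed.

Variables (U : set V) (g : nat).
Hypothesis fU : finite_set U.
(** Contains every position of a walk of at most [g] steps from [U]. Injectivity is required only
    here because the marriage theorem is applied to a finite set. *)
Let Lam := \bigcup_(u in U) ball setT u (k * g).
Hypothesis psi_inj : forall v v' i i', Lam v -> Lam v' -> psi v i = psi v' i' -> v = v' /\ i = i'.

Lemma walk_Lam x s : U x -> (size s <= g)%N -> Lam (foldl psi x s).
Proof.
move=> Ux sg; exists x => //; apply: ball_le (walk_ball x s).
by rewrite leq_mul2l sg orbT.
Qed.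

Lemma walk_inj x x' s s' : U x -> U x' -> (size s <= g)%N -> size s = size s' ->
  foldl psi x s = foldl psi x' s' -> x = x' /\ s = s'.
Proof.
move=> Ux Ux'; elim/last_ind: s s' => [|s i IH] s'; first by case: s'.
case/lastP: s' => [|s' i']; first by rewrite size_rcons.
rewrite !foldl_rcons !size_rcons => sg [ss'] e.
have sg' := ltnW sg.
have := psi_inj (walk_Lam Ux sg') (walk_Lam Ux' (s := s') _) e.
by rewrite -ss' => /(_ sg')[e1 ->]; have [-> ->] := IH s' sg' ss' e1.
Qed.

Definition starts (q : seq V) : seq (V * seq 'I_K) := [seq (x, s) | x <- q, s <- words K g].

Lemma mem_starts q xi : (xi \in starts q) = (xi.1 \in q) && (size xi.2 == g).
Proof.
apply/allpairsP/andP => [[[x s] /= [xq sw ->]]|[xq sw]]; first by rewrite /= xq -mem_words.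
by exists xi; rewrite mem_words; split=> //; case: xi {xq sw}.
Qed.

Lemma uniq_starts q : uniq q -> uniq (starts q).
Proof. by move=> uq; apply: allpairs_uniq (uq) (uniq_words K g) _ => -[? ?] [? ?]. Qed.

Lemma size_starts q : size (starts q) = (size q * K ^ g)%N.
Proof. by rewrite size_allpairs size_words. Qed.

Variable q : seq V.
Hypotheses (uq : uniq q) (qU : forall x, x \in q -> U x).

(** The position at time [j] determines the starting point and the first [j] letters, so only the
    last [g - j] letters are free. *)
Lemma count_walk j v : (j <= g)%N ->
  (count (fun xi => foldl psi xi.1 (take j xi.2) == v) (starts q) <= K ^ (g - j))%N.
Proof.
move=> jg; rewrite -size_filter -size_words.
set t := [seq _ <- _ | _].
have tP xi : xi \in t -> [/\ foldl psi xi.1 (take j xi.2) = v, U xi.1 & size xi.2 = g].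
  by rewrite mem_filter mem_starts => /and3P[/eqP ? /qU ? /eqP].
rewrite -(size_map (fun xi => drop j xi.2)); apply: uniq_leq_size.
  rewrite map_inj_in_uniq; first by apply: filter_uniq; exact: uniq_starts.
  move=> [x s] [x' s'] /tP[/= e Ux sg] /tP[/= e' Ux' sg'] ed.
  have st : size (take j s) = j by rewrite size_takel// sg.
  have st' : size (take j s') = j by rewrite size_takel// sg'.
  have [|||-> et] := walk_inj (s := take j s) (s' := take j s') Ux Ux'; rewrite ?st ?st' ?e ?e'//.
  by rewrite -(cat_take_drop j s) -(cat_take_drop j s') et ed.
by move=> _ /mapP[xi /tP[_ _ sg] ->]; rewrite mem_words size_drop sg.
Qed.

Lemma sum_walk (R : realType) j (S : set V) : (j <= g)%N -> finite_set S ->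
  \sum_(xi <- starts q) ind (S (foldl psi xi.1 (take j xi.2))) <= (nb S * K ^ (g - j))%:R :> R.
Proof.
move=> jg fS; have [r [ur <- rS]] := enum_setP fS.
apply: (@le_trans _ _ (\sum_(xi <- starts q) \sum_(v <- r) ind (foldl psi xi.1 (take j xi.2) = v))).
  apply: ler_sum => xi _; have [h|h] := pselect (S (foldl psi xi.1 (take j xi.2))); last first.
    by rewrite indF// sumr_ge0// => *; exact: ind_ge0.
  rewrite indT// (bigD1_seq (foldl psi xi.1 (take j xi.2)))//=; last exact/rS.
  by rewrite [ind _]indT// lerDl sumr_ge0// => *; exact: ind_ge0.
rewrite exchange_big /= natrM.
apply: (@le_trans _ _ (\sum_(v <- r) (K ^ (g - j))%:R)).
  apply: ler_sum => v _; rewrite sum_ind_count ler_nat; apply: leq_trans (count_walk v jg).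
  by apply: sub_count => xi /asboolP ->.
by rewrite big_const_seq count_predT iter_addr_0 mulr_natl.
Qed.
End Spreading.

(** * Second moments *)

Section Intersections.
Variables (R : realType) (G : multigraph) (p : R) (delta : R) (rho K g : nat).
Local Notation V := (vertex G).
Local Notation E := (edge G).
Hypotheses (p0 : 0 <= p) (p1 : p <= 1) (d0 : 0 < delta) (d1 : delta <= 1).
Hypothesis Kd : 16 <= K%:R * delta.
Variables (l : seq E) (U A : set V).
Hypothesis AU : A `<=` U.
Variables (I : eqType) (Xi : seq I) (Y : nat -> I -> V).
Implicit Types (xi : I) (w : set E).

Let zone v : set E := touch (ball setT v rho).
Definition near v v' := ball (setT : set E) v (rho + 1 + rho) v'.
Definition link j xi w := conn (w `&` zone (Y j xi)) (Y j xi) (Y j.+1 xi).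
Definition linked xi w := forall j, (j < g)%N -> link j xi w.
Definition corridor xi : set E := [set e | exists2 j, (j < g)%N & zone (Y j xi) e].

Hypothesis link_prob : forall xi j, xi \in Xi -> (j < g)%N -> delta <= Pr p l (link j xi).

Lemma link_mono j xi (w w' : set E) : w `<=` w' -> link j xi w -> link j xi w'.
Proof. by move=> ww'; apply: conn_mono => e [/ww' ? ?]. Qed.

Lemma zone_near v v' e : zone v e -> zone v' e -> near v v'.
Proof.
move=> [h|h] [h'|h'].
- apply: (@ball_le _ _ _ (rho + rho)); first by rewrite leq_add2r leq_addr.
  exact: ball_trans h (ball_sym h').
- apply: (ball_trans _ (ball_sym h')); rewrite addn1; exact: (ball_S h Logic.I (joins_ends e)).
- apply: (ball_trans _ (ball_sym h')); rewrite addn1.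
  exact: (ball_S h Logic.I (joins_sym (joins_ends e))).
- apply: (@ball_le _ _ _ (rho + rho)); first by rewrite leq_add2r leq_addr.
  exact: ball_trans h (ball_sym h').
Qed.

Lemma harris_power (T : eqType) (s : seq T) (P : T -> set E -> Prop) :
  (forall i (w w' : set E), w `<=` w' -> P i w -> P i w') ->
  (forall i, i \in s -> delta <= Pr p l (P i)) ->
  delta ^+ size s <= Pr p l (fun w => forall i, i \in s -> P i w).
Proof.
move=> hP; elim: s => [|i s IH] hs.
  by rewrite expr0 -{1}(Ex_cst p l 1); apply: Ex_le => // w _; rewrite indT.
rewrite exprS; apply: (@le_trans _ _ (Pr p l (P i) * Pr p l (fun w => forall i, i \in s -> P i w))).
  apply: ler_pM; rewrite ?exprn_ge0 ?(ltW d0)//; first by apply: hs; exact: mem_head.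
  by apply: IH => j js; apply: hs; rewrite inE js orbT.
apply: le_trans (harris_Pr p0 p1 _ (hP i) _) _.
  by move=> w w' ww' h j js; apply: hP (h j js).
by apply: Pr_le => // w _ [h1 h2] j; rewrite inE => /orP[/eqP ->|/h2].
Qed.

Lemma linked_gt0 xi : xi \in Xi -> 0 < Pr p l (linked xi).
Proof.
move=> xiX; apply: (@lt_le_trans _ _ (delta ^+ size (iota 0 g))); first exact: exprn_gt0.
apply: (le_trans (harris_power (P := fun j => link j xi) _ _)).
- by move=> j w w'; exact: link_mono.
- by move=> j; rewrite mem_iota add0n => /= jg; exact: link_prob.
by apply: Pr_le => // w _ h j jg; apply: h; rewrite mem_iota.
Qed.

Let crossed xi xi' j' := `[< exists2 j, (j < g)%N & near (Y j xi) (Y j' xi') >].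
Let crossings xi xi' := count (crossed xi xi') (iota 0 g).

(** Without its links that come near [xi], the event for [xi'] is independent of the one for [xi].
    By the Harris inequality, restoring these links costs at most a factor [delta] each. *)
Lemma linked_correlation xi xi' : xi \in Xi -> xi' \in Xi ->
  Pr p l (fun w => linked xi w /\ linked xi' w) * delta ^+ crossings xi xi' <=
  Pr p l (linked xi) * Pr p l (linked xi').
Proof.
move=> xiX xi'X.
pose F w := forall j, (j < g)%N -> ~~ crossed xi xi' j -> link j xi' w.
pose N w := forall j, j \in [seq j <- iota 0 g | crossed xi xi' j] -> link j xi' w.
have NP : delta ^+ crossings xi xi' <= Pr p l N.
  rewrite /crossings -size_filter; apply: harris_power; first by move=> j w w'; exact: link_mono.
  by move=> j; rewrite mem_filter mem_iota add0n => /andP[_ /= jg]; exact: link_prob.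
have Fmono (w w' : set E) : w `<=` w' -> F w -> F w'.
  by move=> ww' h j jg nj; apply: link_mono ww' (h j jg nj).
have FN : Pr p l F * delta ^+ crossings xi xi' <= Pr p l (linked xi').
  apply: (@le_trans _ _ (Pr p l F * Pr p l N)); first by apply: ler_wpM2l => //; exact: Pr_ge0.
  apply: le_trans (harris_Pr p0 p1 _ _ _) _ => //.
    by move=> w w' ww' h j js; apply: link_mono ww' (h j js).
  apply: Pr_le => // w _ [h1 h2] j jg; have [hj|hj] := boolP (crossed xi xi' j); last exact: h1.
  by apply: h2; rewrite mem_filter hj mem_iota.
have OF : Pr p l (fun w => linked xi w /\ linked xi' w) <= Pr p l (linked xi) * Pr p l F.
  apply: (@le_trans _ _ (Ex p l (fun w => ind (linked xi w) * ind (F w)))).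
    apply: Ex_le => // w _; rewrite -ind_and; apply: ind_le => -[h1 h2]; split=> // j jg _.
    exact: h2.
  rewrite (@Ex_indep _ _ _ _ _ _ (corridor xi)) => //.
    move=> w w' ww'; apply: ind_eq.
    have ag (u v : set E) : u `&` corridor xi = v `&` corridor xi -> linked xi u -> linked xi v.
      move=> uv h j jg; apply: conn_mono (h j jg) => e [ue ze]; split=> //.
      have : (u `&` corridor xi) e by split=> //; exists j.
      by rewrite uv => -[].
    by split; exact: ag.
  move=> w w' ww'; apply: ind_eq.
  have ag (u v : set E) : u `&` ~` corridor xi = v `&` ~` corridor xi -> F u -> F v.
    move=> uv h j jg nj; apply: conn_mono (h j jg nj) => e [ue ze]; split=> //.
    have : (u `&` ~` corridor xi) e.
      split=> // -[i ig zi]; move/negP: nj; apply; apply/asboolP; exists i => //.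
      exact: zone_near zi ze.
    by rewrite uv => -[].
  by split; exact: ag.
apply: (le_trans (ler_wpM2r _ OF)); first by rewrite exprn_ge0// ltW.
by rewrite -mulrA; apply: ler_wpM2l FN; exact: Pr_ge0.
Qed.

Variables (CR CB : nat).
Hypothesis zone_count : forall v, (count [in zone v] l <= CR)%N.

Definition overlap xi xi' : R := \sum_(e <- l) ind (corridor xi e /\ corridor xi' e).

Let idx := iota 0 g.

Lemma overlap_le xi xi' : overlap xi xi' <=
  CR%:R * \sum_(j <- idx) \sum_(j' <- idx) ind (near (Y j xi) (Y j' xi')).
Proof.
rewrite mulr_sumr; under eq_bigr do rewrite mulr_sumr.
apply: (@le_trans _ _ (\sum_(j <- idx) \sum_(j' <- idx) \sum_(e <- l) ind (zone (Y j xi) e /\ zone (Y j' xi') e))).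
  have -> : \sum_(j <- idx) \sum_(j' <- idx) \sum_(e <- l) ind (zone (Y j xi) e /\ zone (Y j' xi') e) =
      \sum_(e <- l) \sum_(j <- idx) \sum_(j' <- idx) ind (zone (Y j xi) e /\ zone (Y j' xi') e) :> R.
    rewrite [RHS]exchange_big; apply: eq_bigr => j _ /=.
    by rewrite [RHS]exchange_big.
  apply: ler_sum => e _.
  have S0 : 0 <= \sum_(j <- idx) \sum_(j' <- idx) ind (zone (Y j xi) e /\ zone (Y j' xi') e) :> R.
    by apply: sumr_ge0 => j _; apply: sumr_ge0 => j' _; exact: ind_ge0.
  have [[[j jg zj] [j' jg' zj']]|h] := pselect (corridor xi e /\ corridor xi' e); last by rewrite indF.
  rewrite indT//; last by split; [exists j|exists j'].
  rewrite (bigD1_seq j) ?mem_iota ?iota_uniq//= (bigD1_seq j') ?mem_iota ?iota_uniq//=.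
  rewrite indT// -!addrA lerDl addr_ge0//.
    by apply: sumr_ge0 => i _; exact: ind_ge0.
  by apply: sumr_ge0 => i _; apply: sumr_ge0 => i' _; exact: ind_ge0.
apply: ler_sum => j _; apply: ler_sum => j' _.
have [nr|nn] := pselect (near (Y j xi) (Y j' xi')); last first.
  rewrite (indF _ nn) mulr0 big1// => e _; rewrite indF// => -[z z']; apply: nn.
  exact: zone_near z z'.
rewrite (indT _ nr) mulr1 sum_ind_count ler_nat; apply: leq_trans (zone_count (Y j xi)).
by apply: sub_count => e /asboolP[z _]; rewrite inE.
Qed.

Let f s : R := s.+1%:R ^+ 2 / delta ^+ s.+1.

Lemma f_ge0 s : 0 <= f s.
Proof. by rewrite divr_ge0 ?exprn_ge0 ?ltW. Qed.

(** Let [m] be the largest time occurring in a pair of near positions. There are at most [m + 1]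
    crossings and [(m + 1) ^ 2] near pairs, so the left side is at most [CR] times [f m], which is
    one of the terms on the right. *)
Lemma overlap_weighted xi xi' : overlap xi xi' / delta ^+ crossings xi xi' <=
  CR%:R * \sum_(j <- idx) \sum_(j' <- idx) ind (near (Y j xi) (Y j' xi')) * f (maxn j j').
Proof.
set S := \sum_(j <- idx) _; pose nr j j' := near (Y j xi) (Y j' xi').
have S0 : 0 <= S.
  by apply: sumr_ge0 => j _; apply: sumr_ge0 => j' _; rewrite mulr_ge0 ?ind_ge0 ?f_ge0.
set n : R := \sum_(j <- idx) \sum_(j' <- idx) ind (nr j j').
have h1 : overlap xi xi' <= CR%:R * n by exact: overlap_le.
have dm : 0 < (delta ^+ crossings xi xi')^-1 by rewrite invr_gt0 exprn_gt0.
apply: (@le_trans _ _ (CR%:R * n / delta ^+ crossings xi xi')); first by rewrite ler_pM2r.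
rewrite -mulrA; apply: ler_wpM2l => //.
have [ex|none] := pselect (exists s, `[< exists j j', [/\ (j < g)%N, (j' < g)%N, nr j j' & maxn j j' = s] >]); last first.
  rewrite [n](_ : _ = 0) ?mul0r// /n big_seq big1// => j; rewrite mem_iota add0n => /= jg.
  rewrite big_seq big1// => j'; rewrite mem_iota add0n => /= jg'.
  by rewrite indF// => h; apply: none; exists (maxn j j'); apply/asboolP; exists j, j'.
have bound s : `[< exists j j', [/\ (j < g)%N, (j' < g)%N, nr j j' & maxn j j' = s] >] -> (s <= g)%N.
  by move=> /asboolP[j [j' [jg jg' _ <-]]]; rewrite geq_max (ltnW jg) (ltnW jg').
case: (ex_maxnP ex bound) => s /asboolP[j0 [j0' [jg jg' nr0 <-]]] smax.
set m := maxn j0 j0' in smax *.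
have nle j j' : (j < g)%N -> (j' < g)%N -> nr j j' -> (j <= m)%N /\ (j' <= m)%N.
  move=> h h' hn; have := smax (maxn j j'); rewrite geq_max => h2.
  by apply/andP; apply: h2; apply/asboolP; exists j, j'.
have hm : (crossings xi xi' <= m.+1)%N.
  rewrite /crossings -size_filter -(size_iota 0 m.+1); apply: uniq_leq_size.
    by apply: filter_uniq; exact: iota_uniq.
  move=> j'; rewrite mem_filter !mem_iota !add0n => /andP[/asboolP[j h hn] /= h'].
  by rewrite ltnS; case: (nle j j' h h' hn).
have nm : n <= m.+1%:R ^+ 2.
  apply: (@le_trans _ _ (\sum_(j <- idx) \sum_(j' <- idx) ind (j <= m)%N * ind (j' <= m)%N)).
    apply: ler_sum_seq => j; rewrite mem_iota add0n => /= h; apply: ler_sum_seq => j'.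
    rewrite mem_iota add0n => /= h'; rewrite -ind_and; apply: ind_le; exact: nle.
  under eq_bigr do rewrite -mulr_sumr.
  rewrite -mulr_suml -expr2 ler_sqr ?nnegrE ?ler0n//; last by apply: sumr_ge0 => *; exact: ind_ge0.
  rewrite sum_ind_count ler_nat -size_filter -(size_iota 0 m.+1); apply: uniq_leq_size.
    by apply: filter_uniq; exact: iota_uniq.
  by move=> j; rewrite mem_filter !mem_iota !add0n ltnS => /andP[/asboolP h _].
apply: (@le_trans _ _ (f m)).
  apply: ler_pM => //; first by apply: sumr_ge0 => *; apply: sumr_ge0 => *; exact: ind_ge0.
    by rewrite ltW.
  rewrite lef_pV2 ?posrE ?exprn_gt0//; apply: ler_wiXn2l => //; exact: ltW.
rewrite /S (bigD1_seq j0) ?mem_iota ?iota_uniq//= (bigD1_seq j0') ?mem_iota ?iota_uniq//=.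
rewrite indT// mul1r -/m -!addrA lerDl addr_ge0//.
  by apply: sumr_ge0 => i _; rewrite mulr_ge0 ?ind_ge0 ?f_ge0.
by apply: sumr_ge0 => i _; apply: sumr_ge0 => i' _; rewrite mulr_ge0 ?ind_ge0 ?f_ge0.
Qed.

Lemma sum_halves n : \sum_(s <- iota 0 n) (2 ^+ s)^-1 <= 2 :> R.
Proof.
suff : \sum_(s <- iota 0 n) (2 ^+ s)^-1 = 2 - 2 / 2 ^+ n :> R.
  move=> ->; rewrite gerBl divr_ge0// exprn_ge0//.
elim: n => [|n IH]; first by rewrite big_nil expr0 divr1 subrr.
rewrite -addn1 iotaD big_cat big_seq1 /= IH add0n addn1 exprS.
by field; rewrite expf_neq0// pnatr_eq0.
Qed.

Lemma cube_le s : (s.+1 ^ 3 <= 8 ^ s)%N.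
Proof. by rewrite (_ : 8 = 2 ^ 3)%N// -expnM mulnC expnM leq_exp2r// ltn_expl. Qed.

(** Where [16 <= K delta] is used, as [16 = 8 * 2]: the 8 absorbs the cube of [s + 1], and the 2
    makes the sum over [s] converge. *)
Lemma weight_le s : (s <= g)%N ->
  s.+1%:R * (f s * K%:R ^+ (g - s)) <= K%:R ^+ g / delta * (2 ^+ s)^-1.
Proof.
move=> sg; have K0 : 0 < K%:R :> R.
  by rewrite -(pmulr_lgt0 _ d0); apply: lt_le_trans Kd.
have Kg : K%:R ^+ g = K%:R ^+ (g - s) * K%:R ^+ s :> R by rewrite -exprD subnK.
have h16 : 16 ^+ s <= (K%:R * delta) ^+ s by rewrite lerXn2r ?nnegrE// mulr_ge0// ltW.
have h8 : s.+1%:R ^+ 3 <= 8 ^+ s :> R by rewrite -!natrX ler_nat; exact: cube_le.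
rewrite [leLHS](_ : _ = K%:R ^+ g / delta * (s.+1%:R ^+ 3 / (K%:R * delta) ^+ s)); last first.
  have fE : f s = s.+1%:R ^+ 2 / (delta * delta ^+ s) by rewrite -exprS.
  rewrite Kg fE [(_ * delta) ^+ s]exprMn.
  have : 0 < K%:R ^+ s :> R by rewrite exprn_gt0.
  have : 0 < delta ^+ s by rewrite exprn_gt0.
  move: (K%:R ^+ (g - s)) (K%:R ^+ s) (delta ^+ s) => x y z z0 y0.
  by field; rewrite !gt_eqF.
apply: ler_wpM2l; first by rewrite divr_ge0 ?exprn_ge0 ?ltW.
rewrite ler_pdivrMr; last by apply: lt_le_trans h16; rewrite exprn_gt0.
apply: le_trans h8 _; rewrite mulrC ler_pdivlMr ?exprn_gt0// -exprMn.
by rewrite (_ : 8 * 2 = 16) // -natrM.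
Qed.

Hypothesis near_count : forall j v, (j < g)%N ->
  \sum_(xi <- Xi) ind (near v (Y j xi)) <= CB%:R * K%:R ^+ (g - j) :> R.
Local Notation n := (size Xi)%:R.

Lemma near_sym v v' : near v v' -> near v' v.
Proof. exact: ball_sym. Qed.

(** The walk with the later time is summed first, for it has fewer ways to be near a given
    vertex. *)
Lemma sum_near j j' : (j < g)%N -> (j' < g)%N ->
  \sum_(xi <- Xi) \sum_(xi' <- Xi) ind (near (Y j xi) (Y j' xi')) <=
  n * (CB%:R * K%:R ^+ (g - maxn j j')) :> R.
Proof.
move=> jg jg'; have e (c : R) : n * c = \sum_(xi <- Xi) c.
  by rewrite big_const_seq count_predT iter_addr_0 mulr_natl.
rewrite e; have [jj|jj] := leqP j j'; last rewrite exchange_big; apply: ler_sum => xi _.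
  exact: near_count.
apply: le_trans (near_count (Y j' xi) jg); apply: ler_sum => xi' _.
by apply: ind_le; exact: near_sym.
Qed.

Lemma sum_overlap_weighted : \sum_(xi <- Xi) \sum_(xi' <- Xi) overlap xi xi' / delta ^+ crossings xi xi' <=
  CR%:R * (n * CB%:R) * (4 * K%:R ^+ g / delta).
Proof.
have f0 := f_ge0.
apply: (@le_trans _ _ (\sum_(xi <- Xi) \sum_(xi' <- Xi) CR%:R *
    \sum_(j <- idx) \sum_(j' <- idx) ind (near (Y j xi) (Y j' xi')) * f (maxn j j'))).
  by apply: ler_sum => xi _; apply: ler_sum => xi' _; exact: overlap_weighted.
have -> : \sum_(xi <- Xi) \sum_(xi' <- Xi) CR%:R *
    \sum_(j <- idx) \sum_(j' <- idx) ind (near (Y j xi) (Y j' xi')) * f (maxn j j') =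
  CR%:R * \sum_(j <- idx) \sum_(j' <- idx) f (maxn j j') *
    \sum_(xi <- Xi) \sum_(xi' <- Xi) ind (near (Y j xi) (Y j' xi')).
  under eq_bigr do rewrite -mulr_sumr.
  rewrite -mulr_sumr; congr (_ * _).
  under eq_bigr do rewrite exchange_big /=.
  rewrite exchange_big /=; apply: eq_bigr => j _.
  under eq_bigr do rewrite exchange_big /=.
  rewrite exchange_big /=; apply: eq_bigr => j' _.
  rewrite mulr_sumr; apply: eq_bigr => xi _; rewrite mulr_sumr; apply: eq_bigr => xi' _.
  by rewrite mulrC.
rewrite -mulrA; apply: ler_wpM2l => //.
pose F s : R := f s * K%:R ^+ (g - s).
have F0 s : 0 <= F s by rewrite mulr_ge0 ?exprn_ge0.
apply: (@le_trans _ _ (\sum_(j <- idx) \sum_(j' <- idx) n * CB%:R * (ind (j' <= j)%N * F j + ind (j <= j')%N * F j'))).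
  apply: ler_sum_seq => j; rewrite mem_iota add0n => /= jg.
  apply: ler_sum_seq => j'; rewrite mem_iota add0n => /= jg'.
  apply: (le_trans (ler_wpM2l (f0 _) (sum_near jg jg'))).
  rewrite (_ : f _ * _ = n * CB%:R * F (maxn j j')); last by rewrite /F; ring.
  apply: ler_wpM2l; first by rewrite mulr_ge0.
  have [jj|jj] := leqP j j'.
    by rewrite (indT R (P := true))// mul1r lerDr mulr_ge0 ?ind_ge0.
  by rewrite (indT R (ltnW jj)) mul1r lerDl mulr_ge0 ?ind_ge0.
have cnt s : \sum_(j <- idx) ind (j <= s)%N <= s.+1%:R :> R.
  rewrite sum_ind_count ler_nat -size_filter -(size_iota 0 s.+1); apply: uniq_leq_size.
    by apply: filter_uniq; exact: iota_uniq.
  by move=> j; rewrite mem_filter !mem_iota !add0n ltnS => /andP[/asboolP h _].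
have half : \sum_(j <- idx) \sum_(j' <- idx) ind (j' <= j)%N * F j <= 2 * K%:R ^+ g / delta.
  apply: (@le_trans _ _ (\sum_(j <- idx) K%:R ^+ g / delta * (2 ^+ j)^-1)).
    apply: ler_sum_seq => j; rewrite mem_iota add0n => /= jg.
    rewrite -mulr_suml; apply: le_trans (weight_le (ltnW jg)).
    by apply: ler_wpM2r.
  rewrite -mulr_sumr mulrC -mulrA; apply: ler_wpM2r; last exact: sum_halves.
  by apply: divr_ge0; [exact: exprn_ge0|exact: ltW].
have half' : \sum_(j <- idx) \sum_(j' <- idx) ind (j <= j')%N * F j' <= 2 * K%:R ^+ g / delta.
  by rewrite exchange_big.
under eq_bigr do rewrite -mulr_sumr big_split /=.
rewrite -mulr_sumr big_split /=; apply: ler_wpM2l; first by rewrite mulr_ge0.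
by apply: (le_trans (lerD half half')); rewrite le_eqVlt; apply/orP; left; apply/eqP; ring.
Qed.

Hypothesis endpoints : forall xi, xi \in Xi -> A (Y 0 xi) /\ ~ U (Y g xi).
Hypothesis Xi0 : (0 < size Xi)%N.
Variable r : nat.

(** Weights giving each walk the same expected mass [1 / n], so that the expected total mass is
    1. *)
Let c xi : R := (n * Pr p l (linked xi))^-1.

Lemma c_ge0 xi : 0 <= c xi.
Proof. by rewrite invr_ge0 mulr_ge0// Pr_ge0. Qed.

Lemma linked_route xi w : xi \in Xi -> w `<=` [set` l] -> linked xi w ->
  exists nu, [/\ valid (okA l U A) w nu, mass nu = 1 &
    forall e, load nu e <= ind (corridor xi e) :> R].
Proof.
move=> xiX wl lk; have [A0 Ug] := endpoints xiX.
pose mu : seq (R * route E) := [:: (1, (None, w `&` corridor xi))].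
have v : valid (okO l U (Y 0 xi)) w mu.
  move=> x; rewrite inE => /eqP -> /=; split=> /=; [exact: ler01| |by move=> e []].
  split=> /=; [by []| |by move=> e [/wl]].
  exists (Y g xi) => //; suff : forall i, (i <= g)%N -> conn (w `&` corridor xi) (Y 0 xi) (Y i xi).
    by apply.
  elim=> [_|i IH ig]; first exact: conn_refl.
  apply: (conn_trans (IH (ltnW ig))); apply: conn_mono (lk i ig) => e [we ze].
  by split=> //; exists i.
have [nu [v' m' l']] := cut_at_exit AU A0 v; exists nu; split=> //.
  by rewrite m' /mass big_seq1.
move=> e; apply: le_trans (l' e) _; rewrite /load big_seq1 mul1r.
by apply: ind_le => -[//|[]].
Qed.

Lemma capA_second_moment w (t : R) : w `<=` [set` l] -> 0 <= t ->
  2 * t * (\sum_(xi <- Xi) c xi * ind (linked xi w)) -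
  t ^+ 2 * (1 + r%:R) * (\sum_(xi <- Xi) \sum_(xi' <- Xi)
     c xi * c xi' * ind (linked xi w /\ linked xi' w) * overlap xi xi')
  <= capA R l r U A w.
Proof.
move=> wl t0.
have /choice[nu hnu] : forall xi, exists nu : seq (R * route E), xi \in Xi -> linked xi w ->
    [/\ valid (okA l U A) w nu, mass nu = 1 & forall e, load nu e <= ind (corridor xi e)].
  move=> xi; have [xiX|] := boolP (xi \in Xi); last by exists [::].
  have [lk|] := pselect (linked xi w); last by exists [::].
  by have [nu h] := linked_route xiX wl lk; exists nu.
pose s := [seq xi <- Xi | `[< linked xi w >]].
have sP xi : xi \in s -> xi \in Xi /\ linked xi w by rewrite mem_filter => /andP[/asboolP].
have sumS (F : I -> R) : \sum_(xi <- s) F xi = \sum_(xi <- Xi) F xi * ind (linked xi w).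
  rewrite big_filter big_mkcond /=; apply: eq_bigr => xi _.
  by case: asboolP => h; [rewrite indT ?mulr1|rewrite indF ?mulr0].
pose mu := flatten [seq scale (c xi) (nu xi) | xi <- s].
have vmu : valid (okA l U A) w mu.
  move=> x /flattenP[_ /mapP[xi /sP[xiX lk] ->]]; apply: valid_scale; first exact: c_ge0.
  by have [] := hnu xi xiX lk.
have mu0 := valid_nonneg vmu.
have mass_mu : mass mu = \sum_(xi <- Xi) c xi * ind (linked xi w).
  rewrite mass_flatten -sumS; apply: eq_big_seq => xi /sP[xiX lk].
  by have [_ m1 _] := hnu xi xiX lk; rewrite mass_scale m1 mulr1.
have load_mu e : load mu e <= \sum_(xi <- s) c xi * ind (corridor xi e).
  rewrite load_flatten; apply: ler_sum_seq => xi /sP[xiX lk]; rewrite load_scale.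
  by apply: ler_wpM2l; [exact: c_ge0|have [_ _] := hnu xi xiX lk].
have en_mu : energy l r mu <= (1 + r%:R) * \sum_(e <- l) load mu e ^+ 2.
  rewrite mulrDl mul1r lerD2l; apply: ler_wpM2l => //; apply: ler_sum => e _.
  by rewrite ler_sqr ?nnegrE ?cload_le_load ?load_ge0 ?cload_ge0.
have sq : \sum_(e <- l) load mu e ^+ 2 <= \sum_(xi <- Xi) \sum_(xi' <- Xi)
     c xi * c xi' * ind (linked xi w /\ linked xi' w) * overlap xi xi'.
  apply: (@le_trans _ _ (\sum_(e <- l) (\sum_(xi <- s) c xi * ind (corridor xi e)) ^+ 2)).
    apply: ler_sum => e _; have h0 := load_ge0 e mu0.
    by rewrite ler_sqr ?nnegrE// (le_trans h0).
  rewrite (eq_bigr (fun e => \sum_(xi <- Xi) \sum_(xi' <- Xi)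
     c xi * c xi' * ind (linked xi w /\ linked xi' w) * ind (corridor xi e /\ corridor xi' e))); last first.
    move=> e _; rewrite expr2 !sumS mulr_suml; apply: eq_bigr => xi _.
    by rewrite mulr_sumr; apply: eq_bigr => xi' _; rewrite !ind_and; ring.
  rewrite exchange_big /=; apply: ler_sum => xi _; rewrite exchange_big /=; apply: ler_sum => xi' _.
  by rewrite -mulr_sumr.
have := Cap_ub r (@okA_edge G l U A) (valid_scale t0 vmu).
rewrite mass_scale energy_scale mass_mu -/(capA R l r U A w); apply: le_trans.
rewrite mulrA lerD2l lerN2 -mulrA; apply: ler_wpM2l; first exact: sqr_ge0.
by apply: le_trans en_mu _; apply: ler_wpM2l.
Qed.

(** Second moment method: the weighted measure on linked walks has mean mass 1 and mean energy at
    most [(1 + r) z], contact flows being bounded by loads. The factor [t] is optimal for these two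
    bounds. *)
Lemma exp_capA (z : R) : 0 < z ->
  CR%:R * CB%:R * (4 * K%:R ^+ g / delta) <= n * z -> ((1 + r%:R) * z)^-1 <= Ex p l (capA R l r U A).
Proof.
move=> z0 hz; set t := ((1 + r%:R) * z)^-1.
have r1 : 0 < 1 + r%:R :> R by rewrite ltr_pwDl.
have t0 : 0 < t by rewrite invr_gt0 mulr_gt0.
have n0 : 0 < n :> R by rewrite ltr0n.
have cE xi : xi \in Xi -> c xi * Pr p l (linked xi) = n^-1.
  move=> xiX; rewrite /c invfM -mulrA mulVf ?mulr1// gt_eqF//; exact: linked_gt0.
have W1 : \sum_(xi <- Xi) c xi * Pr p l (linked xi) = 1.
  rewrite (eq_big_seq (fun=> n^-1)) ?big_const_seq ?count_predT ?iter_addr_0//.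
  by rewrite -[X in X = _]mulr_natl mulfV// gt_eqF.
set Q := \sum_(xi <- Xi) \sum_(xi' <- Xi)
     c xi * c xi' * Pr p l (fun w => linked xi w /\ linked xi' w) * overlap xi xi'.
have Q1 : Q <= z.
  apply: (@le_trans _ _ (n^-1 ^+ 2 * (\sum_(xi <- Xi) \sum_(xi' <- Xi) overlap xi xi' / delta ^+ crossings xi xi'))).
    rewrite mulr_sumr; apply: ler_sum_seq => xi xiX; rewrite mulr_sumr; apply: ler_sum_seq => xi' xi'X.
    have o0 : 0 <= overlap xi xi' by apply: sumr_ge0 => e _; exact: ind_ge0.
    have cc0 : 0 <= c xi * c xi' by rewrite mulr_ge0 ?c_ge0.
    have h := ler_wpM2l cc0 (linked_correlation xiX xi'X).
    rewrite (_ : n^-1 ^+ 2 * _ = n^-1 ^+ 2 / delta ^+ crossings xi xi' * overlap xi xi'); last first.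
      by rewrite mulrA mulrAC.
    apply: ler_wpM2r => //; rewrite ler_pdivlMr ?exprn_gt0// -[leLHS]mulrA; apply: le_trans h _.
    by rewrite mulrACA !cE// expr2.
  apply: (le_trans (ler_wpM2l (sqr_ge0 _) sum_overlap_weighted)).
  rewrite [leLHS](_ : _ = n^-1 * (CR%:R * CB%:R * (4 * K%:R ^+ g / delta))); last first.
    by move: (4 * _ / _) => u; field; rewrite gt_eqF.
  by rewrite mulrC ler_pdivrMr// [leRHS]mulrC.
apply: (@le_trans _ _ (2 * t * 1 - t ^+ 2 * (1 + r%:R) * z)).
  rewrite mulr1 (_ : t ^+ 2 * (1 + r%:R) * z = t); first by lra.
  by rewrite expr2 -!mulrA /t mulVf ?mulr1// gt_eqF// mulr_gt0.
apply: (@le_trans _ _ (2 * t * (\sum_(xi <- Xi) c xi * Pr p l (linked xi)) - t ^+ 2 * (1 + r%:R) * Q)).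
  rewrite W1 lerD2l lerN2; apply: ler_wpM2l => //.
  by rewrite mulr_ge0 ?sqr_ge0// ltW.
rewrite (_ : _ - _ = Ex p l (fun w => 2 * t * (\sum_(xi <- Xi) c xi * ind (linked xi w)) -
  t ^+ 2 * (1 + r%:R) * (\sum_(xi <- Xi) \sum_(xi' <- Xi)
     c xi * c xi' * ind (linked xi w /\ linked xi' w) * overlap xi xi'))).
  by apply: Ex_le => // w wl; apply: capA_second_moment => //; exact: ltW.
rewrite ExB !ExZ !Ex_sum; congr (_ * _ - _ * _).
  by apply: eq_bigr => xi _; rewrite ExZ.
apply: eq_bigr => xi _; rewrite Ex_sum; apply: eq_bigr => xi' _.
rewrite (Ex_ext _ _ (g := fun w => c xi * c xi' * overlap xi xi' * ind (linked xi w /\ linked xi' w))).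
  by rewrite ExZ /Pr; ring.
by move=> w _; ring.
Qed.

End Intersections.

Lemma expn_ge_twice K m : (2 <= K)%N -> (2 * m <= K ^ (2 * m))%N.
Proof.
move=> K2; have [->//|m0] := posnP (2 * m).
by apply: leq_trans (ltnW (ltn_expl (2 * m) (ltnSn 1))) _; rewrite leq_exp2r.
Qed.

(** The weighted overlap of all pairs of walks is of order [n K ^ g] with [n] walks, and [n] is at
    least [|A| K ^ g / 2]. After normalisation the energy is thus of order [1 / |A|], which makes
    the bound linear in [|A|]. *)
Lemma uniform_exit_bound (R : realType) (G : multigraph) (D : nat) (p delta : R) (k rho K : nat) :
  hasdeg G D -> (0 < D)%N -> 0 <= p -> p <= 1 -> 0 < delta -> delta <= 1 -> 16 <= K%:R * delta ->
  (forall W : set (vertex G), finite_set W -> (K * nb W <= nb (\bigcup_(x in W) ball setT x k))%N) ->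
  (forall (x y : vertex G) l, ball setT x k y -> uniq l -> touch (ball setT x rho) `<=` [set` l] ->
     delta <= Pr p l (fun w => conn (w `&` touch (ball setT x rho)) x y)) ->
  exists2 C : R, 0 < C & forall r, (0 < r)%N -> forall U : set (vertex G), finite_set U ->
    exists l, [/\ uniq l, touch U `<=` [set` l] & exit_bound p l U r C].
Proof.
move=> hD D0 p0 p1 d0 d1 Kd hexp hlink.
pose CR := (D * D.+1 ^ rho)%N; pose CB := (D.+1 ^ (rho + 1 + rho))%N.
have CR0 : (0 < CR)%N by rewrite muln_gt0 D0 expn_gt0.
have CB0 : (0 < CB)%N by rewrite expn_gt0.
have CC0 : 0 < CR%:R * CB%:R / delta :> R by rewrite divr_gt0// mulr_gt0 ?ltr0n.
exists (16 * (CR%:R * CB%:R / delta)); first by rewrite mulr_gt0.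
(* This length ensures [2 |U| <= K ^ g]. The words end at distinct vertices, so at most [|U|] of
   them end in [U], which is at most half of those starting from [A]. *)
move=> r r0 U fU; pose g := (2 * nb U)%N.
have K2 : (2 <= K)%N.
  rewrite -(ler_nat R); apply: (@le_trans _ _ 16); first by rewrite ler_nat.
  by apply: le_trans Kd _; rewrite ler_piMr.
have K0 : (0 < K)%N by apply: ltnW.
have Kg : (2 * nb U <= K ^ g)%N by exact: expn_ge_twice.
have fb v m : finite_set (ball (setT : set (edge G)) v m) by have [] := ball_card hD setT v m.
set Lam := \bigcup_(u in U) ball (setT : set (edge G)) u (k * g).
have fL : finite_set Lam by exact: bigcup_finite.
have [psi [psi_ball psi_inj]] := matching hD fL hexp.
have fl : finite_set (touch (\bigcup_(v in Lam) ball setT v rho)).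
  by apply: (finite_touch hD); exact: bigcup_finite.
have [l [ul _ lP]] := enum_setP fl.
have zl v : Lam v -> touch (ball setT v rho) `<=` [set` l].
  by move=> Lv e te; apply/lP; apply: touch_sub te => u bu; exists v.
have UL v : U v -> Lam v by move=> Uv; exists v => //; exact: ball_center.
exists l; split=> // [e|A AU A0].
  by move=> te; apply/lP; apply: touch_sub te => v Uv; exists v; [exact: UL|exact: ball_center].
have fA := sub_finite_set AU fU; have [q [uq sq qA]] := enum_setP fA.
have qU x : x \in q -> U x by move=> /qA/AU.
pose Y j (xi : vertex G * seq 'I_K) := foldl psi xi.1 (take j xi.2).
pose Xi := [seq xi <- starts K g q | `[< ~ U (Y g xi) >]].
have XiP xi : xi \in Xi -> [/\ A xi.1, size xi.2 = g & ~ U (Y g xi)].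
  by rewrite mem_filter mem_starts => /and3P[/asboolP ? /qA ? /eqP].
have YL xi j : xi \in Xi -> (j <= g)%N -> Lam (Y j xi).
  move=> /XiP[/AU Ux sg _] jg; apply: walk_Lam => //.
  by rewrite size_takel ?sg.
have links xi j : xi \in Xi -> (j < g)%N -> delta <= Pr p l (link rho Y j xi).
  move=> xiX jg; apply: hlink => //; last by apply: zl; apply: YL => //; exact: ltnW.
  have [_ sg _] := XiP xi xiX.
  by rewrite /Y (take_nth (Ordinal K0)) ?sg// foldl_rcons; exact: psi_ball.
have zone_count v : (count [in touch (ball setT v rho)] l <= CR)%N.
  have [fB nB] := ball_card hD setT v rho.
  by apply: leq_trans (count_touch hD ul fB) _; rewrite leq_mul2l nB orbT.
have near_count j v : (j < g)%N ->
    \sum_(xi <- Xi) ind (near rho v (Y j xi)) <= CB%:R * K%:R ^+ (g - j) :> R.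
  move=> jg; have [fB nB] := ball_card hD setT v (rho + 1 + rho).
  apply: (@le_trans _ _ (\sum_(xi <- starts K g q) ind (near rho v (Y j xi)))).
    rewrite /Xi big_filter big_mkcond; apply: ler_sum => xi _.
    by case: ifP => // _; exact: ind_ge0.
  apply: (le_trans (sum_walk psi_ball psi_inj uq qU R (ltnW jg) fB)).
  by rewrite natrM natrX ler_wpM2r ?exprn_ge0// ler_nat.
have nA0 : (0 < nb A)%N by exact: nb_gt0.
have XiN : (nb A * K ^ g <= 2 * size Xi)%N.
  have : ((size Xi)%:R : R) + (nb U)%:R >= (nb A * K ^ g)%:R.
    rewrite -sq -size_starts -[(size Xi)%:R](_ : \sum_(xi <- starts K g q) ind (~ U (Y g xi)) = _); last first.
      by rewrite sum_ind_count /Xi size_filter.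
    have := sum_walk psi_ball psi_inj uq qU R (leqnn g) fU; rewrite subnn expn0 muln1 => h.
    rewrite (_ : (size _)%:R = \sum_(xi <- starts K g q) ind (~ U (Y g xi)) + \sum_(xi <- starts K g q) ind (U (Y g xi))).
      by rewrite lerD2l.
    rewrite -big_split /= (eq_bigr (fun=> 1)).
      by rewrite big_const_seq count_predT iter_addr_0.
    by move=> xi _; rewrite ind_not subrK.
  rewrite -natrD ler_nat => h.
  have h2 : (K ^ g <= nb A * K ^ g)%N by rewrite leq_pmull.
  by move: h h2 Kg; set a := (nb A * _)%N; set b := (K ^ g)%N; lia.
have n0 : (0 < size Xi)%N.
  have : (0 < nb A * K ^ g)%N by rewrite muln_gt0 nA0 expn_gt0 K0.
  by move=> /leq_trans/(_ XiN); rewrite muln_gt0.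
have nA0' : 0 < (nb A)%:R :> R by rewrite ltr0n.
pose z : R := 8 * (CR%:R * CB%:R / delta) / (nb A)%:R.
have z0 : 0 < z by rewrite divr_gt0// mulr_gt0.
have r1 : 1 <= r%:R :> R by rewrite ler1n.
have key : ((1 + r%:R) * z)^-1 <= Ex p l (capA R l r U A).
  have ends xi : xi \in Xi -> A (Y 0%N xi) /\ ~ U (Y g xi).
    by move=> /XiP[? _ ?]; rewrite /Y take0.
  apply: (exp_capA p0 p1 d0 d1 Kd AU links zone_count near_count ends n0 r z0).
  rewrite /z.
  have h : (nb A)%:R * K%:R ^+ g <= 2 * (size Xi)%:R :> R by rewrite -natrX -!natrM ler_nat.
  rewrite (_ : CR%:R * CB%:R * (4 * K%:R ^+ g / delta) =
    4 * (CR%:R * CB%:R / delta) / (nb A)%:R * ((nb A)%:R * K%:R ^+ g)); last first.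
    by field; rewrite !gt_eqF.
  apply: (le_trans (ler_wpM2l _ h)); first by rewrite divr_ge0// mulr_ge0// ltW.
  by rewrite le_eqVlt; apply/orP; left; apply/eqP; field; rewrite !gt_eqF.
apply: le_trans key; have C0 : 0 < 16 * (CR%:R * CB%:R / delta) by rewrite mulr_gt0.
have r0' : 0 < r%:R :> R by rewrite ltr0n.
have a0 : 0 < (1 + r%:R) * z by apply: mulr_gt0 z0; lra.
have b0 : 0 < ((nb A)%:R / (16 * (CR%:R * CB%:R / delta) * r%:R))^-1.
  by rewrite invr_gt0; apply: divr_gt0 => //; exact: mulr_gt0.
rewrite -[leLHS]invrK lef_pV2 ?posrE//.
apply: (@le_trans _ _ (2 * r%:R * z)); first by rewrite ler_pM2r//; lra.
rewrite invf_div /z le_eqVlt; apply/orP; left; apply/eqP; field; rewrite !gt_eqF//.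
Qed.

(** * Automorphisms *)

Section Automorphisms.
Variable G : multigraph.
Local Notation V := (vertex G).
Local Notation E := (edge G).
Implicit Types (w : set E) (fV : V -> V) (fE : E -> E).

Lemma aut_joins fV fE e x y : is_automorphism fV fE -> joins e x y ->
  joins (fE e) (fV x) (fV y).
Proof.
by move=> [_ _ h]; case: (h e) => he [] je; rewrite je /= in he; [left|right|right|left].
Qed.

Lemma aut_inverse fV fE : is_automorphism fV fE -> exists gV gE,
  [/\ is_automorphism gV gE, cancel fV gV, cancel gV fV, cancel fE gE & cancel gE fE].
Proof.
move=> [[gV fgV gfV] [gE fgE gfE] h]; exists gV, gE; split=> //; split.
- by exists fV.
- by exists fE.
move=> e; have := h (gE e); rewrite gfE; case: (ends (gE e)) => a b /= [] ->; rewrite /= !fgV.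
  by left.
by right.
Qed.

Lemma aut_conn fV fE w x y : is_automorphism fV fE -> conn w x y ->
  conn (fE @` w) (fV x) (fV y).
Proof.
move=> af c; apply: (@conn_ind _ _ (fun y => conn (fE @` w) (fV x) (fV y)) _ _ _ c).
  move=> z z' e cz we j; apply: (conn_step cz _ (aut_joins af j)).
  by exists e.
exact: conn_refl.
Qed.

Lemma aut_ball fV fE x n y : is_automorphism fV fE -> ball setT x n y ->
  ball setT (fV x) n (fV y).
Proof.
move=> af; elim: n y => [|n IH] y; first by move=> ->.
move=> [/IH h|[z [e [/IH bz _ j]]]]; first exact: (ball_le (leqnSn n)).
exact: (ball_S bz Logic.I (aut_joins af j)).
Qed.

Lemma aut_touch fV fE (A A' : set V) e : is_automorphism fV fE ->
  (forall v, A v -> A' (fV v)) -> touch A e -> touch A' (fE e).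
Proof.
move=> af AA' [h|h].
  exact: joins_touch (aut_joins af (joins_ends e)) (AA' _ h).
exact: joins_touch (aut_joins af (joins_sym (joins_ends e))) (AA' _ h).
Qed.

Hypothesis qt : quasi_transitive G.

Lemma orbit_representatives : exists reps : seq V,
  forall x, exists o fV fE, [/\ o \in reps, is_automorphism fV fE & x = fV o].
Proof.
have [s [_ _ hs]] := enum_setP qt.
have [[v0 _]|noV] := pselect (exists v : V, True); last first.
  by exists [::] => x; case: noV; exists x.
have /choice[f hf] : forall O : set V, exists x : V, O \in s -> aut_orbit x = O.
  move=> O; have [Os|] := boolP (O \in s); last by exists v0.
  by have /hs[x _ <-] := Os; exists x.
exists (map f s) => x.
have Os : aut_orbit x \in s by apply/hs; exists x.
have : aut_orbit (f (aut_orbit x)) x.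
  rewrite (hf _ Os); exists id, id; split=> //; split; try by exists id.
  by move=> e; left; case: (ends e).
move=> [fV [fE [af xe]]]; exists (f (aut_orbit x)), fV, fE; split=> //.
exact: map_f.
Qed.

(** All uses of quasi-transitivity pass through this principle: an invariant property, monotone in
    its parameter, has to be examined at finitely many representatives only. *)
Lemma uniformly_in_vertices (Q : V -> nat -> Prop) :
  (forall x n m, (n <= m)%N -> Q x n -> Q x m) ->
  (forall fV fE x n, is_automorphism fV fE -> Q x n -> Q (fV x) n) ->
  (forall x, exists n, Q x n) -> exists n, forall x, Q x n.
Proof.
move=> mono inv ex; have [reps hreps] := orbit_representatives.
have [n hn] : exists n, forall o, o \in reps -> Q o n.
  elim: reps {hreps} => [|o reps [n hn]]; first by exists 0%N.
  have [m hm] := ex o; exists (maxn n m) => y; rewrite inE => /orP[/eqP ->|/hn].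
    by apply: mono hm; exact: leq_maxr.
  by apply: mono; exact: leq_maxl.
exists n => x; have [c [fV [fE [creps af ->]]]] := hreps x.
by apply: (inv _ fE) => //; exact: hn.
Qed.

Lemma nb_finite_image (T T' : choiceType) (f : T -> T') (A : set T) (B : set T') :
  finite_set A -> B `<=` f @` A -> finite_set B /\ (nb B <= nb A)%N.
Proof.
move=> fA BA; have fimA := finite_image f fA; split; first exact: sub_finite_set fimA.
exact: leq_trans (nb_le fimA BA) (nb_image _ fA).
Qed.

Hypothesis lf : locally_finite_graph G.

Lemma degree_bound : exists2 D, (0 < D)%N & hasdeg G D.
Proof.
have [D hD] : exists D, forall x : V, finite_set (touch [set x]) /\ (nb (touch [set x]) <= D)%N.
  apply: uniformly_in_vertices => [x n m nm [h1 h2]|fV fE x n af [h1 h2]|x].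
  - by split=> //; exact: leq_trans nm.
  - have [gV [gE [ag fgV gfV fgE gfE]]] := aut_inverse af.
    have sub : touch [set fV x] `<=` fE @` touch [set x].
      move=> e te; exists (gE e) => //; apply: (aut_touch (A := [set fV x]) ag) te.
      by move=> v -> /=; rewrite fgV.
    by have [h3 h4] := nb_finite_image h1 sub; split=> //; exact: leq_trans h2.
  - exists (nb (touch [set x])); split=> //.
    have := finite_image fst (lf x); apply: sub_finite_set => e [h|h].
      by exists (e, false).
    by exists (e, true).
by exists D.+1 => // x; have [h1 h2] := hD x; split=> //; exact: leqW.
Qed.
End Automorphisms.

(** * Expansion *)

Section Expansion.
Variables (R : realType) (G : multigraph) (D : nat).
Local Notation V := (vertex G).
Hypotheses (hD : hasdeg G D) (D0 : (0 < D)%N) (na : nonamenable G R).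
Let h := cheeger_constant G R.
Implicit Types W : set V.

Definition fatten W n : set V := \bigcup_(x in W) ball setT x n.

Lemma finite_fatten W n : finite_set W -> finite_set (fatten W n).
Proof. by move=> fW; apply: bigcup_finite => // x _; have [] := ball_card hD setT x n. Qed.

Lemma fatten_fatten W n : fatten (fatten W n) 1 `<=` fatten W n.+1.
Proof. by move=> y [x [z Wz bx] by1]; exists z => //; rewrite -addn1; exact: ball_trans bx by1. Qed.

Lemma cheeger_le (K : {fset V}) : K != fset0%fset ->
  h <= (#|` fset_set (edge_boundary K)|)%:R / (\sum_(v <- K) degree setT v)%N%:R.
Proof.
move=> K0; apply: ge_inf; last by exists K.
by exists 0 => _ [K' _ <-]; rewrite divr_ge0.
Qed.

(** A vertex of degree zero would contribute the ratio 0, as division by zero gives zero, and the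
    infimum would not be positive. *)
Lemma degree_gt0 (v : V) : (0 < degree setT v)%N.
Proof.
have v0 : [fset v]%fset != fset0 by apply/fset0Pn; exists v; rewrite inE.
have := lt_le_trans na (cheeger_le v0); rewrite big_seq_fset1 lt0n.
by apply: contraTneq => ->; rewrite invr0 mulr0 ltxx.
Qed.

Lemma boundary_ge W : finite_set W -> h * (nb W)%:R <= (nb (edge_boundary (fset_set W)))%:R.
Proof.
move=> fW; have [W0|W0] := eqVneq (fset_set W) fset0%fset.
  by rewrite /nb {1}W0 cardfs0 mulr0.
have dW : ((nb W)%:R : R) <= (\sum_(v <- fset_set W) degree setT v)%N%:R.
  by rewrite ler_nat /nb -sum1_size; apply: leq_sum => v _; exact: degree_gt0.
have d0 : 0 < (\sum_(v <- fset_set W) degree setT v)%N%:R :> R.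
  by apply: lt_le_trans dW; rewrite ltr0n /nb cardfs_gt0.
have := cheeger_le W0; rewrite ler_pdivlMr//; apply: le_trans.
by apply: ler_wpM2l dW; exact: ltW.
Qed.

(** Each boundary edge of [W] touches a vertex of the fattened set outside [W], and at most [D]
    edges touch the same vertex. *)
Lemma fatten1_ge W : finite_set W -> (1 + h / D%:R) * (nb W)%:R <= (nb (fatten W 1))%:R.
Proof.
move=> fW; have ff := finite_fatten 1 fW.
have D0' : 0 < D%:R :> R by rewrite ltr0n.
have Wf : W `<=` fatten W 1 by move=> x Wx; exists x => //; exact: ball_center.
have fo : finite_set (fatten W 1 `\` W) by apply: sub_finite_set ff; exact: subDsetl.
have nf : nb (fatten W 1) = (nb W + nb (fatten W 1 `\` W))%N.
  rewrite -nb_disjoint//; first by rewrite setDUK.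
  by rewrite setDE setICA setICr setI0.
have fto := finite_touch hD fo.
have sub : edge_boundary (fset_set W) `<=` touch (fatten W 1 `\` W).
  have out x y e : joins e x y -> W x -> ~ W y -> (fatten W 1 `\` W) y.
    move=> j Wx Wy; split=> //; exists x => //; exact: (ball_S (ball_center _ x 0) Logic.I j).
  move=> e; rewrite /edge_boundary /= !in_fset_set//.
  have [h1|h1] := pselect (W (ends e).1); have [h2|h2] := pselect (W (ends e).2).
  - by rewrite !mem_set.
  - by move=> _; right; exact: (out _ _ e (joins_ends e)).
  - by move=> _; left; exact: (out _ _ e (joins_sym (joins_ends e))).
  - by rewrite !memNset.
have hb : (nb (edge_boundary (fset_set W)) <= D * nb (fatten W 1 `\` W))%N.
  exact: leq_trans (nb_le fto sub) (nb_touch hD fo).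
have := le_trans (boundary_ge fW) (_ : _ <= (D * nb (fatten W 1 `\` W))%:R).
rewrite ler_nat => /(_ hb); rewrite nf natrD natrM mulrDl mul1r lerD2l mulrAC.
by rewrite ler_pdivrMr// [leRHS]mulrC.
Qed.

Lemma fatten_ge W n : finite_set W -> (1 + h / D%:R) ^+ n * (nb W)%:R <= (nb (fatten W n))%:R.
Proof.
move=> fW; have c0 : 0 < 1 + h / D%:R by rewrite ltr_wpDr// divr_ge0// ltW.
elim: n => [|n IH].
  rewrite mul1r ler_nat; apply: nb_le; first exact: finite_fatten.
  by move=> x Wx; exists x.
rewrite exprS -mulrA; apply: (le_trans (ler_wpM2l (ltW c0) IH)).
apply: (le_trans (fatten1_ge (finite_fatten n fW))); rewrite ler_nat.
by apply: nb_le; [exact: finite_fatten|exact: fatten_fatten].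
Qed.

Lemma expansion (K : nat) : exists k, forall W, finite_set W ->
  (K * nb W <= nb (\bigcup_(x in W) ball (setT : set (edge G)) x k))%N.
Proof.
have hD0 : 0 < h / D%:R by rewrite divr_gt0// ltr0n.
have [k hk] := nat_above (K%:R / (h / D%:R)).
exists k => W fW; rewrite -(ler_nat R) natrM.
apply: le_trans (fatten_ge k fW); apply: ler_wpM2r => //.
have bern m : 1 + m%:R * (h / D%:R) <= (1 + h / D%:R) ^+ m.
  elim: m => [|m IH]; first by rewrite mul0r addr0.
  rewrite exprS; have c0 : 0 <= 1 + h / D%:R by lra.
  apply: le_trans (ler_wpM2l c0 IH); rewrite -natr1.
  have : 0 <= h / D%:R * (m%:R * (h / D%:R)) by rewrite mulr_ge0 ?mulr_ge0// ltW.
  lra.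
apply: le_trans (bern k); move: hk; rewrite ler_pdivrMr//; lra.
Qed.
End Expansion.

(** * Connection probabilities *)

Section Dichotomy.
Variables (R : realType) (G : multigraph) (D : nat) (p : R).
Local Notation V := (vertex G).
Local Notation E := (edge G).
Hypotheses (hD : hasdeg G D) (D0 : (0 < D)%N) (p0 : 0 < p) (p1 : p <= 1).
Hypotheses (cG : connected_graph G) (qt : quasi_transitive G).
Implicit Types (x y z : V) (l F : seq E) (w : set E) (U : set V).

Let p0' : 0 <= p := ltW p0.

Lemma edges_in_ball F x : exists n, [set` F] `<=` touch (ball setT x n).
Proof.
elim: F => [|e F [n hn]]; first by exists 0%N.
have [m hm] := conn_ball (cG x (ends e).1); exists (maxn n m) => e'.
rewrite /= inE => /orP[/eqP ->|/hn]; first by left; apply: ball_le hm; exact: leq_maxr.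
by apply: touch_sub; apply: ball_le; exact: leq_maxl.
Qed.

Lemma vertices_in_ball (s : seq V) x : exists n, forall y, y \in s -> ball setT x n y.
Proof.
elim: s => [|z s [n hn]]; first by exists 0%N.
have [m hm] := conn_ball (cG x z); exists (maxn n m) => y.
rewrite inE => /orP[/eqP ->|/hn]; first by apply: ball_le hm; exact: leq_maxr.
by apply: ball_le; exact: leq_maxl.
Qed.

Lemma Pr_aut fV fE F x y : is_automorphism fV fE ->
  Pr p F (fun w => conn w x y) <= Pr p (map fE F) (fun w => conn w (fV x) (fV y)).
Proof.
by move=> af; rewrite /Pr Ex_map; apply: Ex_le => // w _; apply: ind_le; exact: aut_conn.
Qed.

(** For one [x] finitely many targets [y] occur, and a ball contains the corresponding finite edge
    sets. Quasi-transitivity makes its radius uniform. *)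
Lemma uniform_links (delta : R) (k : nat) :
  (forall x y, exists2 F, uniq F & delta <= Pr p F (fun w => conn w x y)) ->
  exists rho, forall x y l, ball setT x k y -> uniq l -> touch (ball setT x rho) `<=` [set` l] ->
    delta <= Pr p l (fun w => conn (w `&` touch (ball setT x rho)) x y).
Proof.
move=> hF.
pose Q x n := forall y, ball (setT : set E) x k y -> exists F, [/\ uniq F,
  [set` F] `<=` touch (ball setT x n) & delta <= Pr p F (fun w => conn w x y)].
have [rho hrho] : exists rho, forall x, Q x rho.
  apply: (uniformly_in_vertices qt) => [x n m nm h y /h[F [h1 h2 h3]]|fV fE x n af h y by1|x].
  - exists F; split=> //; apply: subset_trans h2 _; apply: touch_sub; exact: ball_le.
  - have [gV [gE [ag fgV gfV fgE gfE]]] := aut_inverse af.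
    have := aut_ball ag by1; rewrite fgV => /h[F [h1 h2 h3]].
    exists (map fE F); split.
    + by rewrite map_inj_uniq//; exact: can_inj fgE.
    + move=> e /= /mapP[e' /h2 te' ->]; apply: (aut_touch af _ te') => v.
      exact: (aut_ball af).
    + by have := Pr_aut F x (gV y) af; rewrite gfV; exact: le_trans h3.
  - have [fB _] := ball_card hD setT x k.
    have [r [_ _ hr]] := enum_setP fB.
    have [n hn] : exists n, forall y, y \in r -> exists F, [/\ uniq F,
        [set` F] `<=` touch (ball setT x n) & delta <= Pr p F (fun w => conn w x y)].
      elim: r {hr} => [|z r [n hn]]; first by exists 0%N.
      have [F uF dF] := hF x z; have [m hm] := edges_in_ball F x.
      exists (maxn n m) => y; rewrite inE => /orP[/eqP ->|/hn[F' [h1 h2 h3]]].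
        exists F; split=> //; apply: subset_trans hm _; apply: touch_sub.
        by apply: ball_le; exact: leq_maxr.
      exists F'; split=> //; apply: subset_trans h2 _; apply: touch_sub.
      by apply: ball_le; exact: leq_maxl.
    by exists n => y /hr/hn.
exists rho => x y l bxy ul tl; have [F [uF sF dF]] := hrho x y bxy.
apply: (le_trans dF).
apply: (@le_trans _ _ (Pr p F (fun w => conn (w `&` touch (ball setT x rho)) x y))).
  apply: Pr_le => // w wF; apply: conn_mono => e we; split=> //; exact: sF (wF _ we).
apply: Pr_sub => //; last by move=> e /sF/tl.
by move=> w w' ww'; apply: conn_mono => e [/ww'].
Qed.

Lemma open_path x y : exists F, uniq F /\ exists n, forall l, uniq l -> {subset F <= l} ->
  p ^+ n <= Pr p l (fun w => [set` F] `<=` w) /\ conn [set` F] x y.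
Proof.
have [m /ball_path[s [_ _ c]]] := conn_ball (cG x y).
exists (undup s); split; first exact: undup_uniq.
exists (size (undup s)) => l ul sl; split; last first.
  by apply: conn_mono c => e es; rewrite /= mem_undup.
apply: Pr_open => //; rewrite -size_filter; apply: uniq_leq_size; first exact: filter_uniq.
by move=> e; rewrite mem_filter => /andP[/set_mem].
Qed.

Section Separation.
Variables eps : R.
Hypotheses (e0 : 0 < eps) (e1 : eps < 1).

(** Expresses that the connection probability in the whole graph exceeds [eps], without an infinite
    product measure. *)
Definition tied x y := exists2 F, uniq F & eps < Pr p F (fun w => conn w x y).

Lemma tied_refl x : tied x x.
Proof. by exists [::] => //; rewrite /Pr /= indT//; exact: conn_refl. Qed.

Lemma tied_sym x y : tied x y -> tied y x.
Proof.
move=> [F uF h]; exists F => //; apply: lt_le_trans h _; apply: Pr_le => // w _.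
exact: conn_sym.
Qed.

(** If no third point is untied from both, every vertex is tied to [x] or to [y]. Some edge of a
    path from [x] to [y] then leads from a vertex tied to [x] to one tied to [y], and the Harris
    inequality across it gives a connection probability of at least [eps * (p * eps)]. *)
Lemma separated_triple x y :
  (forall F, uniq F -> Pr p F (fun w => conn w x y) < eps * (p * eps)) ->
  exists X : seq V, [/\ uniq X, size X = 3 &
    forall z z', z \in X -> z' \in X -> z != z' -> ~ tied z z'].
Proof.
move=> hxy.
have nxy : ~ tied x y.
  move=> [F uF h]; have := lt_trans h (hxy F uF); apply/negP; rewrite -leNgt.
  by rewrite ler_piMr// ?(ltW e0)// mulr_ile1// ltW.
have [[z [nxz nyz]]|none] := pselect (exists z, ~ tied x z /\ ~ tied y z).
  have ne a b : ~ tied a b -> a != b by move=> h; apply/eqP => e; apply: h; rewrite e; exact: tied_refl.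
  have sn a b : ~ tied a b -> ~ tied b a by move=> h /tied_sym.
  exists [:: x; y; z]; split=> //.
    by rewrite /= !inE negb_or !ne.
  move=> a b; rewrite !inE => /or3P[] /eqP -> /or3P[] /eqP ->; rewrite ?eqxx// => _ //; exact: sn.
have cover z : tied x z \/ tied y z.
  have [h|h] := pselect (tied x z); first by left.
  by right; apply: contrapT => h'; apply: none; exists z.
case: nxy; apply: (@conn_ind G setT (tied x) x y _ (cG x y) (tied_refl x)) => z z' e txz _ j.
have [//|[F2 uF2 h2]] := cover z'; case: txz => F1 uF1 h1.
pose F := undup (e :: F1 ++ F2); have uF : uniq F by exact: undup_uniq.
have s1 : {subset F1 <= F} by move=> g gF; rewrite mem_undup inE mem_cat gF orbT.
have s2 : {subset F2 <= F} by move=> g gF; rewrite mem_undup inE mem_cat gF !orbT.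
have mono a b (w w' : set E) : w `<=` w' -> conn w a b -> conn w' a b by exact: conn_mono.
have := hxy F uF; rewrite ltNge => /negP; case.
have pe : p <= Pr p F (fun w => [set e] `<=` w).
  rewrite -[leLHS]expr1; apply: Pr_open => //.
    by move=> g ->; rewrite /= mem_undup inE eqxx.
  rewrite -size_filter; apply: (@uniq_leq_size _ _ [:: e]); first exact: filter_uniq.
  by move=> g; rewrite mem_filter => /andP[/set_mem -> _]; rewrite inE.
have b1 : eps <= Pr p F (fun w => conn w x z).
  by apply: ltW; apply: lt_le_trans h1 _; apply: Pr_sub => //; exact: mono.
have b2 : eps <= Pr p F (fun w => conn w y z').
  by apply: ltW; apply: lt_le_trans h2 _; apply: Pr_sub => //; exact: mono.
have o_mono (w w' : set E) : w `<=` w' -> [set e] `<=` w -> [set e] `<=` w'.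
  by move=> ww' h; exact: subset_trans ww'.
apply: (@le_trans _ _ (Pr p F (fun w => conn w x z) *
    (Pr p F (fun w => [set e] `<=` w) * Pr p F (fun w => conn w y z')))).
  by rewrite !ler_pM ?mulr_ge0// ltW.
apply: (@le_trans _ _ (Pr p F (fun w => conn w x z) *
    Pr p F (fun w => [set e] `<=` w /\ conn w y z'))).
  by apply: ler_wpM2l; [exact: Pr_ge0|exact: (harris_Pr p0' p1 _ o_mono (mono y z'))].
apply: le_trans (harris_Pr p0' p1 _ _ _) _.
- by move=> w w'; exact: mono.
- by move=> w w' ww' [h h']; split; [exact: o_mono ww' h|exact: mono ww' h'].
apply: Pr_le => // w _ [c [we c']]; apply: (conn_trans (y := z')); last exact: conn_sym.
by apply: (conn_step c _ j); exact: we.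
Qed.
End Separation.

(** Three given points reach the complement of [U] simultaneously with probability at least
    [theta ^ 3] by the Harris inequality, and untied points rarely share a cluster. Automorphisms
    carry an untied triple into every ball of a fixed radius. *)
Lemma three_ends_likely (theta : R) : 0 < theta -> theta <= 1 ->
  (forall U l x, finite_set U -> uniq l -> touch U `<=` [set` l] -> U x ->
    theta <= Pr p l (fun w => reach U w x)) ->
  (forall delta, 0 < delta -> exists x y, forall F, uniq F -> Pr p F (fun w => conn w x y) < delta) ->
  exists L, forall l U y, uniq l -> finite_set U -> touch U `<=` [set` l] ->
     ball setT y L.+1 `<=` U -> theta ^+ 3 / 2 <= Pr p l (three_ends L U y).
Proof.
(* There are nine ordered pairs, so all connections together cost at most [9 eps], which is half of
   [theta ^ 3]. *)
move=> t0 t1 hreach hN; pose eps := theta ^+ 3 / 18.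
have t30 : 0 < theta ^+ 3 by rewrite exprn_gt0.
have t31 : theta ^+ 3 <= 1 by rewrite exprn_ile1// ltW.
have e0 : 0 < eps by rewrite divr_gt0.
have e1 : eps < 1 by rewrite /eps; lra.
have [x [y hxy]] := hN (eps * (p * eps)) (mulr_gt0 e0 (mulr_gt0 p0 e0)).
have [X0 [uX0 sX0 hX0]] := separated_triple e0 e1 hxy.
pose Q y n := exists X : seq V, [/\ uniq X, size X = 3,
  (forall z, z \in X -> ball (setT : set E) y n z) &
  forall z z', z \in X -> z' \in X -> z != z' -> ~ tied eps z z'].
have [L hL] : exists L, forall y, Q y L.
  apply: (uniformly_in_vertices qt) => [v n m nm [X [h1 h2 h3 h4]]|fV fE v n af [X [h1 h2 h3 h4]]|v].
  - by exists X; split=> // z /h3; exact: ball_le.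
  - have [gV [gE [ag fgV gfV fgE gfE]]] := aut_inverse af.
    exists (map fV X); split.
    + by rewrite map_inj_uniq//; exact: can_inj fgV.
    + by rewrite size_map.
    + by move=> _ /mapP[z zX ->]; exact: (aut_ball af (h3 z zX)).
    + move=> _ _ /mapP[z zX ->] /mapP[z' zX' ->] ne [F uF hF].
      apply: (h4 z z' zX zX'); first by apply: contraNneq ne => ->.
      exists (map gE F); first by rewrite map_inj_uniq//; exact: can_inj gfE.
      by have := Pr_aut F (fV z) (fV z') ag; rewrite !fgV; exact: lt_le_trans hF.
  - have [n hn] := vertices_in_ball X0 v; exists n, X0; split=> //.
exists L => l U v ul fU tU BU; have [X [uX sX XB Xsep]] := hL v.
have XU z : z \in X -> U z by move=> /XB bz; apply: BU; exact: (ball_le (leqnSn L)).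
pose pairs := [seq (z, z') | z <- X, z' <- X].
pose tie (q : V * V) w := q.1 != q.2 /\ conn w q.1 q.2.
have all3 : theta ^+ 3 <= Pr p l (fun w => forall z, z \in X -> reach U w z).
  have -> : theta ^+ 3 = theta ^+ size X by rewrite sX.
  apply: harris_power => //.
    by move=> z w w'; exact: reach_mono.
  by move=> z zX; apply: hreach => //; exact: XU.
have ties : Pr p l (fun w => exists2 q, q \in pairs & tie q w) <= theta ^+ 3 / 2.
  apply: le_trans (Pr_exists p0' p1 _ _ _) _.
  apply: (@le_trans _ _ (\sum_(q <- pairs) eps)); last first.
    rewrite big_const_seq count_predT iter_addr_0 size_allpairs sX.
    by rewrite -[X in X <= _]mulr_natl /eps; lra.
  apply: ler_sum_seq => q /allpairsP[[z z'] /= [zX zX' ->]].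
  have [->|ne] := eqVneq z z'.
    rewrite /Pr (Ex_ext _ _ (g := fun=> 0)) ?Ex_cst ?ltW// => w _.
    by rewrite indF// => -[]; rewrite /= eqxx.
  rewrite leNgt; apply/negP => h; apply: (Xsep z z') => //; exists l => //.
  by apply: lt_le_trans h _; apply: Pr_le => // w _ [].
have : theta ^+ 3 <= Pr p l (three_ends L U v) + theta ^+ 3 / 2.
  apply: le_trans all3 _; apply: (@le_trans _ _ (Pr p l (three_ends L U v) +
    Pr p l (fun w => exists2 q, q \in pairs & tie q w))); last by rewrite lerD2l.
  apply: le_trans (Pr_or p0' p1 _ _ _); apply: Pr_le => // w _ hw.
  have [h|h] := pselect (exists2 q, q \in pairs & tie q w); [by right|left].
  exists X; split=> // [z zX|z z' zX zX' c]; first by split; [exact: XB|exact: hw].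
  have [//|ne] := eqVneq z z'; case: h; exists (z, z') => //.
  by apply/allpairsP; exists (z, z').
lra.
Qed.
End Dichotomy.

(** * Weak escapes are rare in all cases *)

Section TransientBound.
Variables (R : realType) (G : multigraph) (D : nat) (p : R).
Local Notation V := (vertex G).
Local Notation E := (edge G).
Hypotheses (hD : hasdeg G D) (D0 : (0 < D)%N) (p0 : 0 < p) (p1 : p <= 1).
Implicit Types (x y z o : V) (l F : seq E) (w : set E) (U : set V).

Let p0' : 0 <= p := ltW p0.

(** [r] and [U0] come before [U], so that [U] can later exhaust the graph at a fixed capacity
    level. *)
Definition transient_bound o := forall eps : R, 0 < eps -> exists r (U0 : set V),
  [/\ (0 < r)%N, finite_set U0 & forall U, finite_set U -> U0 `<=` U -> U o -> exists l,
    [/\ uniq l, touch U `<=` [set` l] &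
      Pr p l (fun w => reach U w o /\ capO R l U o w < (16 * r%:R)^-1) <= eps]].

Definition many_exits := exists2 K : R, 0 < K & exists r1, forall r, (r1 <= r)%N ->
  forall U, finite_set U -> exists l, [/\ uniq l, touch U `<=` [set` l] & exit_bound p l U r K].

Lemma transient_bound_lt1 o : p < 1 -> many_exits -> transient_bound o.
Proof.
move=> p1' [K K0 [r1 hK]] eps e0.
have [r0 hr0] := weak_escape_unlikely hD D0 p0 p1' K0 e0.
exists (maxn r0 (maxn r1 1)), set0; split=> //; first by rewrite !leq_max orbT orbT.
move=> U fU _ Uo; have rr1 : (r1 <= maxn r0 (maxn r1 1))%N by rewrite !leq_max leqnn orbT.
have [l [ul tl hl]] := hK _ rr1 U fU; exists l; split=> //.
by apply: hr0 => //; exact: leq_maxl.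
Qed.

Lemma Ex_one l (f : set E -> R) : p = 1 -> Ex p l f = f [set` l].
Proof.
move=> ->; elim: l f => [|e l IH] f /=.
  by congr f; apply/seteqP; split=> x //=.
rewrite subrr mul0r addr0 mul1r IH; congr f; apply/seteqP; split=> x /=.
  by rewrite inE => -[->|->]; rewrite ?eqxx ?orbT.
by rewrite inE => /orP[/eqP ->|?]; [left|right].
Qed.

(** When all edges are open, so is the contact edge, and a route leaving the single point [o] is
    already a route from [o]. This settles [p = 1]. *)
Lemma capA1_le_capO l U o r : U o -> capA R l r U [set o] [set` l] <= capO R l U o [set` l].
Proof.
move=> Uo; apply: Cap_le => [|mu vmu]; first exact: okA_edge.
have mu0 := valid_nonneg vmu.
have v : valid (okO l U o) [set` l] (extend (fun=> set0) mu).
  move=> _ /mapP[x xmu ->]; have [x0 [e [u [u' [xe el j [uo _] [xoff rx]]]]] xl] := vmu _ xmu.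
  have sub : [set g | fp x.2 g \/ exists2 e : E, x.2.1 = Some e & set0 g] `<=` [set` l].
    by move=> g [[|/xl//]|[? _ []]]; rewrite xe => -[<-].
  split=> //=; split=> //=; apply: (reach_conn (x := o) (y := u')).
    by rewrite -uo; apply: conn_edge j; left; left.
  by apply: reach_mono rx => g xg; left; right.
apply: le_trans (Cap_ub 0 (okO_edge Uo) v); rewrite mass_extend lerD2l lerN2.
apply: (@le_trans _ _ (\sum_(g <- l) load mu g ^+ 2)); last exact: sum_load_sqr.
rewrite /energy /en mul0r addr0; apply: ler_sum => g _.
have l0 := load_ge0 g (valid_nonneg v).
have l1 := load_extend (fun=> set0) g mu0.
have e0 : fpath_load (fun=> set0) mu g = 0.
  by rewrite /fpath_load big1// => x _; rewrite indF ?mulr0// => -[].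
by rewrite e0 addr0 in l1; rewrite ler_sqr ?nnegrE// (le_trans l0).
Qed.

Lemma transient_bound_eq1 o : p = 1 -> many_exits -> transient_bound o.
Proof.
move=> pE [K K0 [r1 hK]] eps e0; pose r := maxn r1 1.
have r0 : (0 < r)%N by rewrite leq_max orbT.
have [n hn] := nat_above (K * r%:R + 1).
have Kr0 : 0 < K * r%:R by rewrite mulr_gt0// ltr0n.
have n0 : 0 < n%:R :> R by lra.
exists n, set0; split=> //; first by rewrite -(ltr0n R).
move=> U fU _ Uo; have rr1 : (r1 <= r)%N by exact: leq_maxl.
have [l [ul tl hl]] := hK _ rr1 U fU; exists l; split=> //.
rewrite /Pr Ex_one// indF; first exact: ltW.
move=> [_]; apply/negP; rewrite -leNgt; apply: le_trans (capA1_le_capO l r Uo).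
have := hl [set o]; rewrite Ex_one// => h.
have : (nb [set o])%:R / (K * r%:R) <= capA R l r U [set o] [set` l].
  by apply: h; [move=> v ->|exists o].
apply: le_trans; have -> : nb [set o] = 1%N by rewrite /nb fset_set1 cardfs1.
by rewrite mul1r lef_pV2 ?posrE ?Kr0 ?mulr_gt0//; lra.
Qed.

Lemma transient_bound_of_exits o : many_exits -> transient_bound o.
Proof.
have [p1'|p1'] := ltP p 1; first exact: transient_bound_lt1.
by apply: transient_bound_eq1; apply/eqP; rewrite eq_le p1 p1'.
Qed.

Hypotheses (cG : connected_graph G) (qt : quasi_transitive G) (na : nonamenable G R).

Lemma many_exits_of_links (delta : R) : 0 < delta ->
  (forall x y, exists2 F, uniq F & delta <= Pr p F (fun w => conn w x y)) -> many_exits.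
Proof.
move=> d0 hF; pose d := Num.min delta 1.
have dd0 : 0 < d by rewrite lt_min d0 ltr01.
have dd1 : d <= 1 by rewrite ge_min lexx orbT.
have hF' x y : exists2 F, uniq F & d <= Pr p F (fun w => conn w x y).
  by have [F uF h] := hF x y; exists F => //; apply: le_trans h; rewrite ge_min lexx.
have [K hK] := nat_above (16 / d); rewrite ler_pdivrMr// in hK.
have [k hk] := expansion hD D0 na K.
have [rho hrho] := uniform_links hD p0 p1 cG qt k hF'.
have [C C0 hC] := uniform_exit_bound hD D0 p0' p1 dd0 dd1 hK hk hrho.
exists C => //; exists 1%N => r r1 U fU; exact: hC.
Qed.

(** A fixed path from [x] to [o] is open with positive probability, so by the Harris inequality
    escapes from [o] are at most a constant times as likely as escapes from [x]. *)
Lemma transient_bound_of_decay x o :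
  (forall eps : R, 0 < eps -> exists U l, [/\ finite_set U, uniq l, touch U `<=` [set` l], U x &
    Pr p l (fun w => reach U w x) < eps]) -> transient_bound o.
Proof.
move=> hx eps e0; have [F [uF [m hm]]] := open_path p0 p1 cG x o.
have pm : 0 < p ^+ m by rewrite exprn_gt0.
have [U [l [fU ul tl Ux hl]]] := hx (eps * p ^+ m) (mulr_gt0 e0 pm).
exists 1%N, U; split=> // U' fU' UU' U'o.
have [l0 [ul0 _ hl0]] := enum_setP (finite_touch hD fU').
pose l' := undup (l0 ++ F); have ul' : uniq l' by exact: undup_uniq.
have tl' : touch U' `<=` [set` l'].
  by move=> e /hl0 el; rewrite /= mem_undup mem_cat el.
have Fl' : {subset F <= l'} by move=> e eF; rewrite mem_undup mem_cat eF orbT.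
exists l'; split=> //; have [pF cF] := hm l' ul' Fl'.
rewrite -(ler_pM2r pm); apply: le_trans (ltW hl).
have dep : depends (fun w => ind (reach U w x) : R) (touch U).
  move=> w w' ww'; apply: ind_eq.
  have ag (u v : set E) : u `&` touch U = v `&` touch U -> reach U u x -> reach U v x.
    move=> uv [z Uz c]; have [e [a [b [ue j Ua Ub cab]]]] := first_exit c Ux Uz.
    exists b => //; have tv g : u g -> touch U g -> v g.
      by move=> ug tg; have : (u `&` touch U) g by []; rewrite uv => -[].
    apply: (conn_step (y := a) _ _ j); last by apply: tv => //; exact: joins_touch j Ua.
    by apply: conn_mono cab => g [ug /inside_sub_touch]; exact: tv.
  by split; exact: ag.
have -> : Pr p l (fun w => reach U w x) = Pr p l' (fun w => reach U w x).
  apply: (Ex_depends_eq p dep ul ul') => e te.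
  by rewrite (tl e te); apply/esym; apply: tl'; exact: touch_sub UU' _ te.
apply: (@le_trans _ _ (Pr p l' (fun w => reach U' w o) * Pr p l' (fun w => [set` F] `<=` w))).
  apply: ler_pM => //; [exact: Pr_ge0|exact: ltW|].
  by apply: Pr_le => // w _ [].
apply: le_trans (harris_Pr p0' p1 _ _ _) _.
- by move=> w w'; exact: reach_mono.
- by move=> w w' ww' h; exact: subset_trans ww'.
apply: Pr_le => // w _ [[z Uz c] Fw]; exists z; first by move=> /UU'.
by apply: conn_trans c; exact: conn_mono cF.
Qed.

(** Connection probabilities are bounded below, or they are not but escape probabilities are, or
    escape probabilities decay at some vertex. The second case yields three ends, and the third is
    [transient_bound_of_decay]. *)
Lemma transient_bound_holds o : transient_bound o.
Proof.
have [[delta [d0 hd]]|hN] := pselect (exists delta : R, 0 < delta /\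
    forall x y, exists2 F, uniq F & delta <= Pr p F (fun w => conn w x y)).
  apply: transient_bound_of_exits; exact: many_exits_of_links hd.
have hN' delta : 0 < delta -> exists x y, forall F, uniq F -> Pr p F (fun w => conn w x y) < delta.
  move=> d0; apply: contrapT => h; apply: hN; exists delta; split=> // x y.
  apply: contrapT => h2; apply: h; exists x, y => F uF; rewrite ltNge; apply/negP => h3.
  by apply: h2; exists F.
have p1' : p < 1.
  rewrite lt_neqAle p1 andbT; apply/eqP => pE; apply: hN; exists 1; split=> // x y.
  have [F [uF [m hm]]] := open_path p0 p1 cG x y; exists F => //.
  have [h c] := hm F uF (fun _ => id); apply: (@le_trans _ _ (p ^+ m)); first by rewrite pE expr1n.
  by apply: (le_trans h); apply: Pr_le => // w _ Fw; exact: conn_mono c.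
pose Q x n := forall U l, finite_set U -> uniq l -> touch U `<=` [set` l] -> U x ->
  n.+1%:R^-1 <= Pr p l (fun w => reach U w x).
have [/(uniformly_in_vertices qt)[|fV fE x n af hQ U l fU ul tl Ux|n hQ]|decay] :=
    pselect (forall x, exists n, Q x n).
- move=> x n m nm h U l fU ul tl Ux; apply: le_trans (h U l fU ul tl Ux).
  by rewrite lef_pV2 ?posrE ?ltr0n// ler_nat.
- have [gV [gE [ag fgV gfV fgE gfE]]] := aut_inverse af.
  have fU' : finite_set (gV @` U) by exact: finite_image.
  have ul' : uniq (map gE l) by rewrite map_inj_uniq//; exact: can_inj gfE.
  have tl' : touch (gV @` U) `<=` [set` map gE l].
    move=> e te; apply/mapP; exists (fE e); last by rewrite fgE.
    by apply: tl; apply: (aut_touch af _ te) => _ [v Uv <-]; rewrite gfV.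
  have Ux' : (gV @` U) x by exists (fV x) => //; rewrite fgV.
  apply: le_trans (hQ _ _ fU' ul' tl' Ux') _; rewrite /Pr Ex_map; apply: Ex_le => // w _.
  apply: ind_le => -[z Uz c]; exists (fV z); first by move=> Uz'; apply: Uz; exists (fV z).
  have := aut_conn af c; suff -> : fE @` (gE @` w) = w by [].
  apply/seteqP; split=> e; first by move=> [_ [e' we <-] <-]; rewrite gfE.
  by move=> we; exists (gE e); [exists e|rewrite gfE].
- have t0 : 0 < n.+1%:R^-1 :> R by rewrite invr_gt0.
  have t1 : n.+1%:R^-1 <= 1 :> R by rewrite invf_le1// ler1n.
  have hreach U l x : finite_set U -> uniq l -> touch U `<=` [set` l] -> U x ->
    n.+1%:R^-1 <= Pr p l (fun w => reach U w x) by exact: hQ.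
  have [L hL] := three_ends_likely p0 p1 cG qt t0 t1 hreach hN'.
  have s0 : 0 < n.+1%:R^-1 ^+ 3 / 2 :> R by rewrite divr_gt0// exprn_gt0.
  have [K [r1 [K0 r10 hK]]] := three_ends_exit_bound hD D0 p0 p1' s0 hL.
  apply: transient_bound_of_exits; exists K => //; exists r1 => r rr U fU.
  have [l [ul _ hl]] := enum_setP (finite_touch hD fU).
  by exists l; split=> //; [move=> e /hl|apply: hK => // e /hl].
have [x hx] : exists x, forall n, ~ Q x n.
  apply: contrapT => h; apply: decay => x; apply: contrapT => h2; apply: h; exists x => n hn.
  by apply: h2; exists n.
apply: (@transient_bound_of_decay x) => eps e0.
have [n hn] := nat_above eps^-1.
have nQ := hx n; apply: contrapT => h; apply: nQ => U l fU ul tl Ux.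
rewrite leNgt; apply/negP => h2; apply: h; exists U, l; split=> //; apply: lt_le_trans h2 _.
have n1 : eps^-1 <= n.+1%:R by apply: le_trans hn _; rewrite ler_nat.
by rewrite -[leRHS]invrK lef_pV2 ?posrE ?invr_gt0.
Qed.
End TransientBound.

(** * Law of the percolation configuration *)

Section Cylinders.
Variables (R : realType) (G : multigraph) (p : R).
Variables (d : measure_display) (T : measurableType d) (P : probability T R).
Variable omega : T -> set (edge G).
Local Notation E := (edge G).
Hypothesis perc : bernoulli_percolation p P omega.

(** The hypothesis on [omega] prescribes only the probabilities that finite sets of edges are open.
    Such a set [F] is carried along: an edge of [l] either is open and joins [F], or is closed, and
    that part is obtained as a difference of two events. *)
Lemma cylinder (l : seq E) (F : {fset E}) (Q : set E -> Prop) :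
  uniq l -> (forall e, e \in l -> e \notin F) ->
  let S := [set t | (forall e, e \in F -> omega t e) /\ Q (omega t `&` [set` l])] in
  measurable S /\ P S = (p ^+ #|` F| * Pr p l Q)%:E.
Proof.
have [m1 m2 m3] := perc.
elim: l F Q => [|e l IH] F Q ul lF S.
  have SE : S = if `[< Q set0 >] then \bigcap_(e in [set` F]) [set t | omega t e] else set0.
    have e0 t : omega t `&` [set` [::]] = set0 by apply/seteqP; split=> // x [].
    apply/seteqP; split=> t; rewrite /S /= e0; case: asboolP => // h.
    - by move=> [hF _] x /= xF; exact: hF.
    - by case.
  rewrite /Pr /= SE /ind; case: asboolP => h; split.
  - by apply: fin_bigcap_measurable => //; exact: finite_fset.
  - rewrite mulr1; apply: (etrans (m3 F)).
    rewrite (eq_bigr (fun=> p%:E)) ?big_const_seq; last by move=> i _; rewrite m2.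
    rewrite count_predT; elim: (size _) => [|n IHn]; first by rewrite expr0.
    by rewrite iterS IHn exprS -EFinM.
  - exact: measurable0.
  - by rewrite mulr0 measure0.
have [eul ul'] : e \notin l /\ uniq l by move/andP: ul.
have eF : e \notin F by apply: lF; exact: mem_head.
have lF' x : x \in l -> x \notin F by move=> xl; apply: lF; rewrite inE xl orbT.
have leF x : x \in l -> x \notin (e |` F)%fset.
  by move=> xl; rewrite !inE negb_or lF'// andbT; apply: contraNneq eul => <-.
have [mA pA] := IH (e |` F)%fset (fun s => Q (e |` s)) ul' leF.
have [mB pB] := IH F Q ul' lF'.
have [mC pC] := IH (e |` F)%fset Q ul' leF.
set A := [set t | _] in mA pA; set B := [set t | _] in mB pB; set C := [set t | _] in mC pC.
have cardF : #|` (e |` F)%fset| = #|` F|.+1 by rewrite cardfsU1 eF.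
have CB : C `<=` B.
  by move=> t [h q]; split=> // x xF; apply: h; rewrite !inE xF orbT.
have CE : C = B `&` [set t | omega t e].
  apply/seteqP; split=> [t [h q]|t [[h q] oe]].
    by split; [apply: CB|apply: h; rewrite !inE eqxx].
  by split=> // x; rewrite !inE => /orP[/eqP ->|/h].
have SE : S = A `|` (B `\` C).
  apply/seteqP; split=> [t [h q]|t].
    have [oe|oe] := pselect (omega t e).
      left; split; first by move=> x; rewrite !inE => /orP[/eqP ->|/h].
      suff <- : omega t `&` [set` e :: l] = e |` (omega t `&` [set` l]) by [].
      apply/seteqP; split=> x /=; rewrite inE.
        by move=> [ox /orP[/eqP ->|xl]]; [left|right].
      by move=> [->|[ox ->]]; rewrite ?eqxx ?orbT.
    right; split; last by rewrite CE => -[_].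
    split=> //; suff <- : omega t `&` [set` e :: l] = omega t `&` [set` l] by [].
    apply/seteqP; split=> x /=; rewrite inE; last by move=> [ox ->]; rewrite orbT.
    by move=> [ox /orP[/eqP xe|xl]] //; case: oe; rewrite -xe.
  move=> [[h q]|[[h q] nC]].
    split; first by move=> x xF; apply: h; rewrite !inE xF orbT.
    suff -> : omega t `&` [set` e :: l] = e |` (omega t `&` [set` l]) by [].
    have oe : omega t e by apply: h; rewrite !inE eqxx.
    apply/seteqP; split=> x /=; rewrite inE.
      by move=> [ox /orP[/eqP ->|xl]]; [left|right].
    by move=> [->|[ox ->]]; rewrite ?eqxx ?orbT.
  have oe : ~ omega t e by move=> oe; apply: nC; rewrite CE.
  split=> //; suff -> : omega t `&` [set` e :: l] = omega t `&` [set` l] by [].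
  apply/seteqP; split=> x /=; rewrite inE; last by move=> [ox ->]; rewrite orbT.
  by move=> [ox /orP[/eqP xe|xl]] //; case: oe; rewrite -xe.
have mBC : measurable (B `\` C) by exact: measurableD.
split; first by rewrite SE; exact: measurableU.
have dj : A `&` (B `\` C) = set0.
  rewrite -subset0 => t [[h _] [[hB qB] nC]]; apply: nC; rewrite CE; split=> //.
  by apply: h; rewrite !inE eqxx.
rewrite SE measureU// measureD//; last exact: le_lt_trans (probability_le1 P mB) (ltry 1).
rewrite (_ : B `&` C = C); last by rewrite setIC; apply/setIidl.
rewrite cardF in pA pC.
transitivity ((p ^+ #|` F|.+1 * Pr p l (fun s => Q (e |` s)))%:E +
    ((p ^+ #|` F| * Pr p l Q)%:E - (p ^+ #|` F|.+1 * Pr p l Q)%:E))%E.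
  by congr (_ + (_ - _))%E.
by rewrite -EFinB -EFinD; congr EFin; rewrite /Pr /= exprS; ring.
Qed.

Lemma cylinder_law (l : seq E) (Q : set E -> Prop) : uniq l ->
  measurable [set t | Q (omega t `&` [set` l])] /\
  P [set t | Q (omega t `&` [set` l])] = (Pr p l Q)%:E.
Proof.
move=> ul; have [h1 h2] := cylinder (F := fset0) Q ul (fun _ _ => isT).
have e : [set t | (forall e, e \in fset0 -> omega t e) /\ Q (omega t `&` [set` l])] =
  [set t | Q (omega t `&` [set` l])].
  by apply/seteqP; split=> t /= => [[]|h]//; split.
by move: h1 h2; rewrite e cardfs0 expr0 mul1r.
Qed.
End Cylinders.

(** * Dirichlet energy and simple random walk *)

Lemma sum_subset (R : realType) (T : choiceType) (s l : seq T) (F : T -> R) :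
  uniq s -> uniq l -> {subset s <= l} -> (forall x, 0 <= F x) ->
  \sum_(x <- s) F x <= \sum_(x <- l) F x.
Proof.
move=> us ul sl F0; rewrite (perm_big [seq x <- l | x \in s]).
  rewrite big_filter big_mkcond; apply: ler_sum => x _.
  by case: ifP.
apply: uniq_perm => // [|x]; first exact: filter_uniq.
by rewrite mem_filter; case: (boolP (x \in s)) => //= /sl ->.
Qed.

Section Dirichlet.
Variables (R : realType) (G : multigraph).
Local Notation V := (vertex G).
Local Notation E := (edge G).
Implicit Types (f : V -> R) (l : seq E) (U : set V) (o : V).

Definition dirichlet l (w : set E) f : R :=
  \sum_(e <- l) ind (w e) * (f (ends e).1 - f (ends e).2) ^+ 2.

(** By the Dirichlet principle, the conductance between [o] and infinity vanishes. The energy over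
    all edges is expressed by its finite partial sums. *)
Definition recurrent_at (w : set E) o := forall c : R, 0 < c -> exists f U,
  [/\ finite_set U, forall x, f x != 0 -> U x, f o = 1 & forall l, uniq l -> dirichlet l w f < c].

Let grad f e : R := `|f (ends e).1 - f (ends e).2|.

Lemma grad_joins f e x y : joins e x y -> grad f e = `|f x - f y|.
Proof. by rewrite /grad; case=> ->; rewrite //= distrC. Qed.

Lemma conn_path (w : set E) x y : conn w x y -> exists q,
  [/\ path (fun a b => `[< exists2 e, w e & joins e a b >]) x q, uniq (x :: q) & last x q = y].
Proof.
move=> c; suff [q qp ql] : exists2 q,
    path (fun a b => `[< exists2 e, w e & joins e a b >]) x q & last x q = y.
  by case/shortenP: qp ql => q' p' u' _ l'; exists q'.
apply: (@conn_ind _ _ (fun y => exists2 q,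
  path (fun a b => `[< exists2 e, w e & joins e a b >]) x q & last x q = y) _ _ _ c).
  move=> z z' e [q qp ql] we j; exists (rcons q z'); last by rewrite last_rcons.
  by rewrite rcons_path qp ql; apply/asboolP; exists e.
by exists [::].
Qed.

(** The connection is first shortened to a path without repeated vertices, so that no edge is
    counted twice. *)
Lemma gradient_path (w : set E) f l x y : uniq l -> w `<=` [set` l] -> conn w x y ->
  f x - f y <= \sum_(e <- l) ind (w e) * grad f e.
Proof.
move=> ul wl /conn_path[q [qp qu <-]].
have [s [us sw hs]] : exists s, [/\ uniq s,
    forall e, e \in s -> w e /\ exists a b, [/\ joins e a b, a \in x :: q & b \in x :: q] &
    f x - f (last x q) <= \sum_(e <- s) grad f e].
  elim: q x qp qu => [|z q IH] x; first by exists [::]; rewrite big_nil subrr.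
  move=> /= /andP[/asboolP[e we j] qp] /andP[xzq qu].
  have [s [us sw hs]] := IH z qp qu; exists (e :: s); split.
  - rewrite /= us andbT; apply/negP => /sw[_ [a [b [j' az bz]]]].
    by case: (joins_uniq j j') => -[xa _]; rewrite xa ?az ?bz in xzq.
  - move=> e'; rewrite inE => /orP[/eqP ->|/sw[we' [a [b [j' az bz]]]]].
      by split=> //; exists x, z; rewrite !inE !eqxx orbT; split.
    by split=> //; exists a, b; rewrite inE az orbT inE bz orbT; split.
  - rewrite big_cons (grad_joins f j).
    by have := ler_norm (f x - f z); move: hs; rewrite /=; lra.
apply: le_trans hs _.
have g0 e : 0 <= ind (w e) * grad f e by rewrite mulr_ge0 ?ind_ge0// /grad.
rewrite (eq_big_seq (fun e => ind (w e) * grad f e)); last first.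
  by move=> e /sw[we _]; rewrite indT// mul1r.
by apply: sum_subset => // e /sw[/wl].
Qed.

(** Weak duality. Along a route [f] falls from 1 to 0, so the mass is at most the sum of load times
    gradient over open edges, and [2 a b <= a ^ 2 + b ^ 2]. *)
Lemma capO_dirichlet l U o (w : set E) f : uniq l -> U o -> (forall x, f x != 0 -> U x) -> f o = 1 ->
  capO R l U o w <= dirichlet l w f.
Proof.
move=> ul Uo fU fo; apply: Cap_le => [|mu vmu]; first exact: okO_edge.
have mu0 := valid_nonneg vmu.
have h : mass mu <= \sum_(e <- l) load mu e * (ind (w e) * grad f e).
  rewrite /load; under eq_bigr do rewrite mulr_suml.
  rewrite exchange_big /mass; apply: ler_sum_seq => x xmu.
  have [x0 [x1 [z Uz c] xl] xw] := vmu _ xmu.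
  have fz : f z = 0 by apply/eqP; apply: contraPT Uz => /fU Uz; apply.
  have := gradient_path f ul xl c; rewrite fo fz subr0 => h.
  under eq_bigr do rewrite -mulrA.
  rewrite -mulr_sumr -[leLHS]mulr1; apply: ler_wpM2l => //; apply: le_trans h _.
  apply: ler_sum => e _; rewrite mulrA -ind_and; apply: ler_wpM2r; first exact: normr_ge0.
  by apply: ind_le => xe; split; [right|exact: xw].
have h2 : 2 * mass mu <= \sum_(e <- l) (load mu e ^+ 2 + ind (w e) * grad f e ^+ 2).
  apply: (le_trans (ler_wpM2l _ h)) => //; rewrite mulr_sumr; apply: ler_sum => e _.
  have i2 : ind (w e) * ind (w e) = ind (w e) :> R by rewrite -ind_and; apply: ind_eq; split => [[]|].
  have : 0 <= (load mu e - ind (w e) * grad f e) ^+ 2 by exact: sqr_ge0.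
  rewrite sqrrB exprMn expr2 [ind _ ^+ 2]expr2 i2 mulr2n expr2; lra.
rewrite /energy /en mul0r addr0 lerBlDl; apply: le_trans h2 _.
rewrite big_split /= lerD2l; apply: ler_sum => e _.
by rewrite /grad real_normK ?num_real.
Qed.
End Dirichlet.

(** * Hitting probabilities as test functions of small energy *)

Section Hitting.
Variables (R : realType) (G : multigraph).
Local Notation V := (vertex G).
Local Notation E := (edge G).
Hypothesis lf : locally_finite_graph G.
Variables (w : set E) (o : V).
Implicit Types (f : V -> R) (l : seq E) (x y : V) (a : dart G).

Definition darts_at x : seq (dart G) := enum_fset (fset_set (darts_from w x)).

Lemma mem_darts_at x a : (a \in darts_at x) <-> w a.1 /\ dart_tail a = x.
Proof.
have fin : finite_set (darts_from w x) by apply: sub_finite_set (lf x) => b [].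
by rewrite /darts_at in_fset_set// inE.
Qed.

Lemma uniq_darts_at x : uniq (darts_at x).
Proof. exact: fset_uniq. Qed.

Lemma joins_dart a : joins a.1 (dart_tail a) (dart_head a).
Proof.
rewrite /dart_tail /dart_head; case: a => e [] /=; last exact: joins_ends.
exact: joins_sym (joins_ends e).
Qed.

Definition average f x : R := (\sum_(a <- darts_at x) f (dart_head a)) / (degree w x)%:R.

Lemma degreeE x : degree w x = size (darts_at x). Proof. by []. Qed.

Lemma average_ge0 f x : (forall y, 0 <= f y) -> 0 <= average f x.
Proof. by move=> f0; rewrite divr_ge0// sumr_ge0. Qed.

Lemma average_le f f' x : (forall y, f y <= f' y) -> average f x <= average f' x.
Proof.
by move=> ff; apply: ler_wpM2r; [rewrite invr_ge0|apply: ler_sum => a _; exact: ff].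
Qed.

Lemma average_degree f x : average f x * (degree w x)%:R = \sum_(a <- darts_at x) f (dart_head a).
Proof.
rewrite /average; have [d0|d0] := eqVneq (degree w x) 0%N; last by rewrite divfK// pnatr_eq0.
by move: d0; rewrite degreeE => /size0nil ->; rewrite !big_nil mul0r mul0r.
Qed.

Lemma average1 x : (0 < degree w x)%N -> average (fun=> 1) x = 1.
Proof.
move=> d0; rewrite /average big_const_seq count_predT iter_addr_0 -degreeE divff//.
by rewrite pnatr_eq0 -lt0n.
Qed.

(* The probability that simple random walk started from [x] visits [o] by time [n]. *)
Fixpoint hit (n : nat) x : R :=
  if n is m.+1 then if x == o then 1 else average (hit m) x else ind (x = o).

Lemma hit_o n : hit n o = 1.
Proof. by case: n => [|n] /=; rewrite ?eqxx// indT. Qed.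

Lemma hit_ge0 n x : 0 <= hit n x.
Proof.
elim: n x => [|n IH] x /=; first exact: ind_ge0.
by case: ifP => // _; exact: average_ge0.
Qed.

Lemma hit_mono n x : hit n x <= hit n.+1 x.
Proof.
elim: n x => [|n IH] x.
  rewrite /=; case: eqP => h; first by rewrite indT.
  by rewrite indF// average_ge0// => y; exact: ind_ge0.
by rewrite /=; case: ifP => // _; exact: average_le.
Qed.

Lemma hit_supp n x : hit n x != 0 -> ball setT o n x.
Proof.
elim: n x => [|n IH] x /=.
  by have [->|h] := pselect (x = o); [move=> _; exact: ball_center|rewrite indF// eqxx].
have [-> _|xo h] := eqVneq x o; first exact: ball_center.
 have [a [ad ha]] : exists a, a \in darts_at x /\ hit n (dart_head a) != 0.
  apply: contrapT => none; move/eqP: h; apply.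
  rewrite /average big_seq big1 ?mul0r// => a ad; apply/eqP; apply: contraT => ha.
  by case: none; exists a.
have [we <-] := (mem_darts_at x a).1 ad.
exact: (ball_S (IH _ ha) Logic.I (joins_sym (joins_dart a))).
Qed.

Variable D : nat.
Hypothesis hD : hasdeg G D.

(** Summation by parts groups the energy at the vertices. At [x] other than [o], [hit n x] is at
    most [hit n.+1 x], the average of [hit n] over the neighbours, so the contribution is
    nonpositive; only the darts at [o] remain. *)
Lemma dirichlet_hit n l : uniq l ->
  dirichlet l w (hit n) <= \sum_(a <- darts_at o) (1 - hit n (dart_head a)).
Proof.
move=> ul; set h := hit n.
have [fB _] := ball_card hD setT o n.
have [q [uq _ qB]] := enum_setP fB.
have [lB [ulB _ hlB]] := enum_setP (finite_touch hD fB).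
(* Adding all edges that touch the support makes every dart issued from it available, so the sum can
   be grouped by tails. *)
pose l' := undup (l ++ lB); have ul' : uniq l' by exact: undup_uniq.
have term0 e : 0 <= ind (w e) * (h (ends e).1 - h (ends e).2) ^+ 2 by rewrite mulr_ge0 ?ind_ge0 ?sqr_ge0.
apply: (@le_trans _ _ (dirichlet l' w h)).
  by apply: sum_subset => // e el; rewrite mem_undup mem_cat el.
pose phi a : R := h (dart_tail a) * (h (dart_tail a) - h (dart_head a)).
pose darts : seq (dart G) := [seq (e, b) | e <- l', b <- [:: false; true]].
have udarts : uniq darts by apply: allpairs_uniq => // -[? ?] [? ?].
have mem_d a : (a \in darts) = (a.1 \in l').
  case: a => e b; apply/allpairsP/idP => [[[e' b'] /= [el _ [-> _]]]//|el].
  by exists (e, b); split=> //; case: (b).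
have -> : dirichlet l' w h = \sum_(a <- darts) ind (w a.1) * phi a.
  rewrite /darts big_allpairs_dep /dirichlet; apply: eq_bigr => e _.
  by rewrite !big_cons big_nil /phi /dart_tail /dart_head /=; ring.
have phi0 a : ~ ball setT o n (dart_tail a) -> phi a = 0.
  move=> nb; rewrite /phi (_ : h _ = 0) ?mul0r//; apply/eqP; apply: contraPT nb => h0.
  by move=> nb; apply: nb; exact: hit_supp h0.
have -> : \sum_(a <- darts) ind (w a.1) * phi a =
    \sum_(x <- q) \sum_(a <- darts_at x) phi a.
  rewrite [RHS](eq_big_seq (fun x => \sum_(a <- darts) ind (dart_tail a = x) * (ind (w a.1) * phi a))).
    rewrite exchange_big /=; apply: eq_bigr => a _; rewrite -mulr_suml.
    have [bt|bt] := pselect (ball setT o n (dart_tail a)); last by rewrite phi0// !mulr0.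
    rewrite (bigD1_seq (dart_tail a)) ?uq//=; last exact/qB.
    rewrite (indT R (erefl (dart_tail a))) big1 ?addr0 ?mul1r// => x xt.
    by rewrite indF// => e; rewrite e eqxx in xt.
  move=> x xq; rewrite (perm_big [seq a <- darts | `[< dart_tail a = x /\ w a.1 >]]).
    rewrite big_filter big_mkcond /=; apply: eq_bigr => a _.
    case: asboolP => [[h1 h2]|nh]; first by rewrite (indT R h1) (indT R h2) !mul1r.
    have [h1|h1] := pselect (dart_tail a = x); last by rewrite indF// mul0r.
    by rewrite (indF _ (P := w a.1)) ?mul0r ?mulr0// => h2; apply: nh.
  apply: uniq_perm; [exact: uniq_darts_at|exact: filter_uniq|move=> a].
  rewrite mem_filter mem_d; apply/idP/idP.
    move=> /(mem_darts_at x a)[wa ta]; apply/andP; split; first exact/asboolP.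
    rewrite mem_undup mem_cat; apply/orP; right; apply/hlB.
    by apply: (joins_touch (joins_dart a)); rewrite ta; exact/qB.
  by move=> /andP[/asboolP[ta wa] _]; apply/(mem_darts_at x a).
have oq : o \in q by apply/qB; exact: ball_center.
rewrite (bigD1_seq o)//= -[leRHS]addr0; apply: lerD.
  rewrite big_seq [leRHS]big_seq le_eqVlt; apply/orP; left; apply/eqP.
  apply: eq_bigr => a /(mem_darts_at o a)[_ ta].
  by rewrite /phi ta /h hit_o mul1r.
rewrite big_seq_cond; apply: sumr_le0 => x /andP[_ xo].
rewrite (eq_big_seq (fun a => h x * (h x - h (dart_head a)))); last first.
  by move=> a /(mem_darts_at x a)[_ ta]; rewrite /phi ta.
rewrite -mulr_sumr; apply: mulr_ge0_le0; first exact: hit_ge0.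
rewrite sumrB big_const_seq count_predT iter_addr_0 -degreeE -average_degree subr_le0.
rewrite -[h x *+ _]mulr_natr; apply: ler_wpM2r => //.
by have := hit_mono n x; rewrite /= (negbTE xo).
Qed.

(** The functions [hit n] are finitely supported and equal 1 at [o], hence are competitors in
    [recurrent_at]. *)
Lemma escape_of_transience : ~ recurrent_at R w o -> exists2 c : R, 0 < c &
  forall n, c <= \sum_(a <- darts_at o) (1 - hit n (dart_head a)).
Proof.
move=> /existsNP[c /not_implyP[c0 nf]]; exists c => // n.
rewrite leNgt; apply/negP => lt; apply: nf; exists (hit n), (ball setT o n); split.
- by have [] := ball_card hD setT o n.
- exact: hit_supp.
- exact: hit_o.
- by move=> l ul; apply: le_lt_trans lt; exact: dirichlet_hit.
Qed.

Definition neighbours x : seq V := undup (map (@dart_head G) (darts_at x)).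

Lemma average_step f x : average f x = \sum_(y <- neighbours x) srw_step R w x y * f y.
Proof.
have cnt y : #|` fset_set (darts_between w x y)| = count (fun a => dart_head a == y) (darts_at x).
  have fin : finite_set (darts_between w x y).
    by apply: sub_finite_set (lf x) => a [? ? ?].
  rewrite -size_filter; apply/eqP; rewrite eqn_leq; apply/andP; split.
    apply: uniq_leq_size; first exact: fset_uniq.
    move=> a; rewrite in_fset_set// inE => -[wa ta ha]; rewrite mem_filter ha eqxx.
    exact/(mem_darts_at x a).
  apply: uniq_leq_size; first by apply: filter_uniq; exact: uniq_darts_at.
  move=> a; rewrite mem_filter => /andP[/eqP ha /(mem_darts_at x a)[wa ta]].
  by rewrite in_fset_set// inE.
rewrite /average mulr_suml (eq_big_seq (fun a => \sum_(y <- neighbours x)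
    ind (dart_head a = y) * (f y / (degree w x)%:R))).
  rewrite exchange_big /=; apply: eq_bigr => y _; rewrite -mulr_suml sum_ind_count /srw_step cnt.
  rewrite mulrA mulrAC; congr (_%:R / _ * _); apply: eq_count => a.
  by apply/asboolP/eqP.
move=> a ad; rewrite (bigD1_seq (dart_head a)) ?undup_uniq//=; last by rewrite mem_undup map_f.
rewrite indT// mul1r big1 ?addr0// => y yh; rewrite indF ?mul0r// => e.
by rewrite e eqxx in yh.
Qed.

Lemma neighbours_degree x y : y \in neighbours x -> (0 < degree w y)%N.
Proof.
rewrite mem_undup => /mapP[a /(mem_darts_at x a)[wa ta] ->].
rewrite degreeE -has_predT; apply/hasP; exists (a.1, ~~ a.2) => //.
by apply/(mem_darts_at (dart_head a)); split=> //; case: a {wa ta} => e [].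
Qed.
End Hitting.

(** * From hitting probabilities to the return probability *)

Section Returns.
Variables (R : realType) (G : multigraph).
Local Notation V := (vertex G).
Local Notation E := (edge G).
Hypothesis lf : locally_finite_graph G.
Variables (w : set E) (o : V).
Variables (d : measure_display) (T : measurableType d) (Q : probability T R) (X : nat -> T -> V).
Hypothesis srw : is_srw w o Q X.
Implicit Types (z : nat -> V) (S : set T).

Let mX n y : measurable (X n @^-1` [set y]). Proof. by case: srw. Qed.

Definition prefix_event k z : set T := [set t | forall i, (i <= k)%N -> X i t = z i].
Definition avoiding k n : set T := [set t | forall i, (k < i)%N -> (i <= k + n)%N -> X i t <> o].

Lemma measurable_prefix k z : measurable (prefix_event k z).
Proof.
rewrite (_ : prefix_event k z = \bigcap_(i in [set i | (i <= k)%N]) (X i @^-1` [set z i])).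
  apply: bigcap_measurable => [|i _]; last exact: mX.
  by exists 0%N.
by apply/seteqP; split=> t h i hi; exact: h.
Qed.

Lemma measurable_avoiding k n : measurable (avoiding k n).
Proof.
rewrite (_ : avoiding k n = \bigcap_i (if (k < i <= k + n)%N then ~` (X i @^-1` [set o]) else setT)).
  apply: bigcapT_measurable => i; case: ifP => _; last exact: measurableT.
  exact: measurableC.
apply/seteqP; split=> t h i.
  by move=> _; case: ifP => // /andP[h1 h2]; exact: h.
by move=> h1 h2; have := h i Logic.I; rewrite h1 h2.
Qed.

Lemma sum_fibres S n (r : seq V) : measurable S -> uniq r ->
  (\sum_(y <- r) Q (S `&` X n @^-1` [set y]) <= Q S)%E.
Proof.
elim: r S => [|y r IH] S mS; first by move=> _; rewrite big_nil measure_ge0.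
move=> /= /andP[yr ur]; rewrite big_cons.
have mSD : measurable (S `\` X n @^-1` [set y]) by apply: measurableD.
rewrite [leRHS](measureDI Q mS (mX n y)) addeC; apply: leeD => //.
apply: le_trans (IH _ mSD ur); rewrite big_seq [leRHS]big_seq.
apply: lee_sum => y' y'r; rewrite le_measure ?inE//.
- by apply: measurableI.
- by apply: measurableI.
move=> t [St Xt]; split=> //; split=> // Xy.
by move: yr; rewrite -[y]Xy [X n t]Xt y'r.
Qed.

Let prob z k : R := (z 0%N == o)%:R * \prod_(i < k) srw_step R w (z i) (z i.+1).
(** Probability that the walk, being at [y], avoids [o] during its next [n] steps. *)
Let stay n y : R := if n is m.+1 then 1 - average w (hit R w o m) y else 1.

(** Only finite-dimensional laws are given, so the Markov property is replaced by an induction that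
    lengthens the prefix by one step and sums over the neighbours. As an inequality, it requires no
    more than disjointness of the fibres. *)
Lemma Q_avoiding n k z : (0 < degree w (z k))%N ->
  ((prob z k * stay n (z k))%:E <= Q (prefix_event k z `&` avoiding k n))%E.
Proof.
elim: n k z => [|n IH] k z dz.
  have -> : prefix_event k z `&` avoiding k 0 = prefix_event k z.
    by apply/setIidl => t _ i h1; rewrite addn0 leqNgt h1.
  by have [_ ->] := srw; rewrite mulr1.
set S := _ `&` _; have mS : measurable S.
  by apply: measurableI; [exact: measurable_prefix|exact: measurable_avoiding].
have pz0 : 0 <= prob z k.
  by rewrite mulr_ge0// prodr_ge0// => i _; rewrite divr_ge0.
apply: le_trans (sum_fibres k.+1 mS (undup_uniq (map (@dart_head G) (darts_at w (z k))))).
have -> : prob z k * stay n.+1 (z k) =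
    \sum_(y <- neighbours w (z k)) prob z k * srw_step R w (z k) y * (1 - hit R w o n y).
  under eq_bigr do rewrite -mulrA.
  rewrite -mulr_sumr; congr (_ * _); under eq_bigr do rewrite mulrBr mulr1.
  rewrite sumrB -(average_step lf) /=; congr (_ - _).
  rewrite -[LHS](average1 R dz) (average_step lf); apply: eq_bigr => y _.
  by rewrite mulr1.
rewrite -sumEFin big_seq [leRHS]big_seq; apply: lee_sum => y yN.
have [->|yo] := eqVneq y o; first by rewrite hit_o subrr mulr0 measure_ge0.
pose z' i := if i == k.+1 then y else z i.
have z'k i : (i <= k)%N -> z' i = z i by move=> ik; rewrite /z' ltn_eqF.
have z'y : z' k.+1 = y by rewrite /z' eqxx.
have dy : (0 < degree w (z' k.+1))%N by rewrite z'y; exact: (neighbours_degree lf yN).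
have -> : prob z k * srw_step R w (z k) y * (1 - hit R w o n y) = prob z' k.+1 * stay n (z' k.+1).
  rewrite z'y; congr (_ * _).
    rewrite /prob big_ord_recr /= mulrA z'y !z'k//; congr (_ * _ * _).
    by apply: eq_bigr => i _; rewrite !z'k//; exact: ltnW.
  by case: n {IH mS S} => [|n] /=; [rewrite indF ?subr0//; exact/eqP|rewrite (negbTE yo)].
apply: le_trans (IH k.+1 z' dy) _; rewrite le_measure ?inE//.
- by apply: measurableI; [exact: measurable_prefix|exact: measurable_avoiding].
- exact: measurableI.
move=> t [h1 h2]; split; last by rewrite /= h1// z'y.
split=> i hi; first by rewrite h1 ?z'k// leqW.
move=> hi2; move: hi; rewrite leq_eqVlt => /orP[/eqP <-|hi].
  by rewrite h1// z'y; exact/eqP.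
by apply: h2 => //; rewrite addSnnS.
Qed.

(** The probability of no return up to a given time is at least [c] divided by the degree, whatever
    the time. Continuity from below extends this to all times. *)
Lemma return_lt1 : (0 < degree w o)%N -> (exists2 c : R, 0 < c &
    forall n, c <= \sum_(a <- darts_at w o) (1 - hit R w o n (dart_head a))) ->
  (Q [set t | exists2 n, (0 < n)%N & X n t = o] < 1)%E.
Proof.
move=> d0 [c c0 hc]; have d0' : 0 < (degree w o)%:R :> R by rewrite ltr0n.
pose F n := ~` avoiding 0 n.+1.
have mF n : measurable (F n) by apply: measurableC; exact: measurable_avoiding.
have FE : [set t | exists2 n, (0 < n)%N & X n t = o] = \bigcup_n F n.
  apply/seteqP; split=> t [n hn].
    by move=> Xn; exists n => // h; apply: (h n) => //; rewrite add0n.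
  move=> /existsNP[i /not_implyP[i0 /not_implyP[_ /contrapT Xi]]]; by exists i.
have QF n : (Q (F n) <= (1 - c / (degree w o)%:R)%:E)%E.
  rewrite /F probability_setC; last exact: measurable_avoiding.
  rewrite EFinB; apply: leeB => //.
  have := @Q_avoiding n.+1 0 (fun=> o) d0; rewrite /prob eqxx big_ord0 !mul1r => h.
  apply: le_trans (le_trans h _); last first.
    apply: le_measure; rewrite ?inE; last exact: subIsetr; last exact: measurable_avoiding.
    by apply: measurableI; [exact: measurable_prefix|exact: measurable_avoiding].
  rewrite lee_fin /stay ler_pdivrMr// mulrBl mul1r average_degree.
  apply: le_trans (hc n) _; rewrite sumrB big_const_seq count_predT iter_addr_0.
  by rewrite -degreeE.
have ndF : nondecreasing_seq F.
  move=> n m nm; rewrite subsetEset => t; apply: contra_not => h i i0 im.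
  by apply: h => //; apply: leq_trans im _; rewrite !add0n ltnS.
have mU : measurable (\bigcup_n F n) by exact: bigcupT_measurable.
have cvgF := nondecreasing_cvg_mu (mu := Q) mF mU ndF.
rewrite FE; apply: (@le_lt_trans _ _ (1 - c / (degree w o)%:R)%:E); last first.
  by rewrite lte_fin ltrBlDr ltrDl divr_gt0.
rewrite -(cvg_lim _ cvgF)//; apply: lime_le; first by apply/cvg_ex; eexists; exact: cvgF.
by apply: nearW => n; exact: QF.
Qed.
End Returns.

(** * Null sets *)

Section NullSets.
Variables (R : realType) (G : multigraph) (p : R).
Variables (d : measure_display) (T : measurableType d) (P : probability T R).
Variable omega : T -> set (edge G).
Local Notation V := (vertex G).
Local Notation E := (edge G).
Hypothesis perc : bernoulli_percolation p P omega.
Implicit Types (o x : V) (U : set V) (l : seq E).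

Lemma negligible_of_small (N : set T) :
  (forall eps : R, 0 < eps -> exists M, [/\ measurable M, N `<=` M & (P M <= eps%:E)%E]) ->
  P.-negligible N.
Proof.
move=> h; have /choice[M hM] : forall k : nat, exists M, [/\ measurable M, N `<=` M &
    (P M <= (k.+1%:R^-1)%:E)%E] by move=> k; apply: h.
exists (\bigcap_k M k); split.
- by apply: bigcapT_measurable => k; have [] := hM k.
- apply/eqP; rewrite eq_le measure_ge0 andbT; apply/lee_addgt0Pr => eps e0.
  have [k hk] := nat_above eps^-1; have [mk Nk Pk] := hM k.
  rewrite add0e; apply: (@le_trans _ _ (P (M k))).
    apply: le_measure; rewrite ?inE//; last by move=> t; apply.
    by apply: bigcapT_measurable => i; have [] := hM i.
  apply: le_trans Pk _; rewrite lee_fin -[leRHS]invrK lef_pV2 ?posrE ?invr_gt0//.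
  by apply: le_trans hk _; rewrite ler_nat.
- by move=> t Nt k _; have [_ h2 _] := hM k; exact: h2.
Qed.

Lemma transient_bound0 D o : hasdeg G D -> p = 0 -> transient_bound p o.
Proof.
move=> hD p0 eps e0; exists 1%N, set0; split=> // U fU _ Uo.
have [l [ul _ hl]] := enum_setP (finite_touch hD fU).
exists l; split=> //; first by move=> e /hl.
have E0 f : Ex p l f = f set0.
  rewrite p0; elim: (l) f => [//|e l' IH] f /=.
  by rewrite mul0r add0r subr0 mul1r IH.
rewrite /Pr E0 indF; first exact: ltW.
by move=> [[z Uz c] _]; have [e [? [? [] []]]] := first_exit c Uo Uz.
Qed.

Lemma infinite_cluster_escapes (w : set E) U l o : finite_set U -> touch U `<=` [set` l] -> U o ->
  infinite_set (cluster_of w o) -> reach U (w `&` [set` l]) o.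
Proof.
move=> fU tl Uo iC.
have [z [cz Uz]] : exists z, conn w o z /\ ~ U z.
  apply: contrapT => h; apply: iC; apply: sub_finite_set fU => z cz.
  by apply: contrapT => Uz; apply: h; exists z.
have [e [u [u' [we j Uu Uu' c]]]] := first_exit cz Uo Uz.
exists u' => //; apply: (conn_step (y := u) _ _ j).
  by apply: conn_mono c => g [wg /inside_sub_touch/tl].
by split=> //; apply: tl; exact: joins_touch j Uu.
Qed.

(** If the cluster of [o] is infinite and recurrent, a test function of energy below [1 / (16 r)] is
    supported in [U n] for all large [n], so the events [A n] occur from some index on. Each has
    probability at most [eps], hence so has their lower limit. *)
Lemma recurrent_negligible D o : hasdeg G D -> connected_graph G -> transient_bound p o ->
  P.-negligible [set t | infinite_set (cluster_of (omega t) o) /\ recurrent_at R (omega t) o].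
Proof.
move=> hD cG tb; apply: negligible_of_small => eps e0.
have [r [U0 [r0 fU0 hU]]] := tb eps e0.
pose U n := U0 `|` ball setT o n.
have fU n : finite_set (U n).
  by rewrite /U finite_setU; split=> //; have [] := ball_card hD setT o n.
have Uo n : U n o by right; exact: ball_center.
have /choice[l hl] : forall n, exists l, [/\ uniq l, touch (U n) `<=` [set` l] &
    Pr p l (fun w => reach (U n) w o /\ capO R l (U n) o w < (16 * r%:R)^-1) <= eps].
  by move=> n; apply: hU => //; exact: subsetUl.
pose A n := [set t | reach (U n) (omega t `&` [set` l n]) o /\
  capO R (l n) (U n) o (omega t `&` [set` l n]) < (16 * r%:R)^-1].
have hA n : measurable (A n) /\ (P (A n) <= eps%:E)%E.
  have [ul _ hn] := hl n.
  have [mA PA] := cylinder_law perc (fun w => reach (U n) w o /\ capO R (l n) (U n) o w < (16 * r%:R)^-1) ul.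
  by split=> //; rewrite PA lee_fin.
pose F m := \bigcap_(n in [set n | (m <= n)%N]) A n.
have mF m : measurable (F m).
  by apply: bigcap_measurable => [|n _]; [exists m => /=|have [] := hA n].
have PF m : (P (F m) <= eps%:E)%E.
  have [mA PA] := hA m; apply: le_trans PA; apply: le_measure; rewrite ?inE//.
  by move=> t h; apply: h => /=.
have ndF : nondecreasing_seq F.
  by move=> n m nm; rewrite subsetEset => t h k /= mk; apply: h => /=; exact: leq_trans mk.
have mU : measurable (\bigcup_m F m) by exact: bigcupT_measurable.
exists (\bigcup_m F m); split=> //; last first.
  have cvgF := nondecreasing_cvg_mu (mu := P) mF mU ndF.
  rewrite -(cvg_lim _ cvgF)//; apply: lime_le; first by apply/cvg_ex; eexists; exact: cvgF.
  by apply: nearW => n; exact: PF.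
move=> t [iC rec]; have c0 : 0 < (16 * r%:R)^-1 :> R by rewrite invr_gt0 mulr_gt0 ?ltr0n.
have [f [S [fS Sf fo hf]]] := rec _ c0.
have [s [_ _ hs]] := enum_setP fS.
have [m hm] := vertices_in_ball cG s o.
exists m => // n /= mn; have [ul tl _] := hl n; split; first exact: infinite_cluster_escapes.
have fUn x : f x != 0 -> U n x.
  by move=> /Sf/hs/hm bx; right; exact: (ball_le mn).
apply: le_lt_trans (hf _ ul); apply: (le_trans (capO_dirichlet _ ul (Uo n) fUn fo)).
apply: ler_sum => e _; apply: ler_wpM2r; first exact: sqr_ge0.
by apply: ind_le => -[].
Qed.

Lemma infinite_cluster_degree (w : set E) o : locally_finite_graph G ->
  infinite_set (cluster_of w o) -> (0 < degree w o)%N.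
Proof.
move=> lf iC; have [z [cz zo]] : exists z, conn w o z /\ ~ [set o] z.
  apply: contrapT => h; apply: iC; apply: (sub_finite_set _ (finite_set1 o)) => z cz.
  by apply: contrapT => Uz; apply: h; exists z.
have [e [u [u' [we j uo _ _]]]] := first_exit cz (erefl o) zo.
rewrite degreeE -has_predT; rewrite uo in j.
case: j => je; apply/hasP.
  by exists (e, false) => //; apply/(mem_darts_at lf); rewrite /dart_tail /= je.
by exists (e, true) => //; apply/(mem_darts_at lf); rewrite /dart_tail /= je.
Qed.
End NullSets.

(** * Almost sure transience of all infinite clusters *)

Theorem theorem1p5 (R : realType) (G : multigraph) (p : R)
  (d : measure_display) (T : measurableType d) (P : probability T R)
  (omega : T -> set (edge G)) :
  connected_graph G -> locally_finite_graph G -> infinite_graph G ->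
  quasi_transitive G -> nonamenable G R ->
  0 <= p <= 1 ->
  bernoulli_percolation p P omega ->
  {ae P, forall t, forall C : set (vertex G),
     is_cluster (omega t) C -> infinite_set C ->
     transient_cluster R (omega t) C}.
Proof.
move=> cG lf iG qt na /andP[p0 p1] perc.
have [D D0 hD] := degree_bound qt lf.
have tb (o : vertex G) : transient_bound p o.
  have [p00|p00] := eqVneq p 0; first exact: (transient_bound0 _ hD p00).
  by apply: (transient_bound_holds hD D0 _ p1 cG qt na); rewrite lt_neqAle eq_sym p00.
pose N (o : vertex G) := [set t | infinite_set (cluster_of (omega t) o) /\ recurrent_at R (omega t) o].
have nN o : P.-negligible (N o) by exact: (recurrent_negligible perc hD cG (tb o)).
have [v0 _] : exists v : vertex G, True.
  by apply: contrapT => h; apply: iG; rewrite (_ : setT = set0)// -subset0 => v; case: h; exists v.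
(* The vertex set is a countable union of finite balls, so the null sets of all vertices have a null
   union. *)
have /choice[s hs] : forall n, exists s : seq (vertex G), forall y, ball setT v0 n y -> y \in s.
  move=> n; have [fB _] := ball_card hD setT v0 n.
  by have [s [_ _ h]] := enum_setP fB; exists s => y /h.
apply: (@negligibleS _ _ _ _ (\bigcup_n \bigcup_m N (nth v0 (s n) m))); last first.
  by apply: negligible_bigcup => n; apply: negligible_bigcup => m; exact: nN.
move=> t /existsNP[C /not_implyP[[x0 CE] /not_implyP[iC /existsNP[x /not_implyP[Cx nt]]]]].
rewrite {}CE in iC Cx.
have iCx : infinite_set (cluster_of (omega t) x).
  apply: contra_not iC; apply: sub_finite_set => y cy.
  by apply: conn_trans cy; exact: conn_sym.
have Nx : N x t.
  split=> //; apply: contrapT => nrec; apply: nt => d' T' Q X srw.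
  apply: (return_lt1 lf srw (infinite_cluster_degree lf iCx)).
  exact: (escape_of_transience lf hD nrec).
have [n bn] := conn_ball (cG v0 x); have xs := hs n x bn.
by exists n => //; exists (index x (s n)) => //; rewrite nth_index.
Qed.
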